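(* (i) (Finitely generated hypotheses.) Let $\mathcal X$ be a measurable space, $\Phi=\{g_1,\dots,g_d\}$ a finite nonempty set of real-valued measurable functions on $\mathcal X$, and $\mathcal P$ the hypothesis generated by $\Phi$. The set of nonnegative functions of the form $1+\sum_{i=1}^d\pi_ig_i$, with $\pi\in\mathbb R^d_+$, is a complete class of e-variables for $\mathcal P$. If moreover the implication ''$g,g'\in\mathrm{cone}(\Phi)$ and $g\le g'$, $\mathcal P$-q.s. $\Rightarrow$ $g=g'$, $\mathcal P$-q.s.'' holds, this is a minimal complete class. (ii) (One-sided sub-$\psi$ hypotheses.) Let $\psi:\mathbb R\to\mathbb R\cup\{\infty\}$ be closed, convex, nonnegative, with $\psi(0)=0$ and effective domain $[0,\lambda_{\max})$ for some $\lambda_{\max}\in(0,\infty]$ or $[0,\lambda_{\max}]$ for some $\lambda_{\max}\in(0,\infty)$. Let $\mathcal X=\mathrm{dom}(\psi^* )$, let $\mathcal P$ be the set of sub-$\psi$ probability measures on $\mathcal X$, and let $\Lambda=[0,\lambda_{\max}]$. Let $\mathcal E'$ be the set of functions of the form $x\mapsto\int_\Lambda h_\lambda(x)\,\pi(d\lambda)$, $x\in\mathrm{dom}(\psi^* )$, with $\pi$ a Borel probability measure on $\Lambda$. Then $\mathcal E'$ is a complete class of e-variables for $\mathcal P$. Assume in addition that on $\mathbb R_+$, $\psi$ is the cumulant generating function of some zero-mean distribution $\bar\mu$ whose support has a cluster point in the interior of $\mathrm{dom}(\psi^* )$. There are two cases, depending on whether $\mathrm{dom}(\psi^* )$ contains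 its right endpoint: (1) if $\mathrm{dom}(\psi^* )=(-\infty,\bar x]$ with $\bar x\in[0,\infty)$, then $\mathcal E'$ is a minimal complete class; (2) if $\mathrm{dom}(\psi^* )=(-\infty,\bar x)$ with $\bar x\in[0,\infty]$, then $\mathcal E'_0$ is a minimal complete class, where $\mathcal E'_0\subset\mathcal E'$ is the set of all functions of the form $x\mapsto\int_{\Lambda_0}h_\lambda(x)\,\pi(d\lambda)$, $x\in\mathrm{dom}(\psi^* )$, with $\pi$ a Borel probability measure on $\Lambda_0=[0,\lambda_{\max})$. (iii) (Group-invariant hypotheses.) Let $\Sigma$ be a compact topological group acting measurably from the left on a measurable space $\mathcal X$, with left Haar probability measure $\pi$, and let $\mathcal P$ be the set of $\Sigma$-invariant probability measures on $\mathcal X$. The set of e-variables of the form $1+f-f_\pi$, with $f$ being $[-1,\infty]$-valued, measurable and such that $f_\pi\le 0$, is a minimal complete class of e-variables for $\mathcal P$.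
   Context: General. For a set $\mathcal P$ of probability measures on $\mathcal X$: a measurable set $A$ is $\mathcal P$-negligible if $\mu(A)=0$ for all $\mu\in\mathcal P$; a property holds $\mathcal P$-q.s. if the set where it fails is $\mathcal P$-negligible; two functions that are equal $\mathcal P$-q.s. are $\mathcal P$-versions of each other. An e-variable for $\mathcal P$ is a measurable $h:\mathcal X\to[0,\infty]$ with $\int h\,d\mu\le 1$ for all $\mu\in\mathcal P$; $\mathcal E$ denotes the set of all of them. A complete class of e-variables for $\mathcal P$ is a subset $\mathcal E'\subset\mathcal E$ such that every $h\in\mathcal E$ is $\mathcal P$-q.s. dominated by some $h'\in\mathcal E'$. A complete class $\mathcal E'$ is minimal if removing an e-variable (and all its $\mathcal P$-versions) from $\mathcal E'$ renders the class non-complete. For (i). The hypothesis generated by $\Phi$ is the set of probability measures $\mu$ with $\int|f|\,d\mu<\infty$ and $\int f\,d\mu\le 0$ for all $f\in\Phi$. $\mathrm{cone}(\Phi)$ is the set of finite linear combinations of elements of $\Phi$ with nonnegative coefficients. $\mathbb R^d_+=[0,\infty)^d$. For (ii). $\mathrm{dom}(\phi)=\{\phi<\infty\}$; closed means closed epigraph; $\psi^*(x)=\sup_{\lambda\in\mathbb R}\{\lambda x-\psi(\lambda)\}$. A probability measure $\mu$ on $\mathbb R$ is sub-$\psi$ if $\int e^{\lambda x}\mu(dx)\le e^{\psi(\lambda)}$ for all $\lambda\in\mathrm{dom}(\psi)$; all such measures are concentrated on $\mathrm{dom}(\psi^* )$, which is equipped with its Borel $\sigma$-algebra. $h_\lambda(x)=e^{\lambda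 x-\psi(\lambda)}$ for $\lambda\in[0,\lambda_{\max})$ and $h_{\lambda_{\max}}(x)=\lim_{\lambda\uparrow\lambda_{\max}}e^{\lambda x-\psi(\lambda)}$, $x\in\mathrm{dom}(\psi^* )$. $\Lambda=[0,\lambda_{\max}]$ is compact, with $\lambda_{\max}=\infty$ allowed. The cumulant generating function of $\bar\mu$ is $\lambda\mapsto\log\int e^{\lambda x}\bar\mu(dx)\in(-\infty,\infty]$. For (iii). The action is measurable if $(\sigma,x)\mapsto\sigma x$ is jointly measurable with $\Sigma$ carrying its Borel $\sigma$-algebra. $\mathcal P$ consists of the probability measures $\mu$ equal to their pushforward under $x\mapsto\sigma x$ for every $\sigma\in\Sigma$. For measurable $f$ bounded below, $f_\pi(x)=\int_\Sigma f(\sigma x)\,\pi(d\sigma)$.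
   Formalization: In (i), ''nonnegative'' is read P-q.s. and the class consists of the positive parts of 1+∑π_i g_i; in (ii)(2), E'_0 is claimed minimal complete only if dom(ψ)=[0,λ_max), and if dom(ψ)=[0,λ_max] it is E' that is shown to be minimal complete. *)

(* Defs.v *)
From HB Require Import structures.
From mathcomp Require Import all_boot all_order all_algebra.
From mathcomp Require Import all_classical all_reals all_analysis.
From mathcomp Require Import measurable_realfun.
Set Implicit Arguments.
Unset Strict Implicit.
Unset Printing Implicit Defensive.
Import Order.TTheory GRing.Theory Num.Theory.
Import numFieldNormedType.Exports.
Local Open Scope classical_set_scope.
Local Open Scope ring_scope.

Section evariables.
Context d (X : measurableType d) (R : realType).
Implicit Types (P : set (probability X R)) (h : X -> \bar R).
Local Open Scope ereal_scope.

Definition negligible_for P (A : set X) : Prop :=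
  measurable A /\ forall mu, P mu -> mu A = 0.

Definition qs P (Q : X -> Prop) : Prop := negligible_for P [set x | ~ Q x].

Definition version P h h' : Prop := qs P (fun x => h x = h' x).

Definition evariable P : set (X -> \bar R) :=
  [set h : X -> \bar R | [/\ measurable_fun setT h, (forall x, 0 <= h x) &
               forall mu, P mu -> \int[mu]_x h x <= 1]].

Definition complete_class P (E' : set (X -> \bar R)) : Prop :=
  E' `<=` evariable P /\
  forall h, evariable P h ->
    exists2 h', E' h' & qs P (fun x => h x <= h' x).

Definition minimal_complete_class P (E' : set (X -> \bar R)) : Prop :=
  complete_class P E' /\
  forall h, E' h -> ~ complete_class P (E' `\` [set h' | version P h h']).

End evariables.

Section generated_hypotheses.
Context d (X : measurableType d) (R : realType).
Implicit Types Phi : set (X -> R).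

Definition generated_hypothesis Phi : set (probability X R) :=
  [set mu : probability X R | forall f, Phi f ->
    mu.-integrable setT (EFin \o f) /\ (\int[mu]_x (f x)%:E <= 0)%E].

Definition cone Phi : set (X -> R) :=
  [set g | exists n (c : 'I_n -> R) (f : 'I_n -> X -> R),
    [/\ (forall i, 0 <= c i), (forall i, Phi (f i)) &
        g = fun x => \sum_(i < n) c i * f i x]].

Definition affine_comb n (g : 'I_n -> X -> R) (pi : 'I_n -> R) (x : X) : R :=
  1 + \sum_(i < n) pi i * g i x.

(* Nonnegativity of [affine_comb g pi] is required [P]-q.s., and the positive
   part, which changes nothing outside a negligible set, is the [0, +oo]-valued
   representative.  With nonnegativity required at every point the class need
   not be complete: on X = nat, let g 0 = (-1, 1, -2, -3, -4, ...) and
   g 1 = (0, 0, 1/2, 1/3, 1/4, ...).  The points x >= 2 are negligible, the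
   e-variable 2 * \1_[set 1] is q.s. dominated only if pi 0 >= 1, and then
   1 + pi 0 * g 0 + pi 1 * g 1 is negative at all large x. *)
Definition affine_class (P : set (probability X R)) n (g : 'I_n -> X -> R) :
    set (X -> \bar R) :=
  [set h | exists pi : 'I_n -> R,
    [/\ (forall i, 0 <= pi i), qs P (fun x => 0 <= affine_comb g pi x) &
        h = fun x => (Num.max 0 (affine_comb g pi x))%:E]].

End generated_hypotheses.

(* A subset [A] of a measurable space, with the trace sigma-algebra; the point
   [a] is there because measurable types are pointed. *)
Section trace.
Context d (T : measurableType d) (A : set T) (a : A).

Definition pointed_subset of A : Type := A.

HB.instance Definition _ := Choice.copy (pointed_subset a) (set_type A).
HB.instance Definition _ := isPointed.Build (pointed_subset a) a.

Definition trace_val (x : pointed_subset a) : T := set_val (x : A).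

Definition trace_type := g_sigma_algebra_preimageType trace_val.

End trace.

Section sub_psi.
Context (R : realType).
Implicit Types (psi : R -> \bar R) (lmax : \bar R).
Local Open Scope ereal_scope.

Definition edom (phi : R -> \bar R) : set R := [set x | phi x < +oo].

Definition closed_efun (phi : R -> \bar R) : Prop :=
  closed [set p : R * R | phi p.1 <= p.2%:E].

Definition convex_efun (phi : R -> \bar R) : Prop :=
  forall (t x y : R), (0 <= t <= 1)%R ->
    phi (t * x + (1 - t) * y)%R <= t%:E * phi x + (1 - t)%:E * phi y.

Definition econjugate (phi : R -> \bar R) (x : R) : \bar R :=
  ereal_sup [set (l * x)%:E - phi l | l in [set: R]].

Lemma econjugate_dom0 psi :
  (forall l, 0 <= psi l) -> 0%R \in edom (econjugate psi).
Proof.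
move=> psi0; rewrite inE /edom /=; apply: (@le_lt_trans _ _ 0); last by [].
apply: ge_ereal_sup => _ [l _ <-].
by rewrite mulr0 sub0e leeNl oppe0.
Qed.

Definition conj_origin psi (psi_ge0 : forall l, 0 <= psi l) :
  edom (econjugate psi) := exist _ 0%R (econjugate_dom0 psi_ge0).

Definition conj_space psi (psi_ge0 : forall l, 0 <= psi l) :=
  trace_type (conj_origin psi_ge0).

Definition conj_val psi (psi_ge0 : forall l, 0 <= psi l)
    (x : conj_space psi_ge0) : R := trace_val (a := conj_origin psi_ge0) x.

Definition sub_psi psi (psi_ge0 : forall l, 0 <= psi l) :
    set (probability (conj_space psi_ge0) R) :=
  [set mu : probability (conj_space psi_ge0) R | forall l, edom psi l ->
    \int[mu]_x (expR (l * conj_val x))%:E <= expeR (psi l)].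

Definition exp_evar psi lmax (l : \bar R) (x : R) : \bar R :=
  let h (r : R) := expeR ((r * x)%:E - psi r) in
  if l < lmax then h (fine l)
  else lim (h (fine m) @[m --> within [set m | m < lmax] (nbhs lmax)]).

Definition closed_params lmax : set (\bar R) := [set l | 0 <= l <= lmax].

Definition right_open_params lmax : set (\bar R) := [set l | 0 <= l < lmax].

(* A Borel probability measure on [L] is one on [\bar R] concentrated on [L]. *)
Definition mixture_class psi (psi_ge0 : forall l, 0 <= psi l) lmax
    (L : set (\bar R)) : set (conj_space psi_ge0 -> \bar R) :=
  [set h | exists2 pi : probability (\bar R) R, pi L = 1 &
    h = fun x => \int[pi]_(l in L) exp_evar psi lmax l (conj_val x)].

Definition msupport (mu : probability R R) : set R :=
  [set x | forall U : set R, open U -> U x -> 0 < mu U].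

Definition zero_mean (mu : probability R R) : Prop :=
  mu.-integrable setT EFin /\ \int[mu]_x x%:E = 0.

Definition cgf (mu : probability R R) (l : R) : \bar R :=
  lne (\int[mu]_x (expR (l * x))%:E).

End sub_psi.

Arguments sub_psi {R psi} psi_ge0 _.
Arguments mixture_class {R psi} psi_ge0 lmax L _.

HB.mixin Record PointedTopological_Group_isTopologicalGroup G
    & Group G & PointedTopological G := {
  mulg_continuous : continuous (fun p : G * G => (p.1 * p.2)%g) ;
  invg_continuous : continuous (fun x : G => (x^-1)%g)
}.

(* [point] is an arbitrary element; measurable types are pointed. *)
#[short(type="topologicalGroupType")]
HB.structure Definition TopologicalGroup :=
  {G of Group G & PointedTopological G
      & PointedTopological_Group_isTopologicalGroup G}.

Section group_invariance.
Context (R : realType) (G : topologicalGroupType) d (X : measurableType d).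

Definition borel_type := g_sigma_algebraType (@open G).

(* Left-invariant and regular; by complementation, outer regularity of a finite
   measure is inner regularity with respect to closed sets, which are compact
   when [G] is. *)
Definition left_haar (pi : probability borel_type R) : Prop :=
  (forall (s : G) (A : set borel_type), measurable A ->
     pi [set (s * x)%g | x in (A : set G)] = pi A) /\
  (forall A : set borel_type, measurable A ->
     pi A = ereal_inf [set pi U | U in [set U : set G | open U /\ A `<=` U]]).

Definition left_action (act : G -> X -> X) : Prop :=
  (forall x, act 1%g x = x) /\
  (forall s t x, act (s * t)%g x = act s (act t x)).

Definition measurable_action (act : G -> X -> X) : Prop :=
  measurable_fun setT (fun p : borel_type * X => act p.1 p.2).

Definition invariant_hypothesis (act : G -> X -> X) :
    set (probability X R) :=
  [set mu : probability X R | forall s (A : set X), measurable A ->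
              pushforward mu (act s) A = mu A].

Local Open Scope ereal_scope.

Definition orbit_average (act : G -> X -> X) (pi : probability borel_type R)
    (f : X -> \bar R) (x : X) : \bar R :=
  \int[pi]_s f (act s x).

Definition invariant_class (act : G -> X -> X)
    (pi : probability borel_type R) : set (X -> \bar R) :=
  [set h | evariable (invariant_hypothesis act) h /\
    exists f : X -> \bar R,
      [/\ measurable_fun setT f, (forall x, -1 <= f x),
          (forall x, orbit_average act pi f x <= 0) &
          h = fun x => 1 + f x - orbit_average act pi f x]].

End group_invariance.

Arguments invariant_hypothesis R {G d X} act _.

(* Main.v *)
(* (i) Testing an e-variable [h] against finitely supported measures gives
   [sum w_j (h x_j - 1) <= 0] whenever [sum w_j g_i(x_j) <= 0] for all [i]. If the
   convex cone generated by the vectors [g x] and the unit vectors is a subspace,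
   linear duality yields coefficients [pi] with [h <= 1 + sum pi_i g_i]. Otherwise
   some nonzero functional is nonnegative on this cone; since it integrates to at
   most [0] under each measure of [P], it vanishes q.s., and one passes to its
   kernel, of smaller rank.

   (ii) Moving the missing mass far to the left turns [sum w_j delta_{x_j}] into
   a sub-psi measure as soon as all [sum w_j h_l(x_j)] are less than [1], so that
   [sum w_j h(x_j) <= M] if [sum w_j h_l(x_j) <= M] for all [l]. By a minimax
   argument on the compact set of mixing measures, encoded by their masses on
   dyadic intervals, one mixture dominates [h] at all points simultaneously.
   For minimality, transport [mubar] to [dom psi^*]: every mixture has integral [1],
   so two of them, one below the other, agree almost surely, hence on the support
   of [mubar]. Being Laplace transforms up to the right endpoint, they agree
   everywhere by analyticity at the cluster point; an endpoint in [dom psi^*] is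
   an atom of [mubar].

   (iii) Images of Haar measure along orbits are invariant, so [h_pi <= 1] for every
   e-variable [h], and [f = h - 1] gives a dominating member of the class. Members of the
   class have integral [1] under every invariant measure, hence are maximal. *)
Require Import Defs.
From HB Require Import structures.
From mathcomp Require Import all_boot all_order all_algebra.
From mathcomp Require Import all_classical all_reals all_analysis.
From mathcomp Require Import measurable_realfun.
From mathcomp Require Import ring lra.
Set Implicit Arguments.
Unset Strict Implicit.
Unset Printing Implicit Defensive.
Import Order.TTheory GRing.Theory Num.Theory.
Import numFieldNormedType.Exports.
Local Open Scope classical_set_scope.
Local Open Scope ring_scope.

(** Minimality always comes from maximality within the class: a member lying q.s. below another
    member is a version of it.

    In (ii), consistent dyadic masses need not be the cell masses of a measure, because mass may run
    off to the right end of the half-open cells. The measure extracted from them is therefore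
    controlled through closed cells, and from one side only. This suffices: the minimax argument is
    run on upper sums over closed cells, each involving finitely many masses, and semicontinuity of
    the integrands brings the upper sums down to the integral.

    The parameter [lmax] is the other delicate point: its e-variable is only a limit, which may
    vanish identically, vanish off the right endpoint of [dom psi^*], or be a multiple of an
    exponential. Duality is therefore tested below [lmax] only, and these cases are separated only
    in the treatment of minimality. *)

Section classes.
Context d (X : measurableType d) (R : realType).
Implicit Types (P : set (probability X R)) (h : X -> \bar R).
Local Open Scope ereal_scope.

(** If the class without [h] and its versions were complete, it would contain a q.s. majorant of the
    e-variable [h], which maximality makes a version of [h]. *)
Lemma minimal_complete_classP P (E' : set (X -> \bar R)) :
  complete_class P E' ->
  (forall h h', E' h -> E' h' -> qs P (fun x => h x <= h' x) ->
     version P h h') ->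
  minimal_complete_class P E'.
Proof.
move=> cE' maxE'; split=> // h E'h [_ domE'].
have [h' [E'h' nh'] hh'] := domE' h (cE'.1 _ E'h).
by apply: nh'; exact: maxE'.
Qed.

Lemma measurable_neq_efun (f g : X -> \bar R) :
  measurable_fun setT f -> measurable_fun setT g ->
  measurable [set x | f x <> g x].
Proof.
move=> mf mg.
have -> : [set x | f x <> g x] = [set x | f x != g x].
  by apply/seteqP; split => x /= /eqP.
by rewrite -[X in measurable X]setTI; exact: measurable_neqe.
Qed.

Lemma measurable_nle_efun (f g : X -> \bar R) :
  measurable_fun setT f -> measurable_fun setT g ->
  measurable [set x | ~ (f x <= g x)].
Proof.
move=> mf mg.
have -> : [set x | ~ (f x <= g x)] = [set x | g x < f x].
  by apply/seteqP; split => x /=; rewrite ltNge => /negP.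
by rewrite -[X in measurable X]setTI; exact: measurable_lte.
Qed.

(** The difference [g - f] is integrable, nonnegative almost everywhere and of integral at most 0,
    hence null. *)
Lemma le_integral_eq_null (mu : {measure set X -> \bar R})
    (f g : X -> \bar R) :
  measurable_fun setT f -> measurable_fun setT g ->
  (forall x, 0 <= f x) -> (forall x, 0 <= g x) ->
  mu [set x | ~ (f x <= g x)] = 0 ->
  \int[mu]_x g x <= \int[mu]_x f x -> \int[mu]_x f x < +oo ->
  mu [set x | f x <> g x] = 0.
Proof.
move=> mf mg f0 g0 fg gf foo.
have If : mu.-integrable setT f.
  apply/integrableP; split=> //.
  by under eq_integral do rewrite gee0_abs//.
have Ig : mu.-integrable setT g.
  apply/integrableP; split=> //.
  by under eq_integral do rewrite gee0_abs//; exact: le_lt_trans foo.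
have Id : mu.-integrable setT (g \- f) by exact: integrableB.
have md := measurable_int _ Id.
have d0 : \int[mu]_x (g \- f) x <= 0.
  by rewrite integralB// leeBlDr ?add0e// ge0_fin_numE// integral_ge0.
have dabs : ae_eq mu setT (g \- f) (abse \o (g \- f)).
  have le_fg : {ae mu, forall x, f x <= g x}.
    by exists [set x | ~ (f x <= g x)]; split=> //; exact: measurable_nle_efun.
  apply: filterS2 le_fg (integrable_ae measurableT If) => x fgx fx _ /=.
  by rewrite gee0_abs// sube_ge0// fx.
have : \int[mu]_x `|(g \- f) x| = 0.
  apply/eqP; rewrite eq_le integral_ge0// andbT.
  have -> : \int[mu]_x `|(g \- f) x| = \int[mu]_x (g \- f) x; last by [].
  symmetry; apply: ae_eq_integral => //; exact: measurableT_comp.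
move/(ae_eq_integral_abs mu measurableT md) => [N [mN N0 sN]].
apply: (subset_measure0 _ mN _ N0); first exact: measurable_neq_efun.
move=> x /= fgx; apply: sN => /= /(_ I) d0x; apply: fgx.
move: (f0 x) (g0 x) d0x; case: (f x) => [a| |]; case: (g x) => [b| |]//= _ _.
by move=> /eqP; rewrite -EFinB eqe subr_eq0 => /eqP ->.
Qed.

Lemma integral_probability1 (mu : probability X R) : \int[mu]_x 1 = 1.
Proof. by rewrite integral_cst// mul1e; exact: probability_setT. Qed.

(** Integral 1 leaves no room below an e-variable, whose integral is at most 1. *)
Lemma version_of_integral1 P h h' : evariable P h -> evariable P h' ->
  (forall mu, P mu -> \int[mu]_x h x = 1) ->
  qs P (fun x => h x <= h' x) -> version P h h'.
Proof.
move=> [mh h0 _] [mh' h'0 ih'] ih [_ hh']; split.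
  exact: measurable_neq_efun.
move=> mu Pmu; apply: le_integral_eq_null => //; first exact: hh'.
  by rewrite ih//; exact: ih'.
by rewrite ih// ltry.
Qed.

End classes.

Lemma pushforward_probability d d' (T : measurableType d)
    (T' : measurableType d') (R : realType) (P : probability T R)
    (f : T -> T') : measurable_fun setT f ->
  exists Q : probability T' R, (forall A, Q A = P (f @^-1` A)) /\
    (forall g : T' -> \bar R, measurable_fun setT g ->
       (forall y, 0 <= g y)%E -> \int[Q]_y g y = \int[P]_x g (f x))%E.
Proof.
move=> mf; pose fm := isMeasurableFun.Build _ _ _ _ _ mf.
pose F : {mfun T >-> T'} := HB.pack f fm.
exists (distribution P F); split=> // g mg g0.
by rewrite ge0_integral_distribution.
Qed.

(** * Finitely generated hypotheses *)

Section cones.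
Context (R : realType) (T : Type).
Implicit Types (D : set T) (b : T -> R).

(* [D] parametrizes a convex cone of which only the coordinates [e] and the
   additive, positively homogeneous function [b] are seen. *)
Definition conic_for n D (e : 'I_n -> T -> R) b :=
  forall u v s t, D u -> D v -> 0 <= s -> 0 <= t ->
    exists w, [/\ D w, b w = s * b u + t * b v &
                 forall i, e i w = s * e i u + t * e i v].

(** A finite-dimensional Hahn-Banach argument by induction on the coordinates. The slope [p] along
    the last one is fixed on the elements [Z] whose other coordinates vanish; once [p * e ord_max]
    is subtracted from [b], the kernel condition holds for the remaining coordinates. *)
Lemma linear_majorant n D (e : 'I_n -> T -> R) b :
  conic_for D e b ->
  (forall u, D u -> exists2 v, D v & forall i, e i v = - e i u) ->
  (forall u, D u -> (forall i, e i u = 0) -> b u <= 0) ->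
  exists p : 'I_n -> R, forall u, D u -> b u <= \sum_(i < n) p i * e i u.
Proof.
elim: n e b => [|n IHn] e b comb neg kerb.
  exists (fun=> 0) => u Du; rewrite big_ord0.
  by apply: kerb => // -[].
pose e' j := e (lift ord_max j).
pose Z u := D u /\ forall j, e' j u = 0.
have eP (Q : 'I_n.+1 -> Prop) :
    (forall j, Q (lift ord_max j)) -> Q ord_max -> forall i, Q i.
  by move=> Qj Qm i; case: (unliftP ord_max i) => [j|] ->.
have [p pZ] : exists p, forall u, Z u -> b u <= p * e ord_max u.
  have [[u0 [Zu0 eu0]]|noZ] := pselect (exists u, Z u /\ 0 < e ord_max u).
    pose S := [set s | exists u, [/\ Z u, 0 < e ord_max u &
                                    s = b u / e ord_max u]].
    (* [S] collects the lower bounds on the slope; elements with negative last coordinate give upper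
       bounds. They are compatible because the combination of [u] and [v] with weights
       [- e ord_max v] and [e ord_max u] lies in the kernel. *)
    have ub v : Z v -> e ord_max v < 0 -> ubound S (b v / e ord_max v).
      move=> [Dv Zv] ev _ [u [[Du Zu] eu ->]].
      have ev' : 0 <= - e ord_max v by rewrite oppr_ge0 ltW.
      have [w [Dw bw ew]] := comb u v _ _ Du Dv ev' (ltW eu).
      have : b w <= 0.
        apply: kerb => //; apply: eP => [j|]; rewrite ew; last by ring.
        by rewrite -/(e' j u) -/(e' j v) Zu Zv !mulr0 addr0.
      rewrite bw ler_pdivrMr// mulrAC ler_ndivlMr// => H.
      by rewrite -subr_ge0 in H *; lra.
    have [v Dv ev] := neg _ Zu0.1.
    have Zv : Z v by split=> // j; rewrite /e' ev -/(e' j u0) Zu0.2 oppr0.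
    have ev0 : e ord_max v < 0 by rewrite ev oppr_lt0.
    have hS : has_sup S.
      by split; [exists (b u0 / e ord_max u0), u0 | exists (b v / e ord_max v); exact: ub].
    exists (sup S) => u [Du Zu].
    have [eu|eu|eu] := ltgtP (e ord_max u) 0.
    - rewrite -ler_ndivlMr//; apply: ge_sup; first exact: hS.1.
      by apply: ub.
    - by rewrite -ler_pdivrMr//; apply: ub_le_sup; [exact: hS.2|exists u].
    - rewrite eu mulr0; apply: kerb => //; exact: eP.
  (* No element of [Z] has a positive last coordinate, hence by [neg] none has a negative one: the
     slope is free. *)
  exists 0 => u [Du Zu]; rewrite mul0r; apply: kerb => //; apply: eP => //.
  have [eu|eu|//] := ltgtP (e ord_max u) 0; exfalso; apply: noZ; last by exists u.
  have [v Dv ev] := neg _ Du; exists v; split; last by rewrite ev oppr_gt0.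
  by split=> // j; rewrite /e' ev -/(e' j u) Zu oppr0.
have [||| p' p'P] := IHn e' (fun u => b u - p * e ord_max u).
- move=> u v s t Du Dv s0 t0; have [w [Dw bw ew]] := comb u v s t Du Dv s0 t0.
  exists w; split=> // [|j]; last exact: ew.
  by rewrite bw ew; ring.
- by move=> u Du; have [v Dv ev] := neg _ Du; exists v => // j; exact: ev.
- by move=> u Du eu; rewrite subr_le0; exact: pZ.
exists (fun i => if unlift ord_max i is Some j then p' j else p) => u Du.
rewrite (bigD1_ord ord_max)//= unlift_none.
under eq_bigr do rewrite liftK.
by rewrite -lerBlDl; exact: p'P.
Qed.

(** If the projection forgetting the last coordinate is not a subspace, induction applies. If it is
    one, the cone meets the last axis in a half-line only, and [linear_majorant] on the other
    coordinates tilts the last coordinate into a functional that is nonnegative on the whole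
    cone. *)
Lemma supporting_functional n D (e : 'I_n -> T -> R) u0 :
  conic_for D e (fun=> 0) -> D u0 ->
  (forall v, D v -> ~ forall i, e i v = - e i u0) ->
  exists l : 'I_n -> R, (forall u, D u -> 0 <= \sum_(i < n) l i * e i u) /\
    exists2 u, D u & 0 < \sum_(i < n) l i * e i u.
Proof.
elim: n e u0 => [|n IHn] e u0 comb Du0 noneg.
  by exfalso; apply: (noneg u0) => // -[].
pose e' j := e (lift ord_max j).
have eP (Q : 'I_n.+1 -> Prop) :
    (forall j, Q (lift ord_max j)) -> Q ord_max -> forall i, Q i.
  by move=> Qj Qm i; case: (unliftP ord_max i) => [j|] ->.
have comb' : conic_for D e' (fun=> 0).
  move=> u v s t Du Dv s0 t0; have [w [Dw bw ew]] := comb u v s t Du Dv s0 t0.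
  by exists w; split=> // j; exact: ew.
have [neg|] := pselect (forall u, D u -> exists2 v, D v & forall j, e' j v = - e' j u);
    last first.
  move=> /existsNP[u /not_implyP[Du nu]].
  have [|l [l0 [v Dv lv]]] := IHn e' u comb' Du.
    by move=> v Dv ev; apply: nu; exists v.
  exists (fun i => if unlift ord_max i is Some j then l j else 0).
  have lE x : \sum_(i < n.+1)
       (if unlift ord_max i is Some j then l j else 0) * e i x =
       \sum_(j < n) l j * e' j x.
    rewrite (bigD1_ord ord_max)//= unlift_none mul0r add0r.
    by under eq_bigr do rewrite liftK.
  split=> [x Dx|]; first by rewrite lE; exact: l0.
  by exists v => //; rewrite lE.
have [v Dv ev] := neg _ Du0.
(* [w] lies on the last axis. Its coordinate [t] is nonzero, since otherwise [v] would be opposite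
   to [u0]; the sign of [t] orients the half-line. *)
have [w [Dw _ ew]] := comb u0 v 1 1 Du0 Dv ler01 ler01.
have Zw j : e' j w = 0 by rewrite /e' ew !mul1r -/(e' j v) ev subrr.
set m := e ord_max; set t := m w.
have vE : m v = t - m u0 by rewrite /t /m ew; ring.
have sgn z : D z -> (forall j, e' j z = 0) -> 0 < t * - m z -> False.
  move=> Dz Zz tz.
  have mz : m z != 0 by apply: contraTneq tz => ->; rewrite oppr0 mulr0 ltxx.
  (* With this weight, adding [z] turns the last coordinate [t - m u0] of [v] into [- m u0],
     producing a forbidden opposite of [u0]. *)
  have c0 : 0 <= t / - m z.
    have -> : t / - m z = (t * - m z) / m z ^+ 2 by field.
    by rewrite divr_ge0 ?sqr_ge0// ltW.
  have [y [Dy _ ey]] := comb v z 1 _ Dv Dz ler01 c0.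
  apply: (noneg y) => //; apply: eP => [j|].
    by rewrite ey -/(e' j z) Zz mulr0 addr0 mul1r; exact: ev.
  rewrite ey -/m -/(m z) -/(m v) vE; by field.
have t0 : t != 0.
  apply/eqP => t0; apply: (noneg v) => //; apply: eP => // .
  by rewrite -/m -/(m v) vE t0 sub0r.
have sg u : D u -> (forall j, e' j u = 0) -> 0 <= t * m u.
  by move=> Du Zu; rewrite leNgt; apply/negP => tu; apply: (sgn u) => //;
    rewrite mulrN oppr_gt0.
have [||| p pP] := @linear_majorant n D e' (fun u => - (t * m u)).
- move=> u z a c Du Dz a0 c0; have [y [Dy _ ey]] := comb u z a c Du Dz a0 c0.
  by exists y; split=> // [|j]; [rewrite /m ey; ring|exact: ey].
- by [].
- by move=> u Du Zu; rewrite oppr_le0; exact: sg.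
exists (fun i => if unlift ord_max i is Some j then p j else t).
have lE x : \sum_(i < n.+1)
     (if unlift ord_max i is Some j then p j else t) * e i x =
     t * m x + \sum_(j < n) p j * e' j x.
  rewrite (bigD1_ord ord_max)//= unlift_none.
  by under eq_bigr do rewrite liftK.
split=> [u Du|]; first by rewrite lE -lerBlDl sub0r; exact: pP.
exists w => //; rewrite lE big1 ?addr0; last by move=> j _; rewrite Zw mulr0.
by rewrite -expr2 lt_neqAle sqr_ge0 eq_sym sqrf_eq0 t0.
Qed.

End cones.

(** * Finitely supported measures *)

Section discrete.
Context d (X : measurableType d) (R : realType).
Local Open Scope ereal_scope.

Lemma discrete_measure (s : seq (R * X)) :
  (forall q, q \in s -> (0 <= q.1)%R) ->
  exists mu : {measure set X -> \bar R}, forall f : X -> \bar R,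
    measurable_fun setT f -> (forall x, 0 <= f x) ->
    \int[mu]_x f x = \sum_(q <- s) q.1%:E * f q.2.
Proof.
elim: s => [_|[c x] s IHs s0].
  exists (@mzero _ X R) => f mf f0.
  by rewrite big_nil; exact: integral_measure_zero.
have [|mu muE] := IHs; first by move=> q qs; apply: s0; rewrite inE qs orbT.
have c0 : (0 <= c)%R by apply: (s0 (c, x)); rewrite inE eqxx.
exists (measure_add (mscale (NngNum c0) (\d_x)) mu) => f mf f0.
rewrite big_cons/= ge0_integral_measure_add// muE//; congr (_ + _).
by rewrite ge0_integral_mscale//= integral_dirac//= diracT mul1e.
Qed.

Lemma discrete_probability (s : seq (R * X)) :
  (forall q, q \in s -> (0 <= q.1)%R) -> (\sum_(q <- s) q.1 = 1)%R ->
  exists mu : probability X R, forall f : X -> \bar R,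
    measurable_fun setT f -> (forall x, 0 <= f x) ->
    \int[mu]_x f x = \sum_(q <- s) q.1%:E * f q.2.
Proof.
move=> s0 s1; have [mu muE] := discrete_measure s0.
have mu1 : mu setT = 1.
  have := muE (cst 1) (measurable_cst 1) (fun=> lee01).
  rewrite integral_cst// mul1e => ->.
  by under eq_bigr do rewrite mule1; rewrite sumEFin s1.
(* The total mass is 1, so normalizing changes no value and only supplies the structure of a
   probability. *)
exists (mnormalize mu (\d_ (point : X))) => f mf f0; rewrite -muE//.
apply: eq_measure_integral => A mA _.
rewrite /= /mnormalize [mu setT]mu1 onee_eq0/= invr1; exact: mule1.
Qed.

Lemma discrete_integral (s : seq (R * X)) (mu : probability X R) :
  (forall f : X -> \bar R,
    measurable_fun setT f -> (forall x, 0 <= f x) ->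
    \int[mu]_x f x = \sum_(q <- s) q.1%:E * f q.2) ->
  forall f : X -> R, measurable_fun setT f ->
    mu.-integrable setT (EFin \o f) /\
    \int[mu]_x (f x)%:E = (\sum_(q <- s) q.1 * f q.2)%:E.
Proof.
move=> muE f mf; have mEf : measurable_fun setT (EFin \o f).
  exact/measurable_EFinP.
split.
  apply/integrableP; split=> //; rewrite muE//; last exact: measurableT_comp.
  by under eq_bigr do rewrite -EFinM; rewrite sumEFin ltry.
rewrite integralE !muE//; last 2 first.
- exact: measurable_funeneg.
- exact: measurable_funepos.
rewrite (eq_bigr (fun q => (q.1 * Num.max (f q.2) 0)%:E)); last first.
  by move=> q _; rewrite funeposE/= -EFin_max.
rewrite [X in _ - X](eq_bigr (fun q => (q.1 * Num.max (- f q.2) 0)%:E)); last first.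
  by move=> q _; rewrite funenegE/= -EFin_max.
rewrite !sumEFin -EFinB -sumrB; congr EFin; apply: eq_bigr => q _.
rewrite -mulrBr; congr (_ * _)%R.
by rewrite /Num.max; case: ifPn; case: ifPn => /=; lra.
Qed.

End discrete.

(** * Domination by affine combinations of the generators *)

Section generated.
Context d (X : measurableType d) (R : realType) (n : nat).
Variables (g : 'I_n -> X -> R).
Hypothesis mg : forall i, measurable_fun setT (g i).
Let P := @generated_hypothesis d X R (range g).

Let Pg mu i : P mu -> mu.-integrable setT (EFin \o g i) /\
  (\int[mu]_x (g i x)%:E <= 0)%E.
Proof. by move=> Pmu; apply: Pmu; exists i. Qed.

Let dot (p : 'I_n -> R) x := \sum_(i < n) p i * g i x.

Let mdot p : measurable_fun setT (dot p).
Proof. by apply: measurable_sum => i; exact: measurable_funM. Qed.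

Let measurable_affine p : measurable_fun setT (affine_comb g p).
Proof. by apply: measurable_funD; [exact: measurable_cst|exact: mdot]. Qed.

Let mmax p :
  measurable_fun setT (fun x => (Num.max 0 (affine_comb g p x))%:E).
Proof.
by apply/measurable_EFinP; apply: measurable_maxr; [exact: measurable_cst|].
Qed.

Let integral_dot p mu : P mu -> mu.-integrable setT (EFin \o dot p) /\
  (\int[mu]_x (dot p x)%:E = \sum_(i < n) (p i)%:E * \int[mu]_x (g i x)%:E)%E.
Proof.
move=> Pmu.
have Ii i : mu.-integrable setT (fun x => (p i)%:E * (g i x)%:E)%E.
  by apply: integrableZl => //; exact: (Pg i Pmu).1.
have dotE : EFin \o dot p = (fun x => \sum_(i < n) (p i)%:E * (g i x)%:E)%E.
  by apply/funext => x /=; rewrite -sumEFin.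
split; first by rewrite dotE; apply: integrable_sum => // i _; exact: Ii.
rewrite [X in (\int[_]_x X x)%E]dotE integral_sum//.
by apply: eq_bigr => i _; rewrite integralZl//; exact: (Pg i Pmu).1.
Qed.

(** Divided by their sum, the weights define a measure of [P]; this is its constraint on [h], with
    the normalization cleared. *)
Lemma finite_support_le (h : X -> \bar R) (s : seq (R * X)) :
  evariable P h -> (forall q, q \in s -> 0 <= q.1) ->
  (forall i, \sum_(q <- s) q.1 * g i q.2 <= 0) ->
  (forall q, q \in s -> (h q.2 < +oo)%E) ->
  \sum_(q <- s) q.1 * (fine (h q.2) - 1) <= 0.
Proof.
move=> [mh h0 ih] s0 sg hoo; pose W := \sum_(q <- s) q.1.
have W0 : 0 <= W by rewrite /W big_seq; apply: sumr_ge0 => q /s0.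
have [W00|Wn0] := eqVneq W 0.
  have q0 q : q \in s -> q.1 = 0.
    move=> qs; move: W00 => /eqP; rewrite /W big_seq psumr_eq0; last exact: s0.
    by move=> /allP/(_ q qs); rewrite qs => /eqP.
  by rewrite big_seq big1// => q /q0 ->; rewrite mul0r.
have {W0 Wn0}W0 : 0 < W by rewrite lt_neqAle eq_sym Wn0.
pose s' := [seq (q.1 / W, q.2) | q <- s].
have s'0 q : q \in s' -> 0 <= q.1.
  by case/mapP => q' qs ->; rewrite divr_ge0 ?s0// ltW.
have s'1 : \sum_(q <- s') q.1 = 1.
  by rewrite big_map/= -mulr_suml divff// gt_eqF.
have [mu muE] := discrete_probability s'0 s'1.
have Pmu : P mu.
  move=> _ [i _ <-]; have [Ii ->] := discrete_integral muE (mg i).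
  split=> //; rewrite lee_fin big_map/=.
  under eq_bigr do rewrite mulrAC.
  by rewrite -mulr_suml pmulr_lle0// invr_gt0.
have := ih mu Pmu; rewrite muE// big_map/= big_seq.
rewrite (eq_bigr (fun q => (q.1 / W * fine (h q.2))%:E)); last first.
  by move=> q qs; rewrite [in RHS]EFinM fineK// ge0_fin_numE// hoo.
rewrite sumEFin lee_fin -big_seq.
under eq_bigr do rewrite mulrAC.
rewrite -mulr_suml ler_pdivrMr// mul1r => H.
under eq_bigr do rewrite mulrBr mulr1.
by rewrite sumrB subr_le0.
Qed.

(* The generators are the vectors [g x], [x] in [W], and the unit vectors indexed
   by [I].  If they do not span a subspace as a cone, a supporting functional [l]
   vanishes [P]-q.s. on them, and one passes to its kernel. *)
Lemma dominating_combination (h : X -> \bar R) r (B : 'M[R]_n) (I : pred 'I_n)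
    (W : set X) : evariable P h -> (\rank B < r)%N ->
  measurable W -> (forall mu, P mu -> mu (~` W) = 0%E) ->
  (forall mu, P mu -> forall i, ~~ I i -> (\int[mu]_x (g i x)%:E = 0)%E) ->
  (forall x, W x -> (\row_i g i x <= B)%MS) ->
  (forall i, I i -> (delta_mx 0 i : 'rV_n) <= B)%MS ->
  (forall x, W x -> (h x < +oo)%E) ->
  exists (p : 'I_n -> R) (W' : set X),
    [/\ measurable W', W' `<=` W, (forall mu, P mu -> mu (~` W') = 0%E),
        (forall i, I i -> 0 <= p i) &
        forall x, W' x -> fine (h x) <= 1 + dot p x].
Proof.
move=> evh; elim: r B I W => // r IHr B I W rB mW nW I0 WB IB hoo.
(* An element of the cone is a weighted list of points of [W] together with coefficients of the unit
   vectors indexed by [I]. The unit vectors force [0 <= p i] for [i] in [I]; outside [I] the sign is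
   free, as [g i] then has integral 0 under [P]. *)
pose D := [set u : seq (R * X) * ('I_n -> R) |
  (forall q, q \in u.1 -> 0 <= q.1 /\ W q.2) /\
  (forall i, 0 <= u.2 i /\ (~~ I i -> u.2 i = 0))].
pose e i (u : seq (R * X) * ('I_n -> R)) :=
  \sum_(q <- u.1) q.1 * g i q.2 + u.2 i.
pose b (u : seq (R * X) * ('I_n -> R)) :=
  \sum_(q <- u.1) q.1 * (fine (h q.2) - 1).
have comb : conic_for D e b.
  move=> u v s t [Du1 Du2] [Dv1 Dv2] s0 t0.
  have sumE (f : X -> R) :
      \sum_(q <- [seq (s * q.1, q.2) | q <- u.1] ++
                 [seq (t * q.1, q.2) | q <- v.1]) q.1 * f q.2 =
      s * (\sum_(q <- u.1) q.1 * f q.2) + t * (\sum_(q <- v.1) q.1 * f q.2).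
    rewrite big_cat !big_map/= !mulr_sumr.
    by congr (_ + _); apply: eq_bigr => q _; rewrite mulrA.
  exists ([seq (s * q.1, q.2) | q <- u.1] ++ [seq (t * q.1, q.2) | q <- v.1],
          fun i => s * u.2 i + t * v.2 i); split.
  - split=> [q|i]; last first.
      split=> [|nI]; last by rewrite /= (Du2 i).2// (Dv2 i).2// !mulr0 addr0.
      by rewrite addr_ge0// mulr_ge0// ?(Du2 i).1 ?(Dv2 i).1.
    rewrite mem_cat => /orP[] /mapP[q' q's ->] /=.
      by have [q0 Wq] := Du1 _ q's; rewrite mulr_ge0.
    by have [q0 Wq] := Dv1 _ q's; rewrite mulr_ge0.
  - exact: (sumE (fun x => fine (h x) - 1)).
  - by move=> i; rewrite /e/= (sumE (g i)); ring.
pose pt x : seq (R * X) * ('I_n -> R) := ([:: (1, x)], fun=> 0).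
pose un i : seq (R * X) * ('I_n -> R) := ([::], fun j => (j == i)%:R).
have Dpt x : W x -> D (pt x).
  by move=> Wx; split=> [q|i//]; rewrite inE => /eqP ->.
have Dun i : I i -> D (un i).
  move=> Ii; split=> // j; rewrite ler0n; split=> // nIj /=.
  by case: eqP => // ji; rewrite ji Ii in nIj.
have ept i x : e i (pt x) = g i x by rewrite /e big_seq1 mul1r addr0.
have eun i j : e j (un i) = (j == i)%:R by rewrite /e big_nil add0r.
have sum_un (l : 'I_n -> R) i : \sum_j l j * e j (un i) = l i.
  rewrite (bigD1 i)//= eun eqxx mulr1 big1 ?addr0// => j ji.
  by rewrite eun (negbTE ji) mulr0.
have sum_pt (l : 'I_n -> R) x : \sum_j l j * e j (pt x) = dot l x.
  by apply: eq_bigr => j _; rewrite ept.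
have [neg|] := pselect (forall u, D u -> exists2 v, D v &
    forall i, e i v = - e i u).
  have [|p pP] := linear_majorant comb neg.
    move=> u [Du1 Du2] eu; apply: (finite_support_le evh) => [q /Du1[]//|i|q].
      have := eu i; rewrite /e => /eqP; rewrite addr_eq0 => /eqP ->.
      by rewrite oppr_le0; exact: (Du2 i).1.
    by move=> /Du1[_]; exact: hoo.
  exists p, W; split=> // [i Ii|x Wx].
    by have := pP _ (Dun i Ii); rewrite sum_un /b big_nil.
  by have := pP _ (Dpt x Wx); rewrite sum_pt /b big_seq1 mul1r lerBlDl.
move=> /existsNP[u0 /not_implyP[Du0 nu0]].
have comb0 : conic_for D e (fun=> 0).
  move=> u v s t Du Dv s0 t0; have [w [Dw _ ew]] := comb u v s t Du Dv s0 t0.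
  by exists w; split=> //; rewrite !mulr0 addr0.
have [|l [l0 [u Du lu]]] := supporting_functional comb0 Du0.
  by move=> v Dv ev; apply: nu0; exists v.
have lW x : W x -> 0 <= dot l x by move=> /Dpt/l0; rewrite sum_pt.
have lI i : I i -> 0 <= l i by move=> /Dun/l0; rewrite sum_un.
pose W1 := W `&` [set x | dot l x = 0].
pose I1 := [pred i | I i && (l i == 0)].
have mW1 : measurable W1.
  apply: measurableI => //; rewrite -[X in measurable X]setTI.
  exact: (mdot l measurableT (measurable_set1 0)).
have term_le0 mu i : P mu -> ((l i)%:E * \int[mu]_x (g i x)%:E <= 0)%E.
  move=> Pmu; have [Ii|nI] := boolP (I i); last by rewrite I0// mule0.
  by rewrite mule_ge0_le0// ?lee_fin ?lI//; exact: (Pg i Pmu).2.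
(* [dot l] is nonnegative on [W], while its integral is a sum of nonpositive terms: the function
   vanishes almost everywhere, and every term vanishes. The positive part [F] makes it nonnegative
   at all points. *)
have ae0 mu : P mu -> (mu (W `\` W1) = 0 /\
    forall i, (l i)%:E * \int[mu]_x (g i x)%:E = 0)%E.
  move=> Pmu; have [Il ilE] := integral_dot l Pmu.
  pose F x := Num.max (dot l x) 0.
  have mF : measurable_fun setT (EFin \o F).
    apply/measurable_EFinP; apply: measurable_maxr; [exact: mdot|exact: measurable_cst].
  have F0 x : (0 <= (F x)%:E)%E by rewrite lee_fin le_max lexx orbT.
  have FE : (\int[mu]_x (F x)%:E = \int[mu]_x (dot l x)%:E)%E.
    apply: ae_eq_integral => //; first exact: measurable_int Il.
    exists (~` W); split; [exact: measurableC|exact: nW|].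
    move=> x /= nx Wx; apply: nx => _ /=; rewrite /F max_l//; exact: lW.
  have iF0 : (\int[mu]_x (F x)%:E <= 0)%E.
    by rewrite FE ilE; apply: sume_le0 => i _; exact: term_le0.
  split.
    have F_null : mu [set x | cst 0 x <> (F x)%:E]%E = 0%E.
      apply: (@le_integral_eq_null _ _ _ mu (cst 0%E)) => //.
      - by rewrite (_ : [set x | _] = set0)// -subset0 => x /=; apply; exact: F0.
      - by rewrite integral0.
      - by rewrite integral0 ltry.
    apply: subset_measure0 F_null; [exact: measurableD| |].
      exact: (measurable_neq_efun (measurable_cst 0%E) mF).
    move=> x [Wx nW1x] /= [Fx]; apply: nW1x; split=> //=.
    by move: Fx; rewrite /F max_l//; exact: lW.
  move=> i; apply/eqP; rewrite eq_le term_le0//=.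
  have : (0 <= \int[mu]_x (F x)%:E)%E by apply: integral_ge0.
  rewrite FE ilE (bigD1 i)//= => /le_trans; apply.
  by rewrite -[leRHS]adde0 leeD2l//; apply: sume_le0 => j _; exact: term_le0.
pose Bl := (B :&: kermx (\col_i l i))%MS.
have in_ker (v : 'rV_n) : (v *m \col_i l i == 0) = (\sum_i l i * v 0 i == 0).
  have -> : v *m \col_i l i = (\sum_i l i * v 0 i)%:M.
    apply/matrixP => a c; rewrite !ord1 !mxE eqxx mulr1n.
    by apply: eq_bigr => i _; rewrite !mxE mulrC.
  by rewrite -scalemx1 scaler_eq0 oner_eq0 orbF.
have in_ker_pt x : (\row_i g i x <= kermx (\col_i l i))%MS = (dot l x == 0).
  by rewrite sub_kermx in_ker; under eq_bigr do rewrite mxE.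
have in_ker_un i : ((delta_mx 0 i : 'rV_n) <= kermx (\col_i l i))%MS = (l i == 0).
  rewrite sub_kermx in_ker (bigD1 i)//= mxE !eqxx mulr1 big1 ?addr0// => j ji.
  by rewrite mxE (negbTE ji) andbF mulr0.
(* The rank drops because [l] is positive at [u], a combination of generators lying in [B]. *)
have ltB : (\rank Bl < \rank B)%N.
  apply: rank_ltmx; rewrite ltmxE capmxSl/=; apply/negP => BBl.
  have Bker : (B <= kermx (\col_i l i))%MS.
    by apply: submx_trans BBl _; exact: capmxSr.
  move: lu; rewrite (_ : \sum_i _ = 0) ?ltxx//.
  rewrite /e; under eq_bigr do rewrite mulrDr mulr_sumr.
  rewrite big_split/= exchange_big/= big_seq big1 ?add0r => [|q qs].
    apply: big1 => i _; have [Ii|nI] := boolP (I i).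
      have /eqP -> : l i == 0 by rewrite -in_ker_un (submx_trans (IB _ Ii)).
      by rewrite mul0r.
    by rewrite (Du.2 i).2// mulr0.
  have /eqP dq : dot l q.2 == 0.
    by rewrite -in_ker_pt (submx_trans (WB _ (Du.1 _ qs).2)).
  rewrite (eq_bigr (fun i => q.1 * (l i * g i q.2))) => [|i _]; last by ring.
  by rewrite -mulr_sumr -/(dot l q.2) dq mulr0.
have [|||||||p1 [W' [mW' W'W nW' p10 hp1]]] := IHr Bl I1 W1.
- exact: leq_trans ltB _.
- exact: mW1.
- move=> mu Pmu; have [W10 _] := ae0 mu Pmu.
  apply: (@subset_measure0 _ _ _ mu _ (~` W `|` (W `\` W1))).
  + exact: measurableC.
  + by apply: measurableU; [exact: measurableC|exact: measurableD].
  + by move=> x nx; have [Wx|] := pselect (W x); [right|left].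
  + by apply: null_set_setU; [exact: measurableC|exact: measurableD|exact: nW|].
- move=> mu Pmu i; rewrite negb_and => /orP[nI|li]; first exact: I0.
  have [_ /(_ i)/eqP] := ae0 mu Pmu.
  by rewrite mule_eq0 eqe (negbTE li)/= => /eqP.
- by move=> x [Wx /= lx]; rewrite sub_capmx WB// in_ker_pt lx eqxx.
- by move=> i /andP[Ii li]; rewrite sub_capmx IB// in_ker_un.
- by move=> x [Wx _]; exact: hoo.
(* The recursion controls the sign of [p1] only where [l] vanishes. Adding [M * l] repairs the
   indices with [l i > 0] and changes nothing on [W'], where [dot l] is 0. *)
pose M := \sum_(i | l i != 0) `|p1 i / l i|.
have M0 : 0 <= M by exact: sumr_ge0.
exists (fun i => p1 i + M * l i), W'; split=> //.
- exact: subset_trans W'W (@subIsetl _ _ _).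
- move=> i Ii; have [li|li] := eqVneq (l i) 0.
    by rewrite li mulr0 addr0; apply: p10; rewrite /= Ii li eqxx.
  have li0 : 0 < l i by rewrite lt_neqAle eq_sym li lI.
  rewrite -lerBlDl sub0r -ler_pdivrMr//.
  apply: (@le_trans _ _ `|p1 i / l i|); first by rewrite -normrN -mulNr ler_norm.
  by rewrite /M (bigD1 i)//= lerDl sumr_ge0.
move=> x W'x; rewrite (le_trans (hp1 _ W'x))// lerD2l.
have [_ /= lx] := W'W _ W'x.
rewrite /dot; under [leRHS]eq_bigr do rewrite mulrDl -mulrA.
by rewrite big_split/= -mulr_sumr -/(dot l x) lx mulr0 addr0.
Qed.

Lemma affine_class_complete :
  complete_class P (affine_class P g).
Proof.
have max_ae p mu : P mu -> qs P (fun x => 0 <= affine_comb g p x) ->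
    (forall i, 0 <= p i) ->
    (\int[mu]_x (Num.max 0 (affine_comb g p x))%:E <= 1)%E.
  move=> Pmu [ma na] p0; have [Id idE] := integral_dot p Pmu.
  have -> : (\int[mu]_x (Num.max 0 (affine_comb g p x))%:E =
             \int[mu]_x (1 + (dot p x)%:E))%E.
    apply: ae_eq_integral; [by []|exact: mmax| |].
    - by apply: emeasurable_funD => //; exact: measurable_int Id.
    exists [set x | ~ 0 <= affine_comb g p x]; split=> //; first exact: na.
    move=> x /= nx ax; apply: nx => _.
    by rewrite max_r// -EFinD.
  rewrite integralD//; last exact: finite_measure_integrable_cst.
  rewrite integral_probability1 idE.
  rewrite -[leRHS]adde0 leeD2l//; apply: sume_le0 => i _.
  by rewrite mule_ge0_le0// ?lee_fin//; exact: (Pg i Pmu).2.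
split.
  move=> _ [p [p0 ap ->]]; split.
  - exact: mmax.
  - by move=> x; rewrite lee_fin le_max lexx.
  - by move=> mu Pmu; exact: max_ae.
move=> h evh; have [mh h0 ih] := evh.
pose W := [set x | (h x < +oo)%E].
have mW : measurable W.
  rewrite -[X in measurable X]setTI.
  by apply: measurable_lte => //; exact: measurable_cst.
have nW mu : P mu -> mu (~` W) = 0%E.
  move=> Pmu.
  have Ih : mu.-integrable setT h.
    apply/integrableP; split=> //; under eq_integral do rewrite gee0_abs//.
    by apply: le_lt_trans (ih mu Pmu) _; rewrite ltry.
  have [N [mN N0 sN]] := integrable_ae measurableT Ih.
  apply: (subset_measure0 _ mN _ N0); first exact: measurableC.
  move=> x; rewrite /W /= => /negP; rewrite -leNgt leye_eq => /eqP hx.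
  by apply: sN => /= /(_ I); rewrite hx.
have [|||||p [W' [mW' W'W nW' p0 hp]]] :=
  @dominating_combination h (\rank (1%:M : 'M[R]_n)).+1 1%:M predT W evh _ mW nW.
- by [].
- by [].
- by move=> x _; exact: submx1.
- by move=> i _; exact: submx1.
- by [].
have {}hp x : W' x -> (h x <= (affine_comb g p x)%:E)%E /\ 0 <= affine_comb g p x.
  move=> W'x; have := hp x W'x; have := h0 x; have := W'W x W'x; rewrite /W/=.
  case: (h x) => //= r _; rewrite !lee_fin => r0 rp; split=> //.
  exact: le_trans rp.
have neg_sub (Q : set X) : measurable Q -> W' `<=` ~` Q ->
    forall mu, P mu -> mu Q = 0%E.
  move=> mQ W'Q mu Pmu; apply: (subset_measure0 mQ _ _ (nW' mu Pmu)).
    exact: measurableC.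
  by move=> x Qx W'x; exact: (W'Q x).
have ap : qs P (fun x => 0 <= affine_comb g p x).
  have mQ : measurable [set x | ~ 0 <= affine_comb g p x].
    rewrite (_ : [set x | _] = ~` [set x | 0 <= affine_comb g p x])//.
    apply: measurableC; rewrite -[X in measurable X]setTI.
    exact: measurable_fun_le (measurable_cst _) _.
  by split=> //; apply: neg_sub => // x /hp[_ a0]; exact.
exists (fun x => (Num.max 0 (affine_comb g p x))%:E).
  exists p; split=> // i; exact: p0.
split.
  exact: measurable_nle_efun.
apply: neg_sub.
  exact: measurable_nle_efun.
by move=> x /hp[hx a0] /=; apply; rewrite max_r.
Qed.

Lemma affine_class_minimal :
  (forall f f' : X -> R, cone (range g) f -> cone (range g) f' ->
     qs P (fun x => f x <= f' x) -> qs P (fun x => f x = f' x)) ->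
  minimal_complete_class P (affine_class P g).
Proof.
move=> eq_cone; apply: minimal_complete_classP affine_class_complete _.
move=> _ _ [p [p0 [ma a0] ->]] [p' [p'0 [ma' a'0] ->]] [mle le0].
have cone_dot q : (forall i, 0 <= q i) -> cone (range g) (dot q).
  by move=> q0; exists n, q, g; split=> // i; exists i.
have mne : measurable [set x | ~ dot p x <= dot p' x].
  have := @measurable_nle_efun _ _ _ (EFin \o dot p) (EFin \o dot p').
  apply; exact/measurable_EFinP.
have [|mneq neq0] := eq_cone _ _ (cone_dot p p0) (cone_dot p' p'0).
  split=> // mu Pmu.
  have null2 := null_set_setU (measurableU _ _ ma ma') mle
    (null_set_setU ma ma' (a0 mu Pmu) (a'0 mu Pmu)) (le0 mu Pmu).
  apply: (subset_measure0 mne _ _ null2).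
    by apply: measurableU => //; exact: measurableU.
  move=> x /= nle; have [ax|] := pselect (0 <= affine_comb g p x);
    last by left; left.
  have [a'x|] := pselect (0 <= affine_comb g p' x); last by left; right.
  by right; rewrite !max_r// lee_fin lerD2l.
have mne' := measurable_neq_efun (mmax p) (mmax p').
split=> // mu Pmu; apply: (subset_measure0 mne' mneq _ (neq0 mu Pmu)).
by move=> x /= + pp'; apply; rewrite /affine_comb -/(dot p x) pp'.
Qed.

End generated.

(** * Minimax and mixtures *)

(* The weights certifying failure are the positive parts [(b j - U j m)^+] at a
   minimizer [m] of the sum of their squares. *)
Lemma finite_minimax (R : realType) (T : topologicalType) (K : set T)
    (J : eqType) (b : J -> R) (U : J -> T -> R) (s : seq J) :
  compact K -> K !=set0 -> (forall j, continuous (U j)) ->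
  (forall u v t, K u -> K v -> 0 <= t <= 1 -> exists2 w, K w &
     forall j, U j w = U j u + t * (U j v - U j u)) ->
  (forall (w : J -> R) (M : R), (forall j, 0 <= w j) ->
     (forall m, K m -> \sum_(j <- s) w j * U j m <= M) ->
     \sum_(j <- s) w j * b j <= M) ->
  exists2 m, K m & forall j, j \in s -> b j <= U j m.
Proof.
move=> cK K0 cU convK dual.
pose pos j m := Num.max (b j - U j m) 0.
pose F m := \sum_(j <- s) pos j m ^+ 2.
have cF : continuous F.
  have cpos j : continuous (pos j).
    move=> m; apply: (@continuous_max _ _ (fun x => b j - U j x) (cst 0)).
      by apply: continuousB; [exact: cst_continuous|exact: cU].
    exact: cst_continuous.
  rewrite /F; elim: (s) => [|j s' IHs] m.
    rewrite (_ : (fun _ => _) = cst 0); first exact: cst_continuous.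
    by apply/funext => x; rewrite big_nil.
  rewrite (_ : (fun _ => _) =
    (fun x => pos j x ^+ 2 + \sum_(i <- s') pos i x ^+ 2)); last first.
    by apply/funext => x; rewrite big_cons.
  apply: cvgD; last exact: IHs.
  rewrite /continuous_at expr2; under eq_fun do rewrite expr2.
  by apply: cvgM; exact: cpos.
have [m /set_mem Km minF] :=
  compact_EVT_min K0 cK (continuous_subspaceT cF).
have pos_ge0 j x : 0 <= pos j x by rewrite /pos le_max lexx orbT.
(* First-order optimality of [m] on the segment towards [v]: the derivative of [F] there is
   [- 2 * a], which cannot be negative. *)
have opt v : K v -> \sum_(j <- s) pos j m * U j v <= \sum_(j <- s) pos j m * U j m.
  move=> Kv; pose dlt j := U j v - U j m.
  pose a := \sum_(j <- s) pos j m * dlt j; pose c := \sum_(j <- s) dlt j ^+ 2.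
  have c0 : 0 <= c by apply: sumr_ge0 => j _; exact: sqr_ge0.
  have key t : 0 <= t <= 1 -> 2 * t * a <= t ^+ 2 * c.
    move=> t01; have [w Kw wE] := convK _ _ _ Km Kv t01.
    have : F m <= \sum_(j <- s) (pos j m - t * dlt j) ^+ 2.
      apply: (le_trans (minF w (mem_set Kw))); apply: ler_sum => j _.
      rewrite /pos wE -/(dlt j); rewrite /Num.max.
      case: ifPn; case: ifPn => // h1 h2; nra.
    rewrite (_ : \sum_(j <- s) (pos j m - t * dlt j) ^+ 2 =
                 F m - 2 * t * a + t ^+ 2 * c); first by lra.
    rewrite /F /a /c !mulr_sumr -sumrB -big_split/=.
    by apply: eq_bigr => j _; ring.
  suff : a <= 0.
    by rewrite /a /dlt; under eq_bigr do rewrite mulrBr; rewrite sumrB subr_le0.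
  rewrite leNgt; apply/negP => a0.
  (* Any [t] in ]0, 1] with [t * c <= a] contradicts [key]; this choice also covers [c = 0]. *)
  pose t := a / (a + c).
  have ac : 0 < a + c by rewrite ltr_wpDr.
  have t01 : 0 <= t <= 1.
    by rewrite divr_ge0 ?(ltW a0) ?(ltW ac)//= ler_pdivrMr// mul1r lerDl.
  have t0 : 0 < t by rewrite divr_gt0.
  have tc : t * c <= a.
    by rewrite /t mulrAC ler_pdivrMr// ler_wpM2l ?(ltW a0)// lerDr ltW.
  have ttc : t * (t * c) <= t * a by rewrite ler_wpM2l// ltW.
  have ta : 0 < t * a by rewrite mulr_gt0.
  have := key t t01; rewrite expr2; lra.
(* With these weights [dual] bounds the weighted sum of the [b j] by that of the [U j m], and the
   difference of the two is exactly [F m]. *)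
have := dual (fun j => pos j m) _ (pos_ge0^~ m) opt.
have Fm : \sum_(j <- s) pos j m * b j - \sum_(j <- s) pos j m * U j m = F m.
  rewrite -sumrB; apply: eq_bigr => j _; rewrite -mulrBr /pos expr2.
  by rewrite /Num.max; case: ifPn => // _; rewrite !mul0r.
rewrite -subr_le0 Fm => F0; exists m => // j js.
have : F m == 0 by rewrite eq_le F0 sumr_ge0// => i _; exact: sqr_ge0.
rewrite psumr_eq0; last by move=> i _; exact: sqr_ge0.
move=> /allP/(_ j js); rewrite implyTb sqrf_eq0 => /eqP pj.
by rewrite -subr_le0 -pj /pos le_max lexx.
Qed.

(** The conditions [b j <= U j m] define closed subsets of the compact [K], any finitely many of
    which meet by [finite_minimax]. *)
Lemma compact_minimax (R : realType) (T : ptopologicalType) (K : set T)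
    (J : choiceType) (b : J -> R) (U : J -> T -> R) :
  compact K -> K !=set0 -> (forall j, continuous (U j)) ->
  (forall u v t, K u -> K v -> 0 <= t <= 1 -> exists2 w, K w &
     forall j, U j w = U j u + t * (U j v - U j u)) ->
  (forall (s : seq J) (w : J -> R) (M : R), (forall j, 0 <= w j) ->
     (forall m, K m -> \sum_(j <- s) w j * U j m <= M) ->
     \sum_(j <- s) w j * b j <= M) ->
  exists2 m, K m & forall j, b j <= U j m.
Proof.
move=> cK K0 cU convK dual.
have := cK; rewrite compact_In0 => cK'.
have [||m mP] := cK' J setT (fun j => K `&` [set m | b j <= U j m]).
- exists (fun j => [set m | b j <= U j m]) => // j _.
  have /continuous_closedP/(_ [set x | b j <= x]) := cU j.
  by apply; exact: closed_ge.
- move=> D _.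
  have [m Km mD] := finite_minimax cK K0 cU convK (dual (finmap.enum_fset D)).
  by exists m => j /= jD; split=> //; exact: mD.
(* A common point lies in [K] only if there is at least one index. *)
have [[j]|noJ] := pselect (exists j : J, True).
  by exists m => [|i]; [exact: (mP j I).1|exact: (mP i I).2].
have [m0 Km0] := K0.
by exists m0 => // j; exfalso; apply: noJ; exists j.
Qed.

(** * From dyadic masses to a measure on the unit interval *)

Section dyadic_masses.
Context (R : realType).

(* [m (k, j)] is the mass of the dyadic interval of index [j] at level [k]. *)
Definition dyadic_mass (m : nat * nat -> R) := m (0, 0)%N = 1 /\
  forall k j, 0 <= m (k, j) /\
    m (k, j) = m (k.+1, j.*2) + m (k.+1, j.*2.+1).

Variable m : nat * nat -> R.
Hypothesis mP : dyadic_mass m.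

(** Cumulative masses, in the role of a distribution function on the grid of level [k]. *)
Let a k j := \sum_(i < j) m (k, i : nat).

Let aS k j : a k j.+1 = a k j + m (k, j).
Proof. by rewrite /a big_ord_recr. Qed.

Let a_mono k i j : (i <= j)%N -> a k i <= a k j.
Proof.
elim: j => [|j IHj]; first by rewrite leqn0 => /eqP ->.
rewrite leq_eqVlt => /orP[/eqP -> //|]; rewrite ltnS => /IHj /le_trans; apply.
by rewrite aS lerDl; exact: (mP.2 k j).1.
Qed.

Let a0 k : a k 0 = 0. Proof. by rewrite /a big_ord0. Qed.

Let a_double k j : a k.+1 j.*2 = a k j.
Proof.
elim: j => [|j IHj]; first by rewrite !a0.
by rewrite doubleS !aS IHj (mP.2 k j).2 addrA.
Qed.

Let a_top k : a k (2 ^ k) = 1.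
Proof.
elim: k => [|k IHk]; first by rewrite expn0 aS a0 add0r mP.1.
by rewrite expnS mul2n a_double.
Qed.

(** The quantile at level [u], located up to [2^-k]: the right half of the current cell is chosen
    once the cumulative mass up to its midpoint is at most [u]. *)
Fixpoint dyadic_index k (u : R) : nat := if k is k'.+1 then
  let j := dyadic_index k' u in (j.*2 + (\sum_(i < j.*2.+1) m (k, i : nat) <= u)%R)%N
  else 0%N.
Let J := dyadic_index.

Let J_inv k u : 0 <= u < 1 -> (J k u < 2 ^ k)%N /\ a k (J k u) <= u < a k (J k u).+1.
Proof.
move=> u01; elim: k => [|k [Jk /andP[aJ Ja]]].
  by rewrite expn0 /J/= aS a0 add0r mP.1.
rewrite /J /= -/(J k u) -/(a k.+1 (J k u).*2.+1).
have [le|lt] := leP (a k.+1 (J k u).*2.+1) u => /=.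
  rewrite addn1 expnS mul2n; split.
    by rewrite -doubleS leq_double.
  by rewrite le/= -doubleS a_double.
by rewrite addn0 expnS mul2n ltn_double a_double aJ lt.
Qed.

Let J_uniq k u j : 0 <= u < 1 -> a k j <= u < a k j.+1 -> j = J k u.
Proof.
move=> u01 /andP[aj ja]; have [_ /andP[aJ Ja]] := J_inv k u01.
have [lt|lt|//] := ltngtP j (J k u).
  by have := lt_le_trans ja (le_trans (a_mono k lt) aJ); rewrite ltxx.
by have := lt_le_trans Ja (le_trans (a_mono k lt) aj); rewrite ltxx.
Qed.

(** On [0, 1[ this is [F] at the cell selected by [u]; as a combination of indicators its
    measurability and integral are immediate. *)
Let step k (F : nat -> R) u := \sum_(j < 2 ^ k) F j * \1_(`[a k j, a k j.+1[) u.

Let step_in k F u : 0 <= u < 1 -> step k F u = F (J k u).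
Proof.
move=> u01; have [Jk aJ] := J_inv k u01.
rewrite /step (bigD1 (Ordinal Jk))//= indicE mem_set ?mulr1; last first.
  by rewrite /= in_itv.
rewrite big1 ?addr0// => j jJ; rewrite indicE memNset ?mulr0//= in_itv/=.
move=> aj; case/negP: jJ; apply/eqP/val_inj => /=; exact: J_uniq.
Qed.

Let step_out k F u : ~ (0 <= u < 1) -> step k F u = 0.
Proof.
move=> u01; rewrite /step big1// => j _; rewrite indicE memNset ?mulr0//= in_itv/=.
move=> /andP[aj ja]; apply: u01; apply/andP; split.
  by apply: le_trans aj; rewrite -(a0 k); exact: a_mono.
by apply: lt_le_trans ja _; rewrite -(a_top k); exact: a_mono.
Qed.

Let measurable_step k F : measurable_fun setT (step k F).
Proof.
apply: measurable_sum => j; apply: measurable_funM; first exact: measurable_cst.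
exact: measurable_indic.
Qed.

Let U := uniform_prob (@ltr01 R).

Let U_itv (x y : R) : 0 <= x -> x <= y -> y <= 1 -> U `[x, y[ = (y - x)%:E.
Proof.
move=> x0 xy y1; rewrite /U /uniform_prob.
rewrite (eq_integral (cst 1%E)).
  rewrite integral_cst//= mul1e lebesgue_measure_itv/= lte_fin.
  case: ltP => // yx; rewrite (le_anti (introT andP (conj xy yx))) subrr//.
move=> u; rewrite inE/= in_itv/= => /andP[xu uy]; rewrite /uniform_pdf.
by rewrite (le_trans x0 xu) (le_trans (ltW uy) y1) subr0 invr1.
Qed.

Let integral_step k F : (forall j, 0 <= F j) ->
  (\int[U]_u (step k F u)%:E = (\sum_(j < 2 ^ k) m (k, j : nat) * F j)%:E)%E.
Proof.
move=> F0; rewrite /step; under eq_integral do rewrite -sumEFin.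
rewrite ge0_integral_sum//.
- rewrite -sumEFin; apply: eq_bigr => j _.
  under eq_integral do rewrite EFinM.
  rewrite ge0_integralZl//.
  + rewrite integral_indic// setIT.
    rewrite [X in (_ * X)%E](_ : _ = (a k j.+1 - a k j)%:E); last first.
      apply: U_itv; [|exact: a_mono|]; first by rewrite -(a0 k); exact: a_mono.
      by rewrite -(a_top k); exact: a_mono.
    by rewrite -EFinM aS addrAC subrr add0r mulrC.
  + by apply/measurable_EFinP; exact: measurable_indic.
  + by rewrite lee_fin; exact: F0.
- move=> j; apply/measurable_EFinP; apply: measurable_funM.
    exact: measurable_cst.
  exact: measurable_indic.
- by move=> j x _; rewrite lee_fin mulr_ge0.
Qed.

(** The left end of the cell of level [k] selected by [u]. The cells are nested, so that [S]
    increases, [S + 2^-k] decreases, and the limit is the quantile [T u]. *)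
Let S k u := step k (fun j => j%:R * 2^-1 ^+ k) u.

Let S_step k u : S k u <= S k.+1 u /\ S k.+1 u + 2^-1 ^+ k.+1 <= S k u + 2^-1 ^+ k.
Proof.
have w0 : 0 <= 2^-1 ^+ k :> R by rewrite exprn_ge0.
have [u01|u01] := pselect (0 <= u < 1); last first.
  by rewrite /S !step_out// exprS; split=> //; lra.
rewrite /S !step_in// /J/= -/(J k u) exprS.
by case: (_ <= u) => /=; rewrite natrD -muln2 natrM; split; lra.
Qed.

Let T u := limn (S ^~ u).

Let S_nd u : nondecreasing_seq (S ^~ u).
Proof. by apply/nondecreasing_seqP => k; exact: (S_step k u).1. Qed.

Let S_ni u : nonincreasing_seq (fun k => S k u + 2^-1 ^+ k).
Proof. by apply/nonincreasing_seqP => k; exact: (S_step k u).2. Qed.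

Let S_cvg u : cvgn (S ^~ u).
Proof.
apply: nondecreasing_is_cvgn; first exact: S_nd.
exists (S 0 u + 1) => _ [k _ <-].
rewrite -(expr0 (2^-1 : R)); apply: le_trans (S_ni u (leq0n k)).
by rewrite lerDl exprn_ge0.
Qed.

Let T_bounds k u : S k u <= T u <= S k u + 2^-1 ^+ k.
Proof.
rewrite nondecreasing_cvgn_le//=; apply: limr_le; first exact: S_cvg.
near=> n; have kn : (k <= n)%N by near: n; exists k.
apply: le_trans (S_ni u kn).
by rewrite lerDl exprn_ge0.
Unshelve. all: by end_near. Qed.

Let T01 u : 0 <= T u <= 1.
Proof.
have := T_bounds 0 u; rewrite /S expr0.
have -> : step 0 (fun j => j%:R * 1) u = 0.
  have [u01|] := pselect (0 <= u < 1); last exact: step_out.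
  by rewrite step_in// mul0r.
by rewrite add0r.
Qed.

Let measurable_T : measurable_fun setT T.
Proof.
apply: (measurable_fun_cvg (h := fun k u => S k u)).
  by move=> k; exact: measurable_step.
by move=> u _; exact: S_cvg.
Qed.

(* The measure is the law of [T u], [u] uniform on [0, 1], where [T] is the
   quantile map built by dichotomy. *)
Lemma dyadic_measure : exists Q : probability R R, Q `[0, 1]%classic = 1%E /\
  forall (phi : R -> R) (M : nat -> nat -> R) (C b : R),
    measurable_fun setT phi ->
    (forall t, 0 <= t <= 1 -> 0 <= phi t <= C) ->
    (forall k j, 0 <= M k j <= C) ->
    (forall t e, 0 <= t <= 1 -> 0 < e -> exists k0, forall k j, (k0 <= k)%N ->
       j%:R * 2^-1 ^+ k <= t <= j%:R * 2^-1 ^+ k + 2^-1 ^+ k ->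
       M k j <= phi t + e) ->
    (forall k, b <= \sum_(j < 2 ^ k) m (k, j : nat) * M k j) ->
    (b%:E <= \int[Q]_(t in `[0%R, 1%R]) (phi t)%:E)%E.
Proof.
have [Q [QE QI]] := pushforward_probability U measurable_T.
exists Q; split.
  rewrite QE (_ : _ @^-1` _ = setT); first exact: probability_setT.
  by apply/seteqP; split => // u _ /=; rewrite in_itv; exact: T01.
move=> phi M C b mphi phi01 M01 Mphi bM.
rewrite integral_mkcond QI; last 2 first.
- by apply/(measurable_restrictT _ _).1 => //; apply/measurable_EFinP; exact: measurable_funTS.
- move=> y; rewrite patchE; case: ifPn => //; rewrite inE/= in_itv/= => /phi01.
  by rewrite lee_fin => /andP[].
have -> : (\int[U]_u ((EFin \o phi) \_ `[0%R, 1%R]) (T u) =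
           \int[U]_u (phi (T u))%:E)%E.
  apply: eq_integral => u _; rewrite patchE mem_set//= in_itv; exact: T01.
pose G k u := step k (M k) u.
(* The functions [G k] are controlled from above only and may fail to converge; their maximum with
   the limit [phi (T u)] does converge. *)
pose f k u := Num.max (G k u) (phi (T u)).
have mphiT : measurable_fun setT (fun u => phi (T u)) by exact: measurableT_comp.
have phiT u : 0 <= phi (T u) <= C by apply: phi01; exact: T01.
have G0 k u : 0 <= G k u <= C.
  rewrite /G; have [u01|u01] := pselect (0 <= u < 1); first by rewrite step_in.
  by rewrite step_out// lexx; have /andP[] := phiT u; exact: le_trans.
have mf k : measurable_fun setT (f k).
  by apply: measurable_maxr => //; exact: measurable_step.
have f0 k u : 0 <= f k u <= C.
  have /andP[p0 pC] := phiT u; have /andP[g0 gC] := G0 k u.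
  by rewrite /f le_max g0/= ge_max gC.
have cf u : f ^~ u @ \oo --> phi (T u).
  apply/cvgrPdist_le => e e0.
  have [u01|u01] := pselect (0 <= u < 1); last first.
    near=> k; rewrite /f /G step_out// max_r ?subrr ?normr0 ?(ltW e0)//.
    by have /andP[] := phiT u.
  have [k0 Mk0] := Mphi (T u) e (T01 u) e0.
  near=> k; have kk0 : (k0 <= k)%N by near: k; exists k0.
  (* [T u] may be the right end of the selected cell, hence the closed cells in the hypothesis on
     [M]. *)
  have := T_bounds k u; rewrite /S step_in// => TJ.
  have := Mk0 k _ kk0 TJ; rewrite /f /G step_in// => Me.
  rewrite distrC ger0_norm ?subr_ge0 ?le_max ?lexx ?orbT//.
  by rewrite lerBlDl ge_max Me lerDl ltW.
have [|||||_ _ cI] := @dominated_convergence _ _ _ U setT measurableT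
  (fun k u => (f k u)%:E) (fun u => (phi (T u))%:E) (cst C%:E).
- by move=> k; apply/measurable_EFinP; exact: mf.
- exact/measurable_EFinP.
- by apply: aeW => u _; apply: cvg_EFin; [exact: nearW|exact: cf].
- exact: finite_measure_integrable_cst.
- apply: aeW => u k _ /=; rewrite lee_fin.
  by have /andP[g0 gC] := f0 k u; rewrite ger0_norm.
have <- := cvg_lim _ cI => //.
apply: lime_ge; first by apply/cvg_ex; eexists; exact: cI.
apply: nearW => k; apply: le_trans (_ : \int[U]_u (G k u)%:E <= _)%E.
  by rewrite integral_step ?lee_fin// => j; have /andP[] := M01 k j.
apply: ge0_le_integral => //.
- by move=> u _; rewrite lee_fin; have /andP[] := G0 k u.
- by apply/measurable_EFinP; exact: measurable_step.
- by apply/measurable_EFinP; exact: mf.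
- by move=> u _; rewrite lee_fin /f le_max lexx.
Unshelve. all: by end_near. Qed.

End dyadic_masses.

(** An alias of the product space, able to carry the point that [compact_minimax] expects. *)
Definition mass_family (R : realType) : Type :=
  prod_topology (fun _ : nat * nat => R).

HB.instance Definition _ (R : realType) := Topological.copy (mass_family R)
  (prod_topology (fun _ : nat * nat => R)).
HB.instance Definition _ (R : realType) :=
  isPointed.Build (mass_family R) (fun=> 0).

(** * A single mixture above a family of values *)

Section mixtures.
Context (R : realType).

Let mass_space := mass_family R.

Let proj_cont i : continuous (fun m : mass_space => m i).
Proof. exact: (@proj_continuous _ (fun _ => R) i). Qed.

Let masses : set mass_space :=
  [set m | dyadic_mass m /\ forall i, 0 <= m i <= 1].

Let compact_masses : compact masses.
Proof.
have cA : compact [set m : mass_space | forall i, `[0, 1]%classic (m i)].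
  exact: (@tychonoff _ (fun _ : nat * nat => R) (fun _ => `[0, 1]%classic)
    (fun _ => @segment_compact R 0 1)).
have cB : closed [set m : mass_space | dyadic_mass m].
  have -> : [set m : mass_space | dyadic_mass m] =
    ((fun m : mass_space => m (0, 0)%N) @^-1` [set x | x = 1]) `&`
    \bigcap_(p in [set: nat * nat])
      (((fun m : mass_space => m p) @^-1` [set x | 0 <= x]) `&`
       ((fun m : mass_space => m p - (m (p.1.+1, p.2.*2) + m (p.1.+1, p.2.*2.+1)))
         @^-1` [set x | x = 0])).
    apply/seteqP; split => [m [m1 mP]|m [m1 mP]].
      split=> // -[k j] _; have [m0 mE] := mP k j; split=> //=.
      by rewrite -mE subrr.
    split=> // k j; have [m0 /= /eqP] := mP (k, j) I.
    by rewrite subr_eq0 => /eqP.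
  apply: closedI.
    have /continuous_closedP/(_ [set x | x = 1]) := @proj_cont (0, 0)%N.
    by apply; exact: closed_eq.
  apply: closed_bigI => p _; apply: closedI.
    have /continuous_closedP/(_ [set x | 0 <= x]) := @proj_cont p.
    by apply; exact: closed_ge.
  have /continuous_closedP/(_ [set x | x = 0]) : continuous
      (fun m : mass_space => m p - (m (p.1.+1, p.2.*2) + m (p.1.+1, p.2.*2.+1))).
    move=> m; exact: (cvgB (@proj_cont p m) (cvgD (@proj_cont (p.1.+1, p.2.*2) m)
      (@proj_cont (p.1.+1, p.2.*2.+1) m))).
  by apply; exact: closed_eq.
have -> : masses = [set m : mass_space | dyadic_mass m] `&`
    [set m : mass_space | forall i, `[0, 1]%classic (m i)].
  by apply/seteqP; split => m [mP m01]; split=> // i; have := m01 i;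
    rewrite /= in_itv.
rewrite setIC; exact: compact_closedI.
Qed.

Let cell k j (t : R) := j%:R * 2^-1 ^+ k <= t < j%:R * 2^-1 ^+ k + 2^-1 ^+ k.

Let double_natr j : j.*2%:R = 2 * j%:R :> R.
Proof. by rewrite -mul2n natrM. Qed.

Let doubleS_natr j : j.*2.+1%:R = 2 * j%:R + 1 :> R.
Proof. by rewrite -natr1 double_natr. Qed.

Let cell_ex t k : 0 <= t < 1 -> exists2 j, (j < 2 ^ k)%N & cell k j t.
Proof.
move=> t01; elim: k => [|k [j jk /andP[jt tj]]].
  by exists 0%N => //; rewrite /cell mul0r add0r expr0.
have [le|lt] := leP (j%:R * 2^-1 ^+ k + 2^-1 ^+ k.+1) t.
  exists j.*2.+1; first by rewrite expnS mul2n -leq_double in jk *.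
  move: le tj; rewrite /cell exprS doubleS_natr => le tj.
  by apply/andP; split; lra.
exists j.*2; first by rewrite expnS mul2n ltn_double.
move: jt lt; rewrite /cell exprS double_natr => jt lt.
by apply/andP; split; lra.
Qed.

(** Masses of the Dirac measure at [t]. The half-open cells partition [0, 1[ only, so the dual
    condition is tested at [t < 1]. *)
Let point_mass t : mass_space := fun p => (cell p.1 p.2 t)%:R.

Let point_massP t : 0 <= t < 1 -> masses (point_mass t).
Proof.
move=> t01; split; last by move=> i; rewrite /point_mass; case: cell; rewrite /= ?lexx ?ler01.
split; first by rewrite /point_mass /cell/= mul0r expr0 add0r t01.
move=> k j; split; first by rewrite /point_mass ler0n.
have w0 : 0 < 2^-1 ^+ k :> R by rewrite exprn_gt0.
rewrite /point_mass /= /cell exprS doubleS_natr double_natr -natrD.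
congr (_%:R); set c := j%:R * 2^-1 ^+ k; move: w0; set w := 2^-1 ^+ k => w0.
have -> : 2 * j%:R * (2^-1 * w) = c by rewrite /c -/w; field.
have -> : (2 * j%:R + 1) * (2^-1 * w) = c + 2^-1 * w by rewrite /c -/w; field.
have -> : c + 2^-1 * w + 2^-1 * w = c + w by field.
case: (leP c t); case: (ltP t (c + w)); case: (ltP t (c + 2^-1 * w)) => //= *;
  exfalso; lra.
Qed.

(** The minimax lemma is applied to the pairs of an index [j] and a level [k], with the integral of
    [phi j] replaced by its upper sum at level [k], a continuous affine function of the masses. The
    dual condition is inherited from point masses, whose upper sums are at least [phi j t]; the
    level then tends to infinity in [dyadic_measure]. *)
Lemma mixture_dominating (J : choiceType) (phi : J -> R -> R) (C b : J -> R) :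
  (forall j, measurable_fun setT (phi j)) ->
  (forall j t, 0 <= t <= 1 -> 0 <= phi j t <= C j) ->
  (forall j t e, 0 <= t <= 1 -> 0 < e -> exists2 d, 0 < d &
     forall s, 0 <= s <= 1 -> `|s - t| < d -> phi j s <= phi j t + e) ->
  (forall (s : seq (R * J)) M, (forall q, q \in s -> 0 <= q.1) ->
     (forall t, 0 <= t < 1 -> \sum_(q <- s) q.1 * phi q.2 t <= M) ->
     \sum_(q <- s) q.1 * b q.2 <= M) ->
  exists Q : probability R R, Q `[0, 1]%classic = 1%E /\
    forall j, ((b j)%:E <= \int[Q]_(t in `[0%R, 1%R]) (phi j t)%:E)%E.
Proof.
move=> mphi phi01 uphi dual.
pose A j k i := [set phi j t | t in
  [set t | 0 <= t <= 1 /\ i%:R * 2^-1 ^+ k <= t <= i%:R * 2^-1 ^+ k + 2^-1 ^+ k]].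
pose M j k i := sup (A j k i).
have ubA j k i : ubound (A j k i) (C j).
  by move=> _ [t [t01 _] <-]; have /andP[] := phi01 j t t01.
have leM j k i t : 0 <= t <= 1 ->
    i%:R * 2^-1 ^+ k <= t <= i%:R * 2^-1 ^+ k + 2^-1 ^+ k -> phi j t <= M j k i.
  by move=> t01 ti; apply: ub_le_sup; [exists (C j); exact: ubA|exists t].
have C0 j : 0 <= C j.
  have /andP[p0] := phi01 j 0 (introT andP (conj (lexx 0) ler01)).
  exact: le_trans.
have M01 j k i : 0 <= M j k i <= C j.
  (* A cell that misses [0, 1] takes the default value [sup set0 = 0]. *)
  have [[y [t [t01 ti] _]]|A0] := pselect (A j k i !=set0); last first.
    have AE : A j k i = set0 by apply: contrapT => /eqP/set0P/A0.
    by rewrite /M AE sup0 lexx C0.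
  apply/andP; split.
    by apply: le_trans (leM j k i t t01 ti); have /andP[] := phi01 j t t01.
  by apply: ge_sup; [exists (phi j t), t|exact: ubA].
have Mphi j t e : 0 <= t <= 1 -> 0 < e -> exists k0, forall k i, (k0 <= k)%N ->
    i%:R * 2^-1 ^+ k <= t <= i%:R * 2^-1 ^+ k + 2^-1 ^+ k ->
    M j k i <= phi j t + e.
  move=> t01 e0; have [dl dl0 dlP] := uphi j t e t01 e0.
  have [k0 k0P] : exists k0, 2^-1 ^+ k0 < dl.
    have /cvgrPdist_lt/(_ dl dl0)[k0 _ k0P] :
        (2^-1 : R) ^+ n @[n --> \oo] --> 0.
      by apply: cvg_expr; rewrite ger0_norm ?invr_ge0// invf_lt1// ltr1n.
    exists k0; have := k0P k0 (leqnn _).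
    by rewrite /= sub0r normrN ger0_norm// exprn_ge0// invr_ge0.
  exists k0 => k i kk0 ti; apply: ge_sup; first by exists (phi j t), t.
  move=> _ [s [s01 si] <-]; apply: dlP => //.
  apply: (@le_lt_trans _ _ (2^-1 ^+ k)).
    move: ti si => /andP[t1 t2] /andP[s1 s2].
    by rewrite ler_norml; apply/andP; split; lra.
  apply: le_lt_trans k0P; apply: ler_wiXn2l => //.
  by rewrite invf_le1// ler1n.
pose U (p : J * nat) (m : mass_space) :=
  \sum_(i < 2 ^ p.2) m (p.2, i : nat) * M p.1 p.2 i.
have [||||m [mP _] mU] := @compact_minimax R (mass_family R) masses (J * nat)%type
  (fun p => b p.1) U compact_masses.
- by exists (point_mass 0); apply: point_massP; rewrite lexx ltr01.
- move=> p; apply: continuous_big => [|i _ m]; first exact: add_continuous.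
  exact: (cvgMr_tmp (@proj_cont (p.2, i : nat) m)).
- move=> u v t [[u1 uP] u01] [[v1 vP] v01] t01.
  exists (fun i => u i + t * (v i - u i)).
    have /andP[t0 t1] := t01.
    split; last first.
      move=> i; have /andP[u0 u1'] := u01 i; have /andP[v0 v1'] := v01 i.
      by apply/andP; split; nra.
    split; first by rewrite u1 v1 subrr mulr0 addr0.
    move=> k i; have [u0 uE] := uP k i; have [v0 vE] := vP k i.
    by rewrite uE vE; split; [rewrite -uE -vE; nra|ring].
  move=> p; rewrite /U mulrBr !mulr_sumr -sumrB -big_split/=.
  by apply: eq_bigr => i _; ring.
- move=> s w M' w0 wU.
  have := dual [seq (w p, p.1) | p <- s] M'; rewrite !big_map/=; apply.
    by move=> q /mapP[p _ ->] /=; exact: w0.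
  move=> t t01; rewrite big_map/=.
  apply: le_trans (wU _ (point_massP t01)); apply: ler_sum => p _.
  rewrite ler_wpM2l//; have [i ik ti] := cell_ex p.2 t01.
  rewrite /U (bigD1 (Ordinal ik))//= {1}/point_mass ti mul1r.
  apply: ler_wpDr.
    apply: sumr_ge0 => i' _; by rewrite mulr_ge0//; have /andP[] := M01 p.1 p.2 i'.
  have /andP[t1 t2] := ti; have /andP[t0 t11] := t01.
  by apply: leM; [rewrite t0 ltW|rewrite t1 ltW].
have [Q [Q1 QP]] := dyadic_measure mP.
exists Q; split=> // j.
apply: (QP _ _ _ _ (mphi j) (phi01 j) (M01 j) (Mphi j)) => k.
exact: (mU (j, k)).
Qed.

End mixtures.

(** * Sub-psi hypotheses *)

Section exponents.
Context (R : realType) (lmax : \bar R) (p : R -> R).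
Hypothesis lmax_gt0 : (0 < lmax)%E.
Let D (l : R) := right_open_params lmax l%:E.
Hypothesis p_ge0 : forall l, 0 <= p l.
Hypothesis p0 : p 0 = 0.
Hypothesis p_convex : forall t x y, 0 <= t <= 1 -> D x -> D y ->
  p (t * x + (1 - t) * y) <= t * p x + (1 - t) * p y.

Let D0 l : D l -> 0 <= l. Proof. by move=> /andP[]; rewrite lee_fin. Qed.

Let D_le x y : 0 <= x -> x <= y -> D y -> D x.
Proof.
move=> x0 xy /andP[_ yl]; apply/andP; split; first by rewrite lee_fin.
by apply: le_lt_trans yl; rewrite lee_fin.
Qed.

Let D_zero : D 0. Proof. by rewrite /D /right_open_params /= lexx lmax_gt0. Qed.

Lemma right_open_params_gt l : D l -> exists2 l', D l' & l < l'.
Proof.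
move=> Dl; have /andP[l0 ll] := Dl.
have [r [lr rl]] : exists r, l < r /\ (r%:E < lmax)%E.
  case: (lmax) ll => [s| |//]; last by exists (l + 1); rewrite ltry ltrDl.
  by rewrite lte_fin => ls; exists ((l + s) / 2); split; rewrite ?lte_fin; lra.
exists r => //; apply/andP; split=> //.
by rewrite lee_fin (le_trans (D0 Dl))// ltW.
Qed.

Lemma convex_chord x y z : D x -> D z -> x <= y <= z ->
  (z - x) * p y <= (z - y) * p x + (y - x) * p z.
Proof.
move=> Dx Dz /andP[xy yz]; have [zx|zx] := ltP x z; last first.
  have yx : y = x by apply/eqP; rewrite eq_le xy (le_trans yz zx).
  have zx' : z = x by apply/eqP; rewrite eq_le zx (le_trans xy yz).
  by rewrite yx zx' subrr !mul0r addr0.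
have zx0 : 0 < z - x by rewrite subr_gt0.
pose t := (z - y) / (z - x).
have t01 : 0 <= t <= 1.
  apply/andP; split; first by rewrite divr_ge0// ?subr_ge0// ltW.
  by rewrite /t ler_pdivrMr// mul1r; lra.
have := p_convex t01 Dx Dz.
have -> : t * x + (1 - t) * z = y by rewrite /t; field; rewrite gt_eqF.
have -> : t * p x + (1 - t) * p z = ((z - y) * p x + (y - x) * p z) / (z - x).
  by rewrite /t; field; rewrite gt_eqF.
by rewrite ler_pdivlMr// mulrC.
Qed.

Lemma convex_nondecreasing x y : D y -> 0 <= x -> x <= y -> p x <= p y.
Proof.
move=> Dy x0 xy; have := convex_chord D_zero Dy (introT andP (conj x0 xy)).
rewrite p0 mulr0 add0r !subr0 => H.
have [y0|y0] := ltP 0 y; last first.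
  by rewrite (_ : x = y)//; apply/eqP; rewrite eq_le xy (le_trans y0).
rewrite -(ler_pM2l y0); apply: le_trans H _.
by rewrite ler_wpM2r.
Qed.

(** By convexity the slope from [x] to [y] is at most the one from [x] to [c'], whose numerator is
    at most [p c'] and whose denominator is at least [c' - c]. *)
Lemma convex_lipschitz x y c c' : D c' -> c < c' -> 0 <= x -> x <= y -> y <= c ->
  p y - p x <= (y - x) * (p c' / (c' - c)).
Proof.
move=> Dc' cc x0 xy yc.
have Dx : D x by apply: D_le Dc' => //; rewrite (le_trans xy)// (le_trans yc)// ltW.
have H := convex_chord Dx Dc' (introT andP (conj xy (le_trans yc (ltW cc)))).
have px := p_ge0 x.
have mono : p x <= p y.
  apply: convex_nondecreasing => //.
  by apply: D_le Dc'; [exact: le_trans xy|rewrite (le_trans yc)// ltW].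
have H1 : (c' - x) * (p y - p x) <= (y - x) * p c'.
  have : 0 <= (y - x) * p x by rewrite mulr_ge0// subr_ge0.
  by move=> ?; move: H; lra.
rewrite mulrA ler_pdivlMr ?subr_gt0// mulrC; apply: le_trans H1.
by rewrite ler_wpM2r ?subr_ge0//; lra.
Qed.

Variables (x C : R).
Hypothesis xC : forall l, D l -> l * x - p l <= C.
Let G l := expR (l * x - p l).

Let G0 l : 0 <= G l. Proof. exact: expR_ge0. Qed.

Let GC l : D l -> G l <= expR C. Proof. by move=> Dl; rewrite ler_expR xC. Qed.

Lemma expR_exponent_continuous l e : D l -> 0 < e ->
  exists2 dl, 0 < dl & forall l', D l' -> `|l' - l| < dl -> `|G l' - G l| <= e.
Proof.
move=> Dl e0; have [c' Dc' lc] := right_open_params_gt Dl.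
pose c := (l + c') / 2; pose K := p c' / (c' - c).
have lc1 : l < c by rewrite /c; lra.
have cc : c < c' by rewrite /c; lra.
have K0 : 0 <= K by apply: divr_ge0 => //; rewrite subr_ge0 ltW.
have lip a b : D a -> a <= b -> b <= c -> `|p b - p a| <= K * (b - a).
  move=> Da ab bc; rewrite ger0_norm; last first.
    rewrite subr_ge0; apply: convex_nondecreasing => //; last exact: D0.
    by apply: D_le Dc'; [apply: le_trans ab; exact: D0|rewrite (le_trans bc)// ltW].
  by rewrite mulrC; apply: convex_lipschitz => //; exact: D0.
have /cvgrPdist_lt/(_ e e0)/nbhs_ballP[eta /= eta0 etaP] :=
  @continuous_expR R (l * x - p l).
(* The exponent moves by at most [|l' - l| * (|x| + K)]; the added 1 keeps the denominator
   positive. *)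
have d0 : 0 < eta / (`|x| + K + 1) by rewrite divr_gt0// ltr_wpDl// addr_ge0.
exists (Num.min (c - l) (eta / (`|x| + K + 1))).
  by rewrite lt_min subr_gt0 lc1.
move=> l' Dl'; rewrite lt_min => /andP[l'c l'e].
have pK : `|p l' - p l| <= K * `|l' - l|.
  have l'c' : l' <= c by have := ler_norm (l' - l); lra.
  have [ll'|/ltW l'l] := leP l l'.
    by rewrite [X in _ <= K * X]ger0_norm ?subr_ge0//; exact: lip.
  rewrite distrC [X in _ <= K * X]distrC [X in _ <= K * X]ger0_norm ?subr_ge0//.
  by apply: lip => //; exact: ltW.
rewrite distrC; apply/ltW/etaP; rewrite /ball/= distrC.
rewrite (_ : _ - _ = (l' - l) * x - (p l' - p l)); last by ring.
apply: le_lt_trans (ler_normB _ _) _; rewrite normrM.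
apply: le_lt_trans (_ : `|l' - l| * (`|x| + K) < _).
  by rewrite mulrDr lerD2l [leRHS]mulrC.
apply: le_lt_trans (_ : `|l' - l| * (`|x| + K + 1) < _).
  by rewrite ler_wpM2l// lerDl.
by rewrite -ltr_pdivlMr// ltr_wpDl// addr_ge0.
Qed.

(** The exponent is concave in [l]: once it has decreased from [a] to [b] it keeps decreasing, and
    the limit is an infimum; otherwise [G] is nondecreasing and bounded, and the limit is a
    supremum. *)
Lemma expR_exponent_limit : exists L, [/\ 0 <= L <= expR C &
  forall e, 0 < e -> exists2 l1, D l1 &
    forall l, D l -> l1 <= l -> `|G l - L| <= e].
Proof.
have [[a [b [Da Db ab Gab]]]|nd] := pselect (exists a b, [/\ D a, D b, a < b & G b < G a]).
  have ni y z : D z -> b <= y -> y <= z -> G z <= G y.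
    move=> Dz by_ yz; rewrite ler_expR.
    have ua : b * x - p b < a * x - p a by rewrite -ltr_expR.
    have Dy : D y by apply: D_le Dz => //; apply: le_trans by_; exact: D0.
    have c1 := convex_chord Da Dy (introT andP (conj (ltW ab) by_)).
    have c2 := convex_chord Db Dz (introT andP (conj by_ yz)).
    have [ybE|yb] := eqVneq y b; last have {}yb : b < y by rewrite lt_neqAle eq_sym yb.
      rewrite ybE in yz *.
      have := convex_chord Da Dz (introT andP (conj (ltW ab) yz)).
      set d1 := b - a; set d2 := z - b => H.
      have d1p : 0 < d1 by rewrite subr_gt0.
      have d2p : 0 <= d2 by rewrite subr_ge0.
      rewrite -subr_ge0 -(pmulr_rge0 _ d1p).
      have : 0 <= d2 * ((a * x - p a) - (b * x - p b)) by rewrite mulr_ge0// subr_ge0 ltW.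
      rewrite /d1 /d2 in H *; lra.
    have u2 : y * x - p y <= b * x - p b.
      have d1p : 0 < b - a by rewrite subr_gt0.
      rewrite -subr_ge0 -(pmulr_rge0 _ d1p).
      have : 0 <= (y - b) * ((a * x - p a) - (b * x - p b)).
        by rewrite mulr_ge0// subr_ge0 ltW.
      lra.
    have d1p : 0 < y - b by rewrite subr_gt0.
    rewrite -subr_ge0 -(pmulr_rge0 _ d1p).
    have : 0 <= (z - y) * ((b * x - p b) - (y * x - p y)).
      by rewrite mulr_ge0// subr_ge0.
    lra.
  pose S := [set G l | l in [set l | D l /\ b <= l]].
  have S0 : S !=set0 by exists (G b), b.
  have lbS : lbound S 0 by move=> _ [l _ <-].
  have hS : has_inf S by split=> //; exists 0.
  exists (inf S); split.
    rewrite lb_le_inf//=; apply: le_trans (GC Db); apply: ge_inf; first exact: hS.2.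
    by exists b.
  move=> e e0; have [_ [l1 [Dl1 bl1] <-] l1e] := inf_adherent e0 hS.
  exists l1 => // l Dl l1l.
  have infl : inf S <= G l.
    by apply: ge_inf; [exact: hS.2|exists l => //; split=> //; exact: le_trans l1l].
  by rewrite ger0_norm ?subr_ge0// lerBlDl (le_trans (ni _ _ Dl bl1 l1l))// ltW.
have {}nd y z : D y -> D z -> y <= z -> G y <= G z.
  move=> Dy Dz; rewrite le_eqVlt => /orP[/eqP -> //|yz].
  by rewrite leNgt; apply/negP => Gzy; apply: nd; exists y, z.
pose S := [set G l | l in [set l | D l]].
have ubS : ubound S (expR C) by move=> _ [l Dl <-]; exact: GC.
have hS : has_sup S by split; [exists (G 0), 0|exists (expR C)].
have leS l : D l -> G l <= sup S by move=> Dl; apply: ub_le_sup; [exact: hS.2|exists l].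
exists (sup S); split.
  by rewrite (le_trans (G0 0) (leS _ D_zero))/=; apply: ge_sup; [exact: hS.1|].
move=> e e0; have [_ [l1 Dl1 <-] l1e] := sup_adherent e0 hS.
exists l1 => // l Dl l1l; rewrite distrC ger0_norm ?subr_ge0 ?leS//.
by have := nd _ _ Dl1 Dl l1l; lra.
Qed.

End exponents.

Lemma measurable_of_intervals (R : realType) (f : R -> \bar R) :
  (forall a : R, is_interval [set t | f t < a%:E]%E) -> measurable_fun setT f.
Proof.
move=> If.
apply: (measurability _ (ErealGenInftyO.measurableE R)) => // _ [_ [a ->] <-].
rewrite setTI; apply: is_interval_measurable => x y fx fy z xyz.
have := If a x y; rewrite /= !in_itv/= in fx fy *.
by move=> /(_ fx fy z xyz).
Qed.

(** The tangent of the exponential at [t * b] lies below it at 0 and at [b]; averaging these two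
    bounds with weights [1 - t] and [t] cancels the slope. *)
Lemma expR_chord (R : realType) (t b : R) : 0 <= t <= 1 ->
  expR (t * b) <= 1 - t + t * expR b.
Proof.
move=> /andP[t0 t1]; have e0 := expR_gt0 (t * b).
have h1 : expR (t * b) * (1 + (1 - t) * b) <= expR b.
  rewrite [in leRHS](_ : b = t * b + (1 - t) * b); last by ring.
  by rewrite expRD ler_wpM2l ?expR_ge0// ; exact: expR_ge1Dx.
have h2 : expR (t * b) * (1 - t * b) <= 1.
  rewrite -[leRHS](expRxMexpNx_1 (t * b)) ler_wpM2l ?expR_ge0//.
  by have := expR_ge1Dx (- (t * b)).
have : (1 - t) * (expR (t * b) * (1 - t * b)) <= 1 - t.
  by rewrite -[leRHS]mulr1 ler_wpM2l// subr_ge0.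
have : t * (expR (t * b) * (1 + (1 - t) * b)) <= t * expR b.
  by rewrite ler_wpM2l.
lra.
Qed.

Lemma integral_carrier d (T : measurableType d) (R : realType)
    (pi : probability T R) (L : set T) (f : T -> \bar R) :
  measurable L -> pi L = 1%E -> measurable_fun setT f ->
  (forall x, 0 <= f x)%E ->
  (\int[pi]_(x in L) f x = \int[pi]_x f x)%E.
Proof.
move=> mL L1 mf f0.
have LC : pi (~` L) = 0%E by rewrite probability_setC// L1 subee.
rewrite [RHS](ge0_negligible_integral (N := ~` L))//; last exact: measurableC.
by rewrite setTD setCK.
Qed.

(** * Power series with accumulating zeros *)

Section power_series.
Context (R : realType).
Implicit Types (d : nat -> R) (z r C q : R).

Lemma geometric_sum_le2 q m : 0 <= q <= 2^-1 -> \sum_(j < m) q ^+ j <= 2.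
Proof.
move=> /andP[q0 q2]; elim: m => [|m IHm]; first by rewrite big_ord0.
rewrite big_ord_recl expr0.
under eq_bigr do rewrite exprS.
rewrite -mulr_sumr.
have : q * \sum_(i < m) q ^+ i <= 2^-1 * 2.
  by apply: ler_pM => //; apply: sumr_ge0 => i _; exact: exprn_ge0.
by rewrite mulVf// => ?; lra.
Qed.

Lemma power_series_tail d r C z k n : 0 < r -> (forall j, `|d j| * r ^+ j <= C) ->
  `|z| <= r / 2 ->
  `|\sum_(j < n) d (k + j)%N * z ^+ (k + j)| <= 2 * C * (`|z| / r) ^+ k.
Proof.
move=> r0 dC zr; set q := `|z| / r.
have q0 : 0 <= q by rewrite divr_ge0// ltW.
have q2 : q <= 2^-1 by rewrite ler_pdivrMr// mulrC.
have C0 : 0 <= C by apply: le_trans (dC 0%N); rewrite mulr_ge0// exprn_ge0// ltW.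
apply: le_trans (ler_norm_sum _ _ _) _.
apply: (@le_trans _ _ (\sum_(j < n) (C * q ^+ k) * q ^+ j)).
  apply: ler_sum => j _; rewrite normrM normrX -mulrA -exprD.
  have -> : `|z| = q * r by rewrite divfK// gt_eqF.
  rewrite exprMn mulrCA mulrA [leRHS]mulrC mulrAC -mulrA.
  by rewrite ler_wpM2l ?exprn_ge0// mulrC.
rewrite -mulr_sumr.
apply: (@le_trans _ _ (C * q ^+ k * 2)); last by rewrite mulrC mulrA.
rewrite ler_wpM2l ?mulr_ge0 ?exprn_ge0//.
by rewrite geometric_sum_le2// q0.
Qed.

(** By induction the first [k] coefficients vanish. At a small zero [z] the term of degree [k] is
    then bounded by the tail, of order [|z| ^+ k.+1]; dividing by [|z| ^+ k] and letting [z] tend to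
    0 gives [d k = 0]. *)
Lemma power_series_zero d r C : 0 < r -> (forall j, `|d j| * r ^+ j <= C) ->
  (forall e, 0 < e -> exists z, [/\ z != 0, `|z| < e &
     (fun n => \sum_(j < n) d j * z ^+ j) @ \oo --> 0]) ->
  forall k, d k = 0.
Proof.
move=> r0 dC dz; elim/ltn_ind => k IHk.
have C0 : 0 <= C by apply: le_trans (dC 0%N); rewrite mulr_ge0// exprn_ge0// ltW.
have key e : 0 < e -> `|d k| * r ^+ k.+1 <= 2 * C * e.
  move=> e0; have me : 0 < Num.min e (r / 2) by rewrite lt_min e0 divr_gt0.
  have [z [z0 ze cz]] := dz _ me; move: ze; rewrite lt_min => /andP[ze zr].
  have z_gt0 : 0 < `|z| by rewrite normr_gt0.
  have bound : `|d k| * `|z| ^+ k <= 2 * C * (`|z| / r) ^+ k.+1.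
    apply/ler_addgt0Pr => eta eta0.
    have /cvgrPdist_lt/(_ eta eta0)[N _ NP] := cz.
    have := NP (k.+1 + N)%N (leq_addl _ _); rewrite /= sub0r normrN big_split_ord/=.
    rewrite big_ord_recr/= big1 ?add0r => [|i _]; last by rewrite IHk ?mul0r.
    set S := \sum_(i < N) _ => /ltW dS.
    have St : `|S| <= 2 * C * (`|z| / r) ^+ k.+1.
      by apply: power_series_tail => //; exact: ltW.
    have : `|d k * z ^+ k| <= `|d k * z ^+ k + S| + `|S|.
      by rewrite -{1}(addrK S (d k * z ^+ k)); exact: ler_normB.
    rewrite normrM normrX => h; apply: le_trans h _.
    by rewrite [leRHS]addrC; apply: lerD.
  move: bound; rewrite exprMn exprVn [in leRHS]exprS mulrA.
  rewrite ler_pdivlMr ?exprn_gt0// => bound.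
  have : `|z| ^+ k * (`|d k| * r ^+ k.+1) <= `|z| ^+ k * (2 * C * `|z|).
    move: bound; set A := `|z| ^+ k; set B := `|d k|; set E := r ^+ k.+1.
    by set Z := `|z| => bound; lra.
  rewrite ler_pM2l ?exprn_gt0// => /le_trans; apply.
  by rewrite ler_wpM2l ?mulr_ge0// ltW.
apply/eqP; rewrite -normr_le0 -(pmulr_lle0 _ (_ : 0 < r ^+ k.+1)) ?exprn_gt0//.
apply/ler_addgt0Pr => e e0; rewrite add0r.
have C1 : 0 < 2 * C + 1 by rewrite ltr_wpDl// mulr_ge0.
apply: le_trans (key (e / (2 * C + 1)) _) _; first by rewrite divr_gt0.
by rewrite mulrA ler_pdivrMr//; lra.
Qed.

End power_series.

(** * Laplace transforms and their analyticity *)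

Section laplace.
Context d (T : measurableType d) (R : realType).
Variables (k lam : T -> R).
Hypotheses (mk : measurable_fun setT k) (mlam : measurable_fun setT lam).
Hypotheses (k0 : forall t, 0 <= k t) (lam0 : forall t, 0 <= lam t).

Definition laplace (mu : {measure set T -> \bar R}) (x : R) : \bar R :=
  (\int[mu]_t (k t * expR (lam t * x))%:E)%E.

Let ml x : measurable_fun setT (fun t => k t * expR (lam t * x)).
Proof.
by apply: measurable_funM => //; apply: measurableT_comp => //; exact: measurable_funM.
Qed.

Let l0 x t : (0 <= (k t * expR (lam t * x))%:E)%E.
Proof. by rewrite lee_fin mulr_ge0// expR_ge0. Qed.

Lemma laplace_ge0 mu x : (0 <= laplace mu x)%E.
Proof. by apply: integral_ge0 => t _; exact: l0. Qed.

Lemma laplace_le mu x y : x <= y -> (laplace mu x <= laplace mu y)%E.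
Proof.
move=> xy; apply: ge0_le_integral => //.
- exact/measurable_EFinP.
- exact/measurable_EFinP.
- by move=> t _; rewrite lee_fin ler_wpM2l// ler_expR ler_wpM2l.
Qed.

(** The exponential series is integrated termwise. As [lam] is nonnegative, the integrand at the
    right end [x + r] dominates the partial sums for all [|z| <= r], so finiteness at that one point
    is enough. *)
Lemma laplace_series mu x r : 0 < r -> (laplace mu (x + r) < +oo)%E ->
  exists a C, (forall j, `|a j| * r ^+ j <= C) /\
    forall z, `|z| <= r -> (fun n => \sum_(j < n) a j * z ^+ j) @ \oo -->
      fine (laplace mu (x + z)).
Proof.
move=> r0 foo; pose g t := k t * expR (lam t * (x + r)).
have mg : measurable_fun setT g by exact: ml.
have Ig : mu.-integrable setT (EFin \o g).
  apply/integrableP; split; first exact/measurable_EFinP.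
  rewrite (eq_integral (EFin \o g))// => t _.
  by rewrite gee0_abs//; exact: l0.
pose c j t := k t * expR (lam t * x) * exp_coeff (lam t) j.
have mc j : measurable_fun setT (c j).
  apply: measurable_funM => //; rewrite /exp_coeff.
  apply: measurable_funM => //; exact: measurable_funX.
have c0 j t : 0 <= c j t by rewrite mulr_ge0 ?exp_coeff_ge0// mulr_ge0// expR_ge0.
have sum_exp (s : R) n : 0 <= s -> \sum_(j < n) exp_coeff s j <= expR s.
  move=> s0; rewrite -(big_mkord xpredT (fun j => exp_coeff s j)).
  have := @nondecreasing_cvgn_le R (series (exp_coeff s)); apply.
    by apply: nondecreasing_series => j _ _; exact: exp_coeff_ge0.
  exact: is_cvg_series_exp_coeff.
have cM t n (z : R) : `|z| <= r -> \sum_(j < n) c j t * `|z| ^+ j <= g t.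
  move=> zr; rewrite /g mulrDr expRD mulrA.
  apply: (@le_trans _ _ (k t * expR (lam t * x) * expR (lam t * `|z|))); last first.
    rewrite ler_wpM2l//; first by rewrite mulr_ge0// expR_ge0.
    by rewrite ler_expR ler_wpM2l.
  have ke : 0 <= k t * expR (lam t * x) by rewrite mulr_ge0// expR_ge0.
  have lz : 0 <= lam t * `|z| by rewrite mulr_ge0.
  apply: le_trans (ler_wpM2l ke (sum_exp _ n lz)).
  rewrite mulr_sumr; apply: ler_sum => j _.
  rewrite /c /exp_coeff/= exprMn le_eqVlt; apply/orP; left; apply/eqP; ring.
have cr j t : c j t * r ^+ j <= g t.
  have := cM t j.+1 r; rewrite (ger0_norm (ltW r0)) => /(_ (lexx r)).
  rewrite big_ord_recr/=; apply: le_trans; rewrite lerDr.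
  by apply: sumr_ge0 => i _; rewrite mulr_ge0// exprn_ge0// ltW.
have Ic j : mu.-integrable setT (EFin \o c j).
  have : mu.-integrable setT (fun t => (r ^- j)%:E * (g t)%:E)%E by exact: integrableZl.
  apply: le_integrable => //; first exact/measurable_EFinP.
  move=> t _ /=; rewrite lee_fin !ger0_norm//; last first.
    by rewrite mulr_ge0 ?invr_ge0 ?exprn_ge0 ?(ltW r0)// mulr_ge0// expR_ge0.
  by rewrite mulrC ler_pdivlMr ?exprn_gt0.
pose a j := fine (\int[mu]_t (c j t)%:E)%E.
have aE j : (\int[mu]_t (c j t)%:E = (a j)%:E)%E.
  by rewrite fineK//; exact: (integrable_fin_num measurableT (Ic j)).
have a0 j : 0 <= a j by apply/fine_ge0/integral_ge0 => t _; rewrite lee_fin.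
have gE : (\int[mu]_t (g t)%:E = (fine (laplace mu (x + r)))%:E)%E.
  by rewrite fineK// ge0_fin_numE// laplace_ge0.
exists a, (fine (laplace mu (x + r))); split.
  move=> j; rewrite ger0_norm// -lee_fin -gE mulrC EFinM -aE -ge0_integralZl//; last 3 first.
  - by apply/measurable_EFinP.
  - by move=> t _; rewrite lee_fin.
  - by rewrite lee_fin exprn_ge0// ltW.
  apply: ge0_le_integral => //.
  - by move=> t _; rewrite -EFinM lee_fin mulr_ge0// exprn_ge0// ltW.
  - by apply/measurable_EFinP; exact: measurable_funM.
  - by apply/measurable_EFinP.
  - by move=> t _; rewrite -EFinM lee_fin mulrC.
move=> z zr.
have [|||||_ _ cI] := @dominated_convergence _ _ _ mu setT measurableT
  (fun n t => (\sum_(j < n) c j t * z ^+ j)%:E)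
  (fun t => (k t * expR (lam t * (x + z)))%:E) (EFin \o g).
- move=> n; apply/measurable_EFinP; apply: measurable_sum => j.
  by apply: measurable_funM.
- exact/measurable_EFinP.
- apply: aeW => t _; apply: cvg_EFin; first exact: nearW.
  rewrite /comp/= mulrDr expRD mulrA.
  rewrite (_ : (fun n => _) = (fun n => k t * expR (lam t * x) *
      series (exp_coeff (lam t * z)) n)); last first.
    apply/funext => n; rewrite /series/= big_mkord mulr_sumr; apply: eq_bigr => j _.
    by rewrite /c /exp_coeff/= exprMn; ring.
  by apply: cvgMl_tmp; exact: is_cvg_series_exp_coeff.
- exact: Ig.
- apply: aeW => t n _; rewrite /= lee_fin; apply: le_trans (cM t n z zr).
  apply: le_trans (ler_norm_sum _ _ _) _; apply: ler_sum => j _.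
  by rewrite normrM normrX ger0_norm.
have iE n : (\int[mu]_t (\sum_(j < n) c j t * z ^+ j)%:E =
             (\sum_(j < n) a j * z ^+ j)%:E)%E.
  under eq_integral do rewrite -sumEFin.
  rewrite integral_sum//; last first.
    move=> j; under eq_fun do rewrite mulrC EFinM.
    by apply: integrableZl => //; exact: Ic.
  rewrite -sumEFin; apply: eq_bigr => j _.
  under eq_integral do rewrite mulrC EFinM.
  rewrite (integralZl measurableT (Ic j)) [X in (_ * X)%E](aE j).
  by rewrite -EFinM mulrC.
have lE : laplace mu (x + z) = (fine (laplace mu (x + z)))%:E.
  rewrite fineK// ge0_fin_numE ?laplace_ge0//; apply: le_lt_trans foo.
  by apply: laplace_le; rewrite lerD2l (le_trans (ler_norm _)).
have cE : (fun n => (\sum_(j < n) a j * z ^+ j)%:E) @ \oo -->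
    (fine (laplace mu (x + z)))%:E.
  by rewrite -lE; under eq_fun do rewrite -iE; exact: cI.
exact: (fine_cvg cE).
Qed.

(** In the expansion at [x], the terms of degree at least 1 are at most [2 * C * (|y - x| / r)] when
    [|y - x| <= r / 2]. *)
Lemma laplace_continuous mu x b e : x < b -> (laplace mu b < +oo)%E -> 0 < e ->
  exists2 dl, 0 < dl & forall y, `|y - x| < dl ->
    `|fine (laplace mu y) - fine (laplace mu x)| <= e.
Proof.
move=> xb foo e0; have r0 : 0 < b - x by rewrite subr_gt0.
have [|a [C [aC aP]]] := @laplace_series mu x (b - x) r0; first by rewrite addrC subrK.
set r := b - x in r0 aC aP.
have C0 : 0 <= C by apply: le_trans (aC 0%N); rewrite mulr_ge0// exprn_ge0// ltW.
have C1 : 0 < 2 * C + 1 by rewrite ltr_wpDl// mulr_ge0.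
have dl0 : 0 < e * r / (2 * C + 1) by rewrite divr_gt0// mulr_gt0.
exists (Num.min (r / 2) (e * r / (2 * C + 1))); first by rewrite lt_min dl0 divr_gt0.
move=> y; rewrite lt_min => /andP[yr ye].
have yr' : `|y - x| <= r by apply: ltW; apply: lt_le_trans yr _; lra.
have c1 := aP (y - x) yr'; rewrite (addrC x) subrK in c1.
have a0E : fine (laplace mu x) = a 0%N.
  have := aP 0; rewrite normr0 addr0 => /(_ (ltW r0)) c2.
  apply: (cvg_unique _ c2) => //; apply: cvg_near_cst.
  exists 1%N => // -[//|n] _ /=; rewrite big_ord_recl expr0 mulr1 big1 ?addr0// => j _.
  by rewrite expr0n/= mulr0.
rewrite a0E; apply: (@le_trans _ _ (2 * C * (`|y - x| / r))); last first.
  move: ye; rewrite ltr_pdivlMr// => ye.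
  by rewrite mulrA ler_pdivrMr//; have := normr_ge0 (y - x); lra.
apply/ler_addgt0Pr => eta eta0.
have /cvgrPdist_lt/(_ eta eta0)[N _ NP] := c1.
have SE : \sum_(j < N.+1) a j * (y - x) ^+ j =
    a 0%N + \sum_(j < N) a (1 + j)%N * (y - x) ^+ (1 + j).
  by rewrite big_ord_recl expr0 mulr1.
have := NP N.+1 (leqnSn _); rewrite /= SE.
set S := \sum_(i < N) _ => /ltW dS.
have St : `|S| <= 2 * C * (`|y - x| / r).
  by have := @power_series_tail _ a r C (y - x) 1 N r0 aC (ltW yr); rewrite expr1.
rewrite (_ : _ - _ = S + (fine (laplace mu y) - (a 0%N + S))); last by ring.
by apply: le_trans (ler_normD _ _) _; exact: lerD.
Qed.

(* Around [x], both transforms are power series of radius [b - x], which agree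
   near [x] only if their coefficients do. *)
Lemma laplace_identity_near mu1 mu2 x b : x < b ->
  (laplace mu1 b < +oo)%E -> (laplace mu2 b < +oo)%E ->
  (forall e, 0 < e -> exists y, [/\ y != x, `|y - x| < e &
     laplace mu1 y = laplace mu2 y]) ->
  forall y, x - (b - x) <= y <= b -> laplace mu1 y = laplace mu2 y.
Proof.
move=> xb f1 f2 acc y yb; have r0 : 0 < b - x by rewrite subr_gt0.
have [|a1 [C1 [a1C a1P]]] := @laplace_series mu1 x (b - x) r0.
  by rewrite addrC subrK.
have [|a2 [C2 [a2C a2P]]] := @laplace_series mu2 x (b - x) r0.
  by rewrite addrC subrK.
set r := b - x in r0 a1C a1P a2C a2P yb.
have aE j : a1 j = a2 j.
  apply/eqP; rewrite -subr_eq0; apply/eqP.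
  apply: (@power_series_zero _ (fun j => a1 j - a2 j) r (C1 + C2) r0).
    move=> i; apply: (@le_trans _ _ ((`|a1 i| + `|a2 i|) * r ^+ i)).
      by rewrite ler_wpM2r ?exprn_ge0 ?(ltW r0)// ler_normB.
    by rewrite mulrDl lerD.
  move=> e e0; have me : 0 < Num.min e r by rewrite lt_min e0.
  have [z [zx ze zE]] := acc _ me; move: ze; rewrite lt_min => /andP[ze zr].
  exists (z - x); rewrite subr_eq0; split=> //.
  have c1 := a1P (z - x) (ltW zr); have c2 := a2P (z - x) (ltW zr).
  have -> : (fun n => \sum_(j < n) (a1 j - a2 j) * (z - x) ^+ j) =
      fun n => \sum_(j < n) a1 j * (z - x) ^+ j - \sum_(j < n) a2 j * (z - x) ^+ j.
    by apply/funext => n; rewrite -sumrB; apply: eq_bigr => i _; rewrite mulrBl.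
  rewrite (addrC x) subrK in c1 c2; rewrite zE in c1.
  by have c3 := cvgB c1 c2; rewrite subrr in c3; exact: c3.
have yr : `|y - x| <= r.
  by case/andP: yb => y1 y2; rewrite ler_norml; apply/andP; split; rewrite /r in y1 *; lra.
have c1 := a1P (y - x) yr; have c2 := a2P (y - x) yr.
rewrite (addrC x) subrK in c1 c2.
have fE : fine (laplace mu1 y) = fine (laplace mu2 y).
  have SE : (fun n => \sum_(j < n) a1 j * (y - x) ^+ j) =
      fun n => \sum_(j < n) a2 j * (y - x) ^+ j.
    by apply/funext => n; under eq_bigr do rewrite aE.
  by rewrite SE in c1; apply: cvg_unique c1 c2.
have fin mu : (laplace mu b < +oo)%E -> laplace mu y \is a fin_num.
  move=> fb; rewrite ge0_fin_numE ?laplace_ge0//; apply: le_lt_trans fb.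
  by apply: laplace_le; case/andP: yb.
by rewrite -(fineK (fin _ f1)) -(fineK (fin _ f2)) fE.
Qed.

(** Agreement spreads to the left by steps of length [b - x]: it holds on the interval from [c] to
    [b], so it accumulates at [c] from the right, and the expansion at [c] has radius
    [b - c >= b - x]. *)
Lemma laplace_identity mu1 mu2 x b : x < b ->
  (laplace mu1 b < +oo)%E -> (laplace mu2 b < +oo)%E ->
  (forall e, 0 < e -> exists y, [/\ y != x, `|y - x| < e &
     laplace mu1 y = laplace mu2 y]) ->
  forall y, y <= b -> laplace mu1 y = laplace mu2 y.
Proof.
move=> xb f1 f2 acc; have r0 : 0 < b - x by rewrite subr_gt0.
have key n : forall y, x - (b - x) * n.+1%:R <= y <= b -> laplace mu1 y = laplace mu2 y.
  elim: n => [|n IHn] y.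
    by rewrite mulr1; exact: laplace_identity_near.
  move=> /andP[y1 y2]; set c := x - (b - x) * n.+1%:R in IHn.
  have cb : c < b.
    have : 0 <= (b - x) * n.+1%:R by rewrite mulr_ge0// ltW.
    by rewrite /c; lra.
  apply: (@laplace_identity_near mu1 mu2 c b) => //.
    move=> e e0; pose t := Num.min (e / 2) (b - c).
    have t0 : 0 < t by rewrite lt_min divr_gt0//= subr_gt0.
    have te : t < e by rewrite gt_min; apply/orP; left; lra.
    exists (c + t); split.
    - by rewrite -subr_eq0 addrAC subrr add0r gt_eqF.
    - by rewrite addrAC subrr add0r gtr0_norm.
    - apply: IHn; rewrite lerDl ltW//=.
      have : t <= b - c by rewrite ge_min lexx orbT.
      by lra.
  rewrite y2 andbT; apply: le_trans y1.
  rewrite /c -[in leRHS]natr1 mulrDr mulr1.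
  have : 0 <= (b - x) * n.+1%:R by rewrite mulr_ge0// ltW.
  lra.
move=> y yb; have [n yn] : exists n : nat, x - y <= (b - x) * n.+1%:R.
  exists (Num.truncn ((x - y) / (b - x))).
  rewrite mulrC -ler_pdivrMr//.
  by rewrite ltW// real_truncnS_gt// num_real.
by apply: (key n); rewrite yb andbT; lra.
Qed.

End laplace.

(** * The exponential e-variables and their mixtures *)

Section exponential_evariables.
Context (R : realType) (psi : R -> \bar R) (lmax : \bar R).
Hypothesis psi_ge0 : forall l, (0 <= psi l)%E.
Hypothesis psi_convex : convex_efun psi.
Hypothesis psi0 : psi 0 = 0%E.
Hypothesis lmax_gt0 : (0 < lmax)%E.
Hypothesis psi_dom : edom psi = EFin @^-1` right_open_params lmax \/
  (edom psi = EFin @^-1` closed_params lmax /\ (lmax < +oo)%E).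

Let D (l : R) := right_open_params lmax l%:E.
Let p l := fine (psi l).

Let psiE l : edom psi l -> psi l = (p l)%:E.
Proof. by move=> dl; rewrite fineK// ge0_fin_numE. Qed.

Let D_dom l : D l -> edom psi l.
Proof.
move=> Dl; have /andP[l0 ll] := Dl.
by case: psi_dom => [->//|[-> _]]; rewrite /closed_params /= l0 ltW.
Qed.

Let dom_le l : edom psi l -> 0 <= l /\ (l%:E <= lmax)%E.
Proof.
by case: psi_dom => [->|[-> _]] => /andP[]; rewrite lee_fin => l0 ll;
  split=> //; exact: ltW.
Qed.

Let p_ge0 l : 0 <= p l. Proof. by rewrite fine_ge0. Qed.

Let p0 : p 0 = 0. Proof. by rewrite /p psi0. Qed.

Let dom_convex t x y : 0 <= t <= 1 -> edom psi x -> edom psi y ->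
  edom psi (t * x + (1 - t) * y) /\ p (t * x + (1 - t) * y) <= t * p x + (1 - t) * p y.
Proof.
move=> t01 dx dy; have := psi_convex x y t01.
rewrite (psiE dx) (psiE dy) -!EFinM -EFinD => H.
have dxy : edom psi (t * x + (1 - t) * y) by apply: le_lt_trans H _; rewrite ltry.
by split=> //; move: H; rewrite psiE// lee_fin.
Qed.

Let p_convex t x y : 0 <= t <= 1 -> D x -> D y ->
  p (t * x + (1 - t) * y) <= t * p x + (1 - t) * p y.
Proof. by move=> t01 /D_dom dx /D_dom dy; exact: (dom_convex t01 dx dy).2. Qed.

Lemma conjugate_bound x : edom (econjugate psi) x ->
  forall l, edom psi l -> l * x - p l <= fine (econjugate psi x).
Proof.
move=> Xx l dl; have le : ((l * x)%:E - psi l <= econjugate psi x)%E.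
  by apply: ereal_sup_ubound; exists l.
move: le; rewrite (psiE dl) -EFinB; move: Xx; rewrite /edom/=.
by case: (econjugate psi x).
Qed.

Lemma exp_evarE l x : D l -> exp_evar psi lmax l%:E x = (expR (l * x - p l))%:E.
Proof.
by move=> Dl; rewrite /exp_evar; case/andP: (Dl) => _ ->/=; rewrite psiE// ; exact: D_dom.
Qed.

(** Turns the limit in [exp_evar], taken along a filter on the extended line, into an estimate over
    real parameters, for finite and infinite [lmax] alike. *)
Lemma exp_evar_limit x : edom (econjugate psi) x -> exists L : R,
  [/\ 0 <= L <= expR (fine (econjugate psi x)), exp_evar psi lmax lmax x = L%:E &
   forall e, 0 < e -> exists2 l1, D l1 &
    forall l, D l -> l1 <= l -> `|expR (l * x - p l) - L| <= e].
Proof.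
move=> Xx.
have xC l : D l -> l * x - p l <= fine (econjugate psi x).
  by move=> Dl; apply: conjugate_bound => //; exact: D_dom.
have [L [L0 LP]] := expR_exponent_limit lmax_gt0 p_convex xC.
exists L; split=> //; rewrite /exp_evar ltxx.
pose F := within [set m | m < lmax]%E (nbhs lmax).
have nearF l1 : D l1 -> \forall m \near F, exists2 l, m = l%:E & D l /\ l1 <= l.
  move=> Dl1; have /andP[l10 l1l] := Dl1.
  rewrite /F near_withinE.
  have : \forall m \near lmax, (l1%:E < m)%E.
    by apply: open_nbhs_nbhs; split=> //; exact: open_ereal_gt_ereal.
  apply: filterS => m l1m ml.
  have mfin : m \is a fin_num.
    by rewrite fin_numE gt_eqF ?lt_eqF// ?(lt_trans _ l1m)// ?ltNyr// (lt_le_trans ml)// leey.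
  exists (fine m); first by rewrite fineK.
  have l1m' : l1 <= fine m by rewrite -lee_fin fineK// ltW.
  split=> //; apply/andP; split; last by rewrite fineK.
  by rewrite lee_fin; apply: le_trans l1m'; rewrite -lee_fin.
have PF : ProperFilter F.
  apply: within_nbhs_proper => B.
  have [[r lr]|lr] : (exists r, lmax = r%:E) \/ lmax = +oo%E.
  - by case: (lmax) lmax_gt0 => [r _| |//]; [left; exists r|right].
  - rewrite lr => /nbhs_EFin/nbhs_ballP[e /= e0 eB].
    exists (r - e / 2)%:E; split; first by rewrite /= lte_fin; lra.
    by apply: eB; rewrite /ball/= opprB addrC subrK ger0_norm; lra.
  rewrite lr => -[M [Mr MB]]; exists (M + 1)%:E; split; first exact: ltry.
  by apply: MB; rewrite lte_fin ltrDl.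
apply: cvg_lim => //; apply: cvg_EFin.
  have D0 : D 0 by rewrite /D /right_open_params/= lexx.
  apply: filterS (nearF 0 D0) => m [l -> [Dl _]] /=.
  by rewrite psiE//; exact: D_dom.
apply/cvgrPdist_le => e e0; have [l1 Dl1 l1P] := LP e e0.
apply: filterS (nearF l1 Dl1) => m [l -> [Dl l1l]] /=.
by rewrite psiE/=; [rewrite distrC; exact: l1P|exact: D_dom].
Qed.

(* [tau] maps [0, 1] onto [0, lmax], also when [lmax = +oo]. *)
Let c := contract lmax.
Let tau (t : R) : \bar R := expand (t * c).

Let c01 : 0 < c <= 1.
Proof.
apply/andP; split; last by have := contract_le1 lmax; rewrite ler_norml => /andP[].
by rewrite -contract0 lt_contract.
Qed.

Let contract_tau t : 0 <= t <= 1 -> contract (tau t) = t * c.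
Proof.
move=> /andP[t0 t1]; have /andP[c0 c1] := c01.
rewrite /tau expandK// inE/= ger0_norm; last by rewrite mulr_ge0// ltW.
by rewrite mulr_ile1// ltW.
Qed.

Let tau1 : tau 1 = lmax. Proof. by rewrite /tau mul1r contractK. Qed.

Let tau_lt t : 0 <= t < 1 -> exists2 l, tau t = l%:E & D l.
Proof.
move=> /andP[t0 t1]; have /andP[c0 c1] := c01.
have ct := contract_tau (introT andP (conj t0 (ltW t1))).
have tl : (tau t < lmax)%E by rewrite -lt_contract ct -/c -ltr_pdivlMr// divff ?gt_eqF.
have t_ge0 : (0 <= tau t)%E by rewrite -le_contract contract0 ct mulr_ge0// ltW.
have tfin : tau t \is a fin_num by rewrite ge0_fin_numE// (lt_le_trans tl)// leey.
exists (fine (tau t)); first by rewrite fineK.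
by rewrite /D fineK//; apply/andP.
Qed.

Let tau_surj l : D l -> exists2 t, 0 <= t < 1 & tau t = l%:E.
Proof.
move=> /andP[l0 ll]; have /andP[c0 c1] := c01.
exists (contract l%:E / c); last by rewrite /tau divfK ?gt_eqF// contractK.
apply/andP; split.
  by rewrite divr_ge0 ?(ltW c0)// -contract0 le_contract.
by rewrite ltr_pdivrMr// mul1r lt_contract.
Qed.

Definition exp_param x t := fine (exp_evar psi lmax (tau t) x).

Lemma exp_evar_fin x t : edom (econjugate psi) x -> 0 <= t <= 1 ->
  exp_evar psi lmax (tau t) x = (exp_param x t)%:E /\
  0 <= exp_param x t <= expR (fine (econjugate psi x)).
Proof.
move=> Xx /andP[t0]; rewrite le_eqVlt => /orP[/eqP ->|t1].
  by have [L [L0 LE _]] := exp_evar_limit Xx; rewrite /exp_param tau1 LE.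
have [|l tE Dl] := @tau_lt t; first by rewrite t0.
rewrite /exp_param tE exp_evarE//= expR_ge0 ler_expR; split=> //.
by apply: conjugate_bound => //; exact: D_dom.
Qed.

Lemma exp_param_continuous x t e : edom (econjugate psi) x ->
  0 <= t <= 1 -> 0 < e -> exists2 d, 0 < d & forall s, 0 <= s <= 1 ->
    `|s - t| < d -> `|exp_param x s - exp_param x t| <= e.
Proof.
move=> Xx /andP[t0]; rewrite le_eqVlt => /orP[/eqP ->|t1] e0.
  have [L [L0 LE LP]] := exp_evar_limit Xx.
  have [l1 Dl1 l1P] := LP e e0; have [t1 /andP[t10 t11] t1E] := tau_surj Dl1.
  exists (1 - t1); first by rewrite subr_gt0.
  move=> s /andP[s0]; rewrite le_eqVlt => /orP[/eqP -> _|s1 st].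
    by rewrite subrr normr0 ltW.
  have [|l sE Dl] := @tau_lt s; first by rewrite s0.
  rewrite /exp_param sE exp_evarE// tau1 LE/=; apply: l1P => //.
  have ts : t1 <= s by have := ler_norm (1 - s); rewrite distrC in st; lra.
  have s01 : 0 <= s <= 1 by rewrite s0 ltW.
  have t101 : 0 <= t1 <= 1 by rewrite t10 ltW.
  rewrite -lee_fin -t1E -sE -le_contract (contract_tau t101) (contract_tau s01).
  by rewrite ler_wpM2r//; case/andP: c01 => /ltW.
have [|l tE Dl] := @tau_lt t; first by rewrite t0.
have [dl dl0 dlP] := expR_exponent_continuous lmax_gt0 p_ge0 p0 p_convex x Dl e0.
have tau_cont : \forall s \near t, `|fine (tau s) - l| < dl.
  have /andP[c0 c1] := c01.
  have tc1 : `|t * c| < 1.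
    by rewrite ger0_norm ?mulr_ge0 ?(ltW c0)//; nra.
  pose f (s : R) := s * c / (1 - `|s * c|).
  have cm : (fun s : R => s * c) @ t --> t * c by apply: cvgMr_tmp; exact: cvg_id.
  have cn : (fun s : R => `|s * c|) @ t --> `|t * c| by exact: cvg_norm cm.
  have fE (s : R) : `|s * c| < 1 -> fine (tau s) = f s.
    by move=> sc1; rewrite /tau /expand !leNgt ltrNl; case/ltr_normlP: sc1 => -> ->.
  have cf : f @ t --> l.
    rewrite (_ : l = f t); last by rewrite -fE// tE.
    apply: cvgM => //; apply: cvgV; first by rewrite subr_eq0 gt_eqF.
    by apply: cvgB => //; exact: cvg_cst.
  have n1 : \forall s \near t, `|s * c| < 1 by exact: cvgr_lt cn _ tc1.
  have /cvgrPdist_lt/(_ dl dl0) := cf.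
  apply: filterS2 n1 => s sc1; rewrite fE// distrC.
  exact.
have /nbhs_ballP[d1 /= d10 d1P] := tau_cont.
exists (Num.min d1 (1 - t)); first by rewrite lt_min d10 subr_gt0.
move=> s /andP[s0 _]; rewrite lt_min => /andP[sd st].
have s1 : s < 1 by have := ler_norm (s - t); lra.
have [|l' sE Dl'] := @tau_lt s; first by rewrite s0.
rewrite /exp_param sE tE !exp_evarE//=; apply: dlP => //.
have := d1P s; rewrite /ball/= distrC => /(_ sd).
by rewrite sE.
Qed.

Local Notation X := (conj_space psi_ge0).
Local Notation cv := (@conj_val R psi psi_ge0).

Lemma conj_valP (x : X) : edom (econjugate psi) (cv x).
Proof. by have := valP x; rewrite inE. Qed.

Lemma conj_val_surj x : edom (econjugate psi) x -> exists z : X, cv z = x.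
Proof. by move=> Xx; exists (exist _ x (mem_set Xx)). Qed.

Lemma measurable_conj_val : measurable_fun setT cv.
Proof. by move=> _ B mB; exists B. Qed.

Let measurable_psi : measurable_fun setT psi.
Proof.
apply: measurable_of_intervals => a x y /= xa ya z /andP[xz zy].
have dx : edom psi x by apply: lt_trans xa _; rewrite ltry.
have dy : edom psi y by apply: lt_trans ya _; rewrite ltry.
have [xy|yx] := ltP x y; last first.
  by rewrite (_ : z = x)//; apply/eqP; rewrite eq_le xz (le_trans zy yx).
pose t := (y - z) / (y - x).
have t01 : 0 <= t <= 1.
  by rewrite /t; apply/andP; split; [rewrite divr_ge0 ?subr_ge0// ltW|
    rewrite ler_pdivrMr ?subr_gt0// mul1r lerD2l lerN2].
have zE : t * x + (1 - t) * y = z.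
  by rewrite /t; field; rewrite subr_eq0 gt_eqF.
have [dz] := dom_convex t01 dx dy; rewrite zE in dz *.
rewrite (psiE dz) lte_fin => pz; apply: le_lt_trans pz _.
rewrite (psiE dx) lte_fin in xa; rewrite (psiE dy) lte_fin in ya.
have ma : Num.max (p x) (p y) < a by rewrite gt_max xa ya.
apply: le_lt_trans ma; set m := Num.max _ _.
have xm : p x <= m by rewrite le_max lexx.
have ym : p y <= m by rewrite le_max lexx orbT.
case/andP: t01 => t0 t1.
have : 0 <= t * (m - p x) by rewrite mulr_ge0// subr_ge0.
have : 0 <= (1 - t) * (m - p y) by rewrite mulr_ge0// subr_ge0.
lra.
Qed.

(** A sequence of real parameters tending to [lmax]: it gives access to measurability, Fatou and
    dominated convergence for the endpoint function. *)
Let limit_seq n := fine (tau (1 - n.+1%:R^-1)).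

Let limit_seqP n : D (limit_seq n) /\ tau (1 - n.+1%:R^-1) = (limit_seq n)%:E.
Proof.
have [|l tE Dl] := @tau_lt (1 - n.+1%:R^-1).
  by rewrite subr_ge0 invf_le1// ler1n/= gtrBl invr_gt0.
by rewrite /limit_seq tE.
Qed.

Let limit_seq_cvg x : edom (econjugate psi) x ->
  (fun n => exp_evar psi lmax (limit_seq n)%:E x) @ \oo --> exp_evar psi lmax lmax x.
Proof.
move=> Xx; have t11 : 0 <= (1 : R) <= 1 by rewrite ler01 lexx.
have [LE _] := exp_evar_fin Xx t11; rewrite tau1 in LE; rewrite LE.
apply: cvg_EFin.
  by apply: nearW => n; rewrite exp_evarE//; exact: (limit_seqP n).1.
apply/cvgrPdist_le => e e0.
have [d0 d00 d0P] := exp_param_continuous Xx t11 e0.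
have /cvgrPdist_lt/(_ d0 d00) := @cvg_harmonic R.
apply: filterS => n; rewrite sub0r normrN => nd.
rewrite distrC /= -(limit_seqP n).2; apply: d0P.
  by rewrite subr_ge0 invf_le1// ler1n/= gerBl invr_ge0.
by rewrite addrAC subrr sub0r normrN.
Qed.

Lemma exp_evar_ge0 l (x : X) : (0 <= exp_evar psi lmax l (cv x))%E.
Proof.
have [ll|ll] := boolP (l < lmax)%E; first by rewrite /exp_evar ll expeR_ge0.
have -> : exp_evar psi lmax l (cv x) = exp_evar psi lmax lmax (cv x).
  by rewrite /exp_evar (negbTE ll) ltxx.
have [L [/andP[L0 _] -> _]] := exp_evar_limit (conj_valP x).
by rewrite lee_fin.
Qed.

Let measurable_real_exp l :
  measurable_fun setT (fun x : X => exp_evar psi lmax (limit_seq l)%:E (cv x)).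
Proof.
under eq_fun do rewrite (exp_evarE _ (limit_seqP l).1).
apply/measurable_EFinP; apply: measurableT_comp => //.
apply: measurable_funB => //; apply: measurable_funM => //.
exact: measurable_conj_val.
Qed.

Lemma measurable_exp_evar : measurable_fun setT
  (fun z : \bar R * X => exp_evar psi lmax z.1 (cv z.2)).
Proof.
(* A parameter below [lmax] may be a negative real, where [psi] is infinite and the value is
   [expeR -oo = 0]. *)
have -> : (fun z : \bar R * X => exp_evar psi lmax z.1 (cv z.2)) =
  fun z => if (z.1 < lmax)%E then
    (if (psi (fine z.1) < +oo)%E then
       (expR (fine z.1 * cv z.2 - fine (psi (fine z.1))))%:E else 0%E)
    else exp_evar psi lmax lmax (cv z.2).
  apply/funext => -[l x]; rewrite /exp_evar ltxx /=; case: ifPn => // _.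
  case: ifPn => [dl|]; first by rewrite (psiE dl).
  by rewrite -leNgt leye_eq => /eqP ->.
have mfine : measurable_fun setT (fun z : \bar R * X => fine z.1).
  by apply: measurableT_comp; [exact: fine_measurable|exact: measurable_fst].
have mpsi : measurable_fun setT (fun z : \bar R * X => psi (fine z.1)).
  exact: measurableT_comp measurable_psi mfine.
apply: measurable_fun_ifT => /=.
- exact: measurable_fun_lte (measurable_fst) (measurable_cst _).
- apply: measurable_fun_ifT => //.
  + exact: measurable_fun_lte mpsi (measurable_cst _).
  + apply/measurable_EFinP; apply: measurableT_comp => //.
    apply: measurable_funB.
      apply: measurable_funM; first exact: mfine.
      by apply: measurableT_comp; [exact: measurable_conj_val|exact: measurable_snd].
    by apply: measurableT_comp; [exact: fine_measurable|exact: mpsi].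
- apply: (@measurableT_comp _ _ _ _ _ _ (fun x : X => exp_evar psi lmax lmax (cv x))) => //.
  apply: (emeasurable_fun_cvg (fun n (x : X) => exp_evar psi lmax (limit_seq n)%:E (cv x))).
    by move=> n; exact: measurable_real_exp.
  by move=> x _; exact: limit_seq_cvg (conj_valP x).
Qed.

Let P := sub_psi psi_ge0.

(** Below [lmax] this is the sub-psi inequality divided by [expR (p l)]; at [lmax] it follows by
    Fatou along [limit_seq]. *)
Lemma integral_exp_evar_le1 mu l : P mu -> closed_params lmax l ->
  (\int[mu]_x exp_evar psi lmax l (cv x) <= 1)%E.
Proof.
move=> Pmu /andP[l0]; rewrite le_eqVlt => /predU1P ll.
have fin r : D r -> (\int[mu]_x exp_evar psi lmax r%:E (cv x) <= 1)%E.
  move=> Dr.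
  have mE : measurable_fun setT (fun x : X => (expR (r * cv x))%:E).
    apply/measurable_EFinP; apply: measurableT_comp => //.
    by apply: measurable_funM => //; exact: measurable_conj_val.
  have E0 (x : X) : setT x -> (0 <= (expR (r * cv x))%:E)%E.
    by rewrite lee_fin expR_ge0.
  have k0 : (0 <= (expR (p r))^-1%:E)%E by rewrite lee_fin invr_ge0 expR_ge0.
  have -> : (\int[mu]_x exp_evar psi lmax r%:E (cv x) =
      \int[mu]_x ((expR (p r))^-1%:E * (expR (r * cv x))%:E))%E.
    by apply: eq_integral => x _; rewrite exp_evarE// expRB mulrC EFinM.
  rewrite ge0_integralZl//.
  have := Pmu r (D_dom Dr); rewrite psiE/=; last exact: D_dom.
  move=> H; apply: (@le_trans _ _ ((expR (p r))^-1%:E * (expR (p r))%:E)%E).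
    by apply: lee_wpmul2l => //; rewrite lee_fin invr_ge0 expR_ge0.
  by rewrite -EFinM mulVf ?gt_eqF ?expR_gt0.
case: ll => [->|ll]; last first.
  have lfin : l \is a fin_num by rewrite ge0_fin_numE// (lt_le_trans ll)// leey.
  by rewrite -(fineK lfin); apply: fin; rewrite /D /right_open_params/= fineK// l0 ll.
under eq_integral => x _.
  rewrite -(cvg_lim _ (limit_seq_cvg (conj_valP x)))// -is_cvg_limn_einfE; last first.
    by apply/cvg_ex; eexists; exact: limit_seq_cvg (conj_valP x).
  over.
apply: le_trans (fatou mu measurableT _ _) _.
- by move=> n; exact: measurable_real_exp.
- by move=> n x _; exact: exp_evar_ge0.
rewrite limn_einf_lim; apply: lime_le; first exact: is_cvg_einfs.
apply: nearW => n.
apply: (@le_trans _ _ (\int[mu]_x exp_evar psi lmax (limit_seq n)%:E (cv x))%E).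
  by apply: ereal_inf_lbound; exists n => /=.
exact: fin (limit_seqP n).1.
Qed.

Lemma mixture_integral (pi : probability (\bar R) R) (L : set (\bar R))
    (mu : {sigma_finite_measure set X -> \bar R}) : measurable L -> pi L = 1%E ->
  let h x := (\int[pi]_(l in L) exp_evar psi lmax l (cv x))%E in
  [/\ measurable_fun setT h, forall x, (0 <= h x)%E &
      (\int[mu]_x h x = \int[pi]_(l in L) \int[mu]_x exp_evar psi lmax l (cv x))%E].
Proof.
move=> mL L1 h.
have mx x : measurable_fun setT (fun l => exp_evar psi lmax l (cv x)).
  exact: (measurable_fun_pair1 x measurable_exp_evar).
have hE : h = fun x => (\int[pi]_l exp_evar psi lmax l (cv x))%E.
  by apply/funext => x; rewrite /h integral_carrier// => l; exact: exp_evar_ge0.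
split.
- rewrite hE; apply: (measurable_fun_fubini_tonelli_G (m1 := pi)
    (fun z : \bar R * X => exp_evar psi lmax z.1 (cv z.2))) => //.
    exact: measurable_exp_evar.
  by move=> z; exact: exp_evar_ge0.
- by move=> x; apply: integral_ge0 => l _; exact: exp_evar_ge0.
- rewrite hE integral_carrier//; last 2 first.
  + apply: (measurable_fun_fubini_tonelli_F (m2 := mu)
      (fun z : \bar R * X => exp_evar psi lmax z.1 (cv z.2))) => //.
      exact: measurable_exp_evar.
    by move=> z; exact: exp_evar_ge0.
  + by move=> l; apply: integral_ge0 => x _; exact: exp_evar_ge0.
  rewrite (fubini_tonelli (m1 := pi) (m2 := mu)
    (fun z : \bar R * X => exp_evar psi lmax z.1 (cv z.2)))//.
    exact: measurable_exp_evar.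
  by move=> z; exact: exp_evar_ge0.
Qed.

Let measurable_params : measurable (closed_params lmax) /\
  measurable (right_open_params lmax).
Proof.
have m0 : measurable [set l : \bar R | (0 <= l)%E].
  by rewrite -[X in measurable X]setTI; apply: measurable_lee => //; exact: measurable_cst.
split.
  have -> : closed_params lmax = [set l | 0 <= l]%E `&` [set l | l <= lmax]%E.
    by apply/seteqP; split=> l /= => [/andP|[? ?]]//; apply/andP.
  apply: measurableI => //; rewrite -[X in measurable X]setTI.
  by apply: measurable_lee => //; exact: measurable_cst.
have -> : right_open_params lmax = [set l | 0 <= l]%E `&` [set l | l < lmax]%E.
  by apply/seteqP; split=> l /= => [/andP|[? ?]]//; apply/andP.
apply: measurableI => //; rewrite -[X in measurable X]setTI.
by apply: measurable_lte => //; exact: measurable_cst.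
Qed.

Lemma mixture_class_evariable L : measurable L -> L `<=` closed_params lmax ->
  mixture_class psi_ge0 lmax L `<=` evariable P.
Proof.
move=> mL LL _ [pi L1 ->].
split; [by have [] := mixture_integral (\d_(point : X)) mL L1| |].
  by move=> x; apply: integral_ge0 => l _; exact: exp_evar_ge0.
move=> mu Pmu; have [_ _ ->] := mixture_integral mu mL L1.
apply: (@le_trans _ _ (\int[pi]_(l in L) cst 1 l)%E); last first.
  have -> // : (\int[pi]_(l in L) cst 1 l = 1)%E.
  by rewrite integral_cst// mul1e; exact: L1.
apply: ge0_le_integral => //.
- by move=> l _; apply: integral_ge0 => x _; exact: exp_evar_ge0.
- apply: measurable_funTS.
  apply: (measurable_fun_fubini_tonelli_F (m2 := mu)
    (fun z : \bar R * X => exp_evar psi lmax z.1 (cv z.2))) => //.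
    exact: measurable_exp_evar.
  by move=> z; exact: exp_evar_ge0.
- by move=> l Ll; apply: integral_exp_evar_le1 => //; exact: LL.
Qed.

(* The weights are divided by some [M' > M], and the remaining mass is put at a
   point so far to the left that the result is sub-psi. *)
Lemma finite_support_sub_psi h (s : seq (R * X)) (M : R) :
  evariable P h -> (forall q, q \in s -> 0 <= q.1) ->
  (forall l, D l -> \sum_(q <- s) q.1 * expR (l * cv q.2 - p l) <= M) ->
  (\sum_(q <- s) q.1%:E * h q.2 <= M%:E)%E.
Proof.
move=> [mh h0 ih] s0 sM; pose W := \sum_(q <- s) q.1.
have D0 : D 0 by rewrite /D /right_open_params /= lexx lmax_gt0.
have W0 : 0 <= W by rewrite /W big_seq; apply: sumr_ge0 => q /s0.
have WM : W <= M.
  have := sM 0 D0; rewrite p0.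
  by under eq_bigr do rewrite mul0r subr0 expR0 mulr1.
apply/lee_addgt0Pr => e e0; rewrite -EFinD.
set M' := M + e; have MM' : M < M' by rewrite /M' ltrDl.
have M'0 : 0 < M' by apply: le_lt_trans MM'; exact: le_trans WM.
pose f l := \sum_(q <- s) q.1 * expR (l * cv q.2).
have cf l : f @ l --> f l.
  apply: cvg_big => [|q _]; first exact: add_continuous.
  apply: cvgMl_tmp; apply: (cvg_comp (fun l => l * cv q.2)); last exact: continuous_expR.
  by apply: cvgMr_tmp; exact: cvg_id.
have f0 : f 0 = W by apply: eq_bigr => q _; rewrite mul0r expR0 mulr1.
have [l0 l00 fl0] : exists2 l0, 0 < l0 & f l0 < M'.
  have : \forall l \near 0, f l < M' by apply: cvgr_lt (cf 0) _ _; rewrite f0 (le_lt_trans WM).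
  move=> /nbhs_ballP[r /= r0 rP]; exists (r / 2); first by rewrite divr_gt0.
  by apply: rP; rewrite /ball/= sub0r normrN ger0_norm; lra.
have fM l : edom psi l -> f l <= M * expR (p l).
  move=> dl.
  have fD r : D r -> f r <= M * expR (p r).
    move=> Dr; rewrite -ler_pdivrMr ?expR_gt0//; apply: le_trans (sM r Dr).
    rewrite /f mulr_suml; apply: ler_sum => q _.
    by rewrite expRB mulrA.
  (* The only other parameter is [lmax] itself, when it belongs to [dom psi]. The bound reaches it
     by continuity of [f], since convexity gives [p (l - k) <= p l]. *)
  have [Dl|nDl] := pselect (D l); first exact: fD.
  have [l_ge0 ll] := dom_le dl.
  have lE : lmax = l%:E.
    apply/eqP; rewrite eq_le ll andbT leNgt; apply/negP => ll'.
    by apply: nDl; rewrite /D /right_open_params/= ll' lee_fin l_ge0.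
  have lgt0 : 0 < l by rewrite -lte_fin -lE.
  rewrite leNgt; apply/negP => fl.
  have : \forall r \near l, M * expR (p l) < f r by exact: cvgr_gt (cf l) _ fl.
  move=> /nbhs_ballP[r /= r0 rP].
  pose k := Num.min (r / 2) (l / 2); have k0 : 0 < k by rewrite lt_min !divr_gt0.
  have kr : k < r by rewrite gt_min; apply/orP; left; lra.
  have kl : k < l by rewrite gt_min; apply/orP; right; lra.
  have := rP (l - k); rewrite /ball/= opprB addrC subrK (ger0_norm (ltW k0)) => /(_ kr).
  have Dlk : D (l - k).
    apply/andP; split; first by rewrite lee_fin subr_ge0 ltW.
    by rewrite lE lte_fin gtrBl.
  apply/negP; rewrite -leNgt; apply: le_trans (fD _ Dlk) _.
  apply: ler_wpM2l; first exact: le_trans WM.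
  rewrite ler_expR.
  have t01 : 0 <= (l - k) / l <= 1.
    rewrite divr_ge0 ?subr_ge0 ?(ltW kl) ?(ltW lgt0)//= ler_pdivrMr// mul1r.
    by rewrite gerBl ltW.
  have [_] := dom_convex t01 dl (D_dom D0).
  rewrite mulr0 addr0 divfK ?gt_eqF// p0 mulr0 addr0 => /le_trans; apply.
  by rewrite ler_piMl//; case/andP: t01.
(* The moment left to the far point at [l0]: the first bound is the slack used for parameters above
   [l0], the second the slack at [l0] itself. *)
pose dl := Num.min (1 - M / M') (1 - f l0 / M').
have dl0 : 0 < dl by rewrite lt_min !subr_gt0 !ltr_pdivrMr// !mul1r MM' fl0.
have dl1 : dl <= 1.
  rewrite /dl ge_min lerBlDr lerDl divr_ge0// ?(ltW M'0)//; exact: le_trans WM.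
pose y := ln dl / l0.
have ye : expR (l0 * y) = dl by rewrite /y mulrC divfK ?gt_eqF// lnK.
have y0 : y <= 0 by rewrite /y pmulr_lle0 ?invr_gt0// ln_le0.
have [z zE] : exists z : X, cv z = y.
  apply: conj_val_surj; rewrite /edom/=; apply: (@le_lt_trans _ _ 0%E); last exact: ltry.
  apply: ge_ereal_sup => _ [l _ <-].
  have [ldom|] := pselect (edom psi l).
    rewrite psiE// -EFinB lee_fin; have [l_ge0 _] := dom_le ldom.
    have := p_ge0 l; have : l * y <= 0 by rewrite mulr_ge0_le0.
    lra.
  by rewrite /edom/= => /negP; rewrite -leNgt leye_eq => /eqP ->; rewrite leNye.
pose s' := (1 - W / M', z) :: [seq (q.1 / M', q.2) | q <- s].
have s'0 q : q \in s' -> 0 <= q.1.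
  rewrite inE => /predU1P[-> /=|/mapP[q' q's ->]/=].
    by rewrite subr_ge0 ler_pdivrMr// mul1r (le_trans WM)// ltW.
  by rewrite divr_ge0 ?s0// ltW.
have s'1 : \sum_(q <- s') q.1 = 1.
  by rewrite big_cons big_map/= -mulr_suml -/W subrK.
have [mu muE] := discrete_probability s'0 s'1.
have WM'1 : 1 - W / M' <= 1 by rewrite gerBl divr_ge0// ltW.
have WM'0 : 0 <= 1 - W / M' by exact: (s'0 _ (mem_head _ _)).
have Pmu : P mu.
  move=> l ldom; rewrite muE; last 2 first.
  - apply/measurable_EFinP; apply: measurableT_comp => //.
    by apply: measurable_funM => //; exact: measurable_conj_val.
  - by move=> x; rewrite lee_fin expR_ge0.
  rewrite (eq_bigr (fun q => (q.1 * expR (l * cv q.2))%:E)); last by [].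
  rewrite sumEFin psiE//= lee_fin big_cons big_map/= zE.
  rewrite (eq_bigr (fun q => q.1 * expR (l * cv q.2) / M')); last by move=> q _; ring.
  rewrite -mulr_suml -/(f l).
  have [l_ge0 _] := dom_le ldom.
  have e1 : 1 <= expR (p l) by rewrite -expR0 ler_expR.
  (* Up to [l0], the moment is below its chord between the parameters 0, where it is the total mass
     1, and [l0], where it is at most [dl + f l0 / M' <= 1]. *)
  have [ll0|l0l] := leP l l0.
    apply: le_trans e1; pose t := l / l0.
    have t01 : 0 <= t <= 1.
      by rewrite /t divr_ge0 ?(ltW l00)//= ler_pdivrMr// mul1r.
    have lt b : l * b = t * (l0 * b) by rewrite mulrA /t divfK ?gt_eqF.
    have hy : expR (l * y) <= 1 - t + t * dl by rewrite lt -ye; exact: expR_chord.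
    have hf : f l <= (1 - t) * W + t * f l0.
      rewrite /f /W !mulr_sumr -big_split/= big_seq [leRHS]big_seq.
      apply: ler_sum => q qs; rewrite lt.
      rewrite (_ : _ + _ = q.1 * (1 - t + t * expR (l0 * cv q.2))); last by ring.
      by rewrite ler_wpM2l ?s0//; exact: expR_chord.
    have dlf : dl <= 1 - f l0 / M' by rewrite ge_min lexx orbT.
    have /andP[t0 t1] := t01.
    apply: (@le_trans _ _ ((1 - W / M') * (1 - t + t * dl) +
        ((1 - t) * W + t * f l0) / M')).
      by apply: lerD; [rewrite ler_wpM2l|rewrite ler_wpM2r// invr_ge0 ltW].
    have : (1 - W / M') * dl <= dl by rewrite ler_piMl// ltW.
    move=> h1; have h2 := le_trans h1 dlf.
    have : t * ((1 - W / M') * dl) <= t * (1 - f l0 / M') by rewrite ler_wpM2l.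
    rewrite -subr_ge0 => h3; rewrite -subr_ge0.
    rewrite [X in 0 <= X](_ : _ = t * (1 - f l0 / M') - t * ((1 - W / M') * dl))//.
    by ring.
  (* Beyond [l0], the far point contributes at most [1 - M / M'] and the other points at most
     [M / M' * expR (p l)], while [expR (p l)] is at least 1. *)
  have hy : expR (l * y) <= dl by rewrite -ye ler_expR ler_wnM2r// ltW.
  have dlM : dl <= 1 - M / M' by rewrite ge_min lexx.
  have h1 : (1 - W / M') * expR (l * y) <= (1 - M / M') * expR (p l).
    apply: (@le_trans _ _ dl).
      by apply: le_trans hy; rewrite ler_piMl// expR_ge0.
    apply: le_trans dlM _; rewrite ler_peMr// subr_ge0 ler_pdivrMr// mul1r ltW//.
  have h2 : f l / M' <= M / M' * expR (p l).
    by rewrite mulrAC ler_wpM2r ?invr_ge0 ?(ltW M'0)// fM.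
  lra.
have := ih mu Pmu; rewrite muE// big_cons big_map/=.
have hz : (0 <= (1 - W / M')%:E * h z)%E by rewrite mule_ge0// lee_fin.
have hs : (0 <= \sum_(q <- s) (q.1 / M')%:E * h q.2)%E.
  rewrite big_seq; apply: sume_ge0 => q qs.
  by rewrite mule_ge0// lee_fin divr_ge0 ?s0// ltW.
move=> H; have {}H : (\sum_(q <- s) (q.1 / M')%:E * h q.2 <= 1)%E.
  by apply: le_trans H; rewrite leeDr.
have -> : (\sum_(q <- s) q.1%:E * h q.2 =
    M'%:E * \sum_(q <- s) (q.1 / M')%:E * h q.2)%E.
  rewrite big_seq [in RHS]big_seq ge0_sume_distrr; last first.
    by move=> q qs; rewrite mule_ge0// lee_fin divr_ge0 ?s0// ltW.
  apply: eq_bigr => q qs; rewrite muleA -EFinM.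
  by rewrite mulrC divfK ?gt_eqF.
by rewrite -[leRHS]mule1; apply: lee_wpmul2l => //; rewrite lee_fin ltW.
Qed.

Let measurable_tau : measurable_fun setT tau.
Proof.
apply: measurable_of_intervals => a x y /= xa ya z /andP[xz zy].
apply: le_lt_trans ya; apply: le_expand.
by rewrite ler_wpM2r//; case/andP: c01 => /ltW.
Qed.

Lemma mixture_class_complete :
  complete_class P (mixture_class psi_ge0 lmax (closed_params lmax)).
Proof.
have [mL _] := measurable_params; split.
  exact: mixture_class_evariable.
move=> h evh; have [mh h0 ih] := evh.
(* Duality for a single point of weight 1: every e-variable lies below the exponential of [psi^*],
   so it is finite and real-valued minimax applies. *)
have hfin (x : X) : (h x <= (expR (fine (econjugate psi (cv x))))%:E)%E.
  have := @finite_support_sub_psi h [:: (1, x)] (expR (fine (econjugate psi (cv x)))) evh.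
  rewrite big_seq1 mul1e; apply.
    by move=> q; rewrite inE => /eqP ->.
  move=> l Dl; rewrite big_seq1 mul1r ler_expR.
  exact: conjugate_bound (conj_valP x) _ (D_dom Dl).
have hE x : h x = (fine (h x))%:E.
  by rewrite fineK// ge0_fin_numE// (le_lt_trans (hfin x))// ltry.
have mx (x : X) : measurable_fun setT (fun l => exp_evar psi lmax l (cv x)).
  exact: (measurable_fun_pair1 x measurable_exp_evar).
have [||||Q [Q1 QP]] := @mixture_dominating R X (fun x t => exp_param (cv x) t)
  (fun x => expR (fine (econjugate psi (cv x)))) (fun x => fine (h x)).
- move=> x; exact: (measurableT_comp (fine_measurable measurableT)
    (measurableT_comp (mx x) measurable_tau)).
- by move=> x t t01; have [] := exp_evar_fin (conj_valP x) t01.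
- move=> x t e t01 e0; have [d d0 dP] := exp_param_continuous (conj_valP x) t01 e0.
  exists d => // s s01 sd; have := le_trans (ler_norm _) (dP s s01 sd).
  by rewrite lerBlDl.
- move=> s M s0 sM; rewrite -lee_fin -sumEFin.
  under eq_bigr do rewrite EFinM -hE.
  apply: finite_support_sub_psi => // l Dl; have [t t01 tE] := tau_surj Dl.
  have := sM t t01; rewrite /exp_param tE.
  by under eq_bigr do rewrite (exp_evarE _ Dl).
have [pi [piE piI]] := pushforward_probability Q measurable_tau.
have tauL t : `[0, 1]%classic t -> closed_params lmax (tau t).
  rewrite /= in_itv/= => t01; have /andP[t0 t1] := t01; have /andP[c0 _] := c01.
  rewrite /closed_params/= -le_contract contract0 (contract_tau t01).
  rewrite mulr_ge0 ?(ltW c0)//= -le_contract (contract_tau t01) -/c.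
  by rewrite ler_piMl// ltW.
have L1 : pi (closed_params lmax) = 1%E.
  apply/eqP; rewrite eq_le probability_le1//= -Q1 piE.
  apply: le_measure; rewrite ?inE//.
  by rewrite -[X in measurable X]setTI; exact: measurable_tau.
exists (fun x : X => \int[pi]_(l in closed_params lmax) exp_evar psi lmax l (cv x))%E.
  by exists pi.
have dom (x : X) :
    (h x <= \int[pi]_(l in closed_params lmax) exp_evar psi lmax l (cv x))%E.
  rewrite integral_carrier//; last by move=> l; exact: exp_evar_ge0.
  rewrite piI//; last by move=> l; exact: exp_evar_ge0.
  rewrite hE; apply: le_trans (QP x) _.
  rewrite (eq_integral (fun t => exp_evar psi lmax (tau t) (cv x))); last first.
    move=> t; rewrite inE/= in_itv/= => t01.
    by have [] := exp_evar_fin (conj_valP x) t01.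
  apply: ge0_subset_integral => //.
  - exact: (measurableT_comp (mx x) measurable_tau).
  - by move=> t _; exact: exp_evar_ge0.
split=> [|mu _].
  by rewrite (_ : [set x | _] = set0)//; apply/seteqP; split => x //= /(_ (dom x)).
rewrite (_ : [set x | _] = set0) ?measure0//.
by apply/seteqP; split => x //= /(_ (dom x)).
Qed.

Let X_le x y : x <= y -> edom (econjugate psi) y -> edom (econjugate psi) x.
Proof.
move=> xy Xy; apply: le_lt_trans Xy; apply: ge_ereal_sup => _ [l _ <-].
have [dl|] := pselect (edom psi l); last first.
  by rewrite /edom/= => /negP; rewrite -leNgt leye_eq => /eqP ->; rewrite leNye.
apply: (@le_trans _ _ ((l * y)%:E - psi l)%E); last by apply: ereal_sup_ubound; exists l.
rewrite psiE// -!EFinB lee_fin lerD2r ler_wpM2l//; exact: (dom_le dl).1.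
Qed.

Let measurable_X : measurable (edom (econjugate psi)).
Proof.
apply: is_interval_measurable => x y Xx Xy z /andP[_ zy].
exact: X_le zy Xy.
Qed.

Lemma exp_evar_le x l : edom (econjugate psi) x -> closed_params lmax l ->
  (exp_evar psi lmax l x <= (expR (fine (econjugate psi x)))%:E)%E.
Proof.
move=> Xx /andP[l0]; rewrite le_eqVlt => /predU1P[->|ll].
  by have [L [/andP[_ LC] -> _]] := exp_evar_limit Xx; rewrite lee_fin.
have lfin : l \is a fin_num by rewrite ge0_fin_numE// (lt_le_trans ll)// leey.
have Dl : D (fine l) by rewrite /D /right_open_params/= fineK// l0 ll.
rewrite -(fineK lfin) exp_evarE// lee_fin ler_expR.
by apply: conjugate_bound => //; exact: D_dom.
Qed.

(** The exponent at [x] is at most [psi^* b - l * (b - x)], which tends to minus infinity with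
    growing [l]. *)
Lemma exp_evar_infty x b : lmax = +oo%E -> edom (econjugate psi) b -> x < b ->
  exp_evar psi lmax lmax x = 0%E.
Proof.
move=> lE Xb xb; have Xx := X_le (ltW xb) Xb.
have [L [/andP[L0 _] -> LP]] := exp_evar_limit Xx.
congr EFin; apply/eqP; rewrite eq_le L0 andbT.
apply/ler_addgt0Pr => e e0; rewrite add0r.
have e2 : 0 < e / 2 by rewrite divr_gt0.
have [l1 Dl1 l1P] := LP _ e2.
set C := fine (econjugate psi b).
pose l := Num.max l1 ((C - ln (e / 2)) / (b - x)).
have Dl : D l.
  rewrite /D /right_open_params/= lE ltry andbT lee_fin le_max.
  by case/andP: Dl1; rewrite lee_fin => ->.
have := l1P l Dl; rewrite le_max lexx => /(_ isT) Ll.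
have el : expR (l * x - p l) <= e / 2.
  rewrite -[leRHS]lnK// ler_expR.
  have h1 : l * b - p l <= C by apply: conjugate_bound => //; exact: D_dom.
  have : (C - ln (e / 2)) <= l * (b - x).
    by rewrite -ler_pdivrMr ?subr_gt0// le_max lexx orbT.
  lra.
have := ler_norm (L - expR (l * x - p l)); rewrite distrC in Ll.
lra.
Qed.

Let limit_seq_ge l1 : D l1 -> \forall n \near \oo, l1 <= limit_seq n.
Proof.
move=> Dl1; have [t1 /andP[t10 t11] t1E] := tau_surj Dl1.
have d0 : 0 < 1 - t1 by rewrite subr_gt0.
have /cvgrPdist_lt/(_ _ d0) := @cvg_harmonic R.
apply: filterS => n; rewrite sub0r normrN ger0_norm ?invr_ge0// => nd.
have {}nd : n.+1%:R^-1 < 1 - t1 by exact: nd.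
rewrite -lee_fin -(limit_seqP n).2 -t1E; apply: le_expand.
apply: ler_wpM2r; first by case/andP: c01 => /ltW.
by rewrite lerBrDr -lerBrDl ltW.
Qed.

(** Below [lmax] the value at [x] is the value at 0 times [expR (l * x)], and both factors
    converge. *)
Lemma exp_evar_lmax_fin M x : lmax = M%:E -> edom (econjugate psi) x ->
  exp_evar psi lmax lmax x =
    (fine (exp_evar psi lmax lmax 0) * expR (M * x))%:E.
Proof.
move=> lE Xx; have X0 : edom (econjugate psi) 0.
  by have := econjugate_dom0 psi_ge0; rewrite inE.
have cvM : limit_seq n @[n --> \oo] --> M.
  apply/cvgrPdist_le => e e0.
  have Dl : D (Num.max 0 (M - e)).
    rewrite /D /right_open_params/= lee_fin le_max lexx/= lE lte_fin gt_max.
    by rewrite -lte_fin -lE lmax_gt0 ltrBlDr ltrDl.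
  have := limit_seq_ge Dl; apply: filterS => n; rewrite ge_max => /andP[_ nM].
  have [/andP[_]] := limit_seqP n; rewrite lE lte_fin => lM _.
  by rewrite ger0_norm ?subr_ge0 ?(ltW lM)//; lra.
have [Lx [_ LxE _]] := exp_evar_limit Xx; have [L0 [_ L0E _]] := exp_evar_limit X0.
have cx := limit_seq_cvg Xx; rewrite LxE in cx; move/fine_cvg in cx.
have c0 := limit_seq_cvg X0; rewrite L0E in c0; move/fine_cvg in c0.
have ce : expR (limit_seq n * x) @[n --> \oo] --> expR (M * x).
  apply: (cvg_comp (fun n => limit_seq n * x)); last exact: continuous_expR.
  by apply: cvgMr_tmp.
have c2 : ((fine \o (fun n => exp_evar psi lmax (limit_seq n)%:E 0)) \*
    (fun n => expR (limit_seq n * x))) n @[n --> \oo] --> L0 * expR (M * x).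
  exact: cvgM.
have fE : (fine \o (fun n => exp_evar psi lmax (limit_seq n)%:E x)) =
    (fine \o (fun n => exp_evar psi lmax (limit_seq n)%:E 0)) \*
    (fun n => expR (limit_seq n * x)).
  apply/funext => n /=.
  rewrite !exp_evarE; [|exact: (limit_seqP n).1|exact: (limit_seqP n).1].
  by rewrite /= mulr0 sub0r -expRD addrC.
rewrite fE in cx; rewrite LxE L0E; congr EFin => /=.
by apply: cvg_unique cx c2.
Qed.

(** Were [psi] bounded below [M], the closed epigraph would contain a point above [M]. So the
    nondecreasing [p] is unbounded there, while [l * x] stays bounded. *)
Lemma exp_evar_closed_zero M x : closed_efun psi -> lmax = M%:E ->
  ~ edom psi M -> edom (econjugate psi) x -> exp_evar psi lmax lmax x = 0%E.
Proof.
move=> cpsi lE ndM Xx.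
have unbounded V : exists2 l, D l & V < p l.
  apply: contrapT => nV; apply: ndM.
  have pV l : D l -> p l <= V.
    by move=> Dl; rewrite leNgt; apply/negP => ?; apply: nV; exists l.
  suff : [set q : R * R | psi q.1 <= q.2%:E]%E (M, V).
    by move=> /= /le_lt_trans; apply; rewrite ltry.
  apply: cpsi => B [[B1 B2] /= [/nbhs_ballP[r /= r0 rB1] B2V] sB].
  have M0 : 0 < M by rewrite -lte_fin -lE.
  pose l := Num.max 0 (M - r / 2).
  have Dl : D l.
    rewrite /D /right_open_params/= lee_fin le_max lexx/= lE lte_fin gt_max M0/=.
    by rewrite ltrBlDr ltrDl divr_gt0.
  exists (l, V); split; first by rewrite /= psiE ?lee_fin ?pV//; exact: D_dom.
  apply: sB; split => /=; last exact: nbhs_singleton.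
  apply: rB1; rewrite /ball/=.
  have lM : l <= M by case/andP: Dl => _; rewrite lE lte_fin => /ltW.
  have : M - r / 2 <= l by rewrite le_max lexx orbT.
  by rewrite ger0_norm ?subr_ge0//; lra.
have [L [/andP[L0 _] -> LP]] := exp_evar_limit Xx.
congr EFin; apply/eqP; rewrite eq_le L0 andbT.
apply/ler_addgt0Pr => e e0; rewrite add0r.
have e2 : 0 < e / 2 by rewrite divr_gt0.
have [l1 Dl1 l1P] := LP _ e2.
have [l2 Dl2 pl2] := unbounded (M * `|x| - ln (e / 2)).
pose l := Num.max l1 l2.
have Dl : D l by rewrite /l; case: (leP l1 l2).
have ppl : p l2 <= p l.
  apply: (convex_nondecreasing lmax_gt0 p_ge0 p0 p_convex Dl).
    by case/andP: Dl2; rewrite lee_fin.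
  by rewrite le_max lexx orbT.
have := l1P l Dl; rewrite le_max lexx => /(_ isT) Ll.
have el : expR (l * x - p l) <= e / 2.
  rewrite -[leRHS]lnK// ler_expR.
  have [l_ge0 lM] : 0 <= l /\ l <= M.
    by case/andP: Dl; rewrite lE lee_fin lte_fin => -> /ltW ->.
  have : l * x <= M * `|x|.
    apply: (@le_trans _ _ (l * `|x|)); first by rewrite ler_wpM2l// ler_norm.
    by rewrite ler_wpM2r.
  lra.
have := ler_norm (L - expR (l * x - p l)); rewrite distrC in Ll.
lra.
Qed.

(** As the endpoint function is 0, moving the mass at [lmax] to the parameter 0 can only increase a
    mixture. *)
Lemma mixture_class_right_open_complete :
  (forall x, edom (econjugate psi) x -> exp_evar psi lmax lmax x = 0%E) ->
  complete_class P (mixture_class psi_ge0 lmax (right_open_params lmax)).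
Proof.
move=> H0; have [mL mL0] := measurable_params; split.
  by apply: mixture_class_evariable => // l /andP[l0 ll]; rewrite /closed_params/= l0 ltW.
move=> h evh; have [_ [pi L1 ->] [mle hle]] := mixture_class_complete.2 h evh.
pose T (l : \bar R) : \bar R := if (l < lmax)%E then l else 0%E.
have mT : measurable_fun setT T.
  apply: measurable_fun_ifT; [|exact: measurable_id|exact: measurable_cst].
  by apply: measurable_fun_lte; [exact: measurable_id|exact: measurable_cst].
have [pi' [pi'E pi'I]] := pushforward_probability pi mT.
have TL l : closed_params lmax l -> right_open_params lmax (T l).
  move=> /andP[l0 ll]; rewrite /T /right_open_params/=.
  by case: ifPn => ll'; rewrite ?l0 ?ll'// lexx.
have L01 : pi' (right_open_params lmax) = 1%E.
  apply/eqP; rewrite eq_le probability_le1//= -L1 pi'E.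
  apply: le_measure; rewrite ?inE//.
  by rewrite -[X in measurable X]setTI; exact: mT.
have mx (x : X) : measurable_fun setT (fun l => exp_evar psi lmax l (cv x)).
  exact: (measurable_fun_pair1 x measurable_exp_evar).
have dom (x : X) : (\int[pi]_(l in closed_params lmax) exp_evar psi lmax l (cv x) <=
    \int[pi']_(l in right_open_params lmax) exp_evar psi lmax l (cv x))%E.
  have E0 l : (0 <= exp_evar psi lmax l (cv x))%E by exact: exp_evar_ge0.
  rewrite [leRHS]integral_carrier// pi'I//.
  rewrite -(integral_carrier mL L1 (measurableT_comp (mx x) mT))//; last first.
    by move=> l; exact: E0.
  apply: ge0_le_integral => //.
  - exact: measurable_funTS.
  - by apply: measurable_funTS; exact: (measurableT_comp (mx x) mT).
  - move=> l /andP[l0 ll] /=; rewrite /T; case: ifPn => // nll.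
    have -> : l = lmax by apply/eqP; rewrite eq_le ll leNgt.
    by rewrite (H0 _ (conj_valP x)); exact: E0.
exists (fun x : X => \int[pi']_(l in right_open_params lmax) exp_evar psi lmax l (cv x))%E.
  by exists pi'.
have mh' : measurable_fun setT
    (fun x : X => \int[pi']_(l in right_open_params lmax) exp_evar psi lmax l (cv x))%E.
  by have [] := mixture_integral (\d_(point : X)) mL0 L01.
have mh : measurable_fun setT h by case: evh.
have {}msub := measurable_nle_efun mh mh'.
split=> // mu Pmu; apply: (subset_measure0 msub mle _ (hle mu Pmu)).
by move=> x /= nle hx; apply: nle; exact: le_trans (dom x).
Qed.

(** * Minimality for cumulant generating functions *)

Section cumulant.
Variable mubar : probability R R.
Hypothesis psi_cgf : forall l, 0 <= l -> psi l = cgf mubar l.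

Let mubar_exp l : edom psi l -> (\int[mubar]_x (expR (l * x))%:E = (expR (p l))%:E)%E.
Proof.
move=> dl; have [l0 _] := dom_le dl.
have := psi_cgf l0; rewrite /cgf (psiE dl) => /(congr1 (@expeR R)).
rewrite lneK// in_itv/= leey andbT.
by apply: integral_ge0 => x _; rewrite lee_fin expR_ge0.
Qed.

Let measurable_exp l : measurable_fun setT (fun x : R => (expR (l * x))%:E).
Proof.
by apply/measurable_EFinP; apply: measurableT_comp => //; exact: measurable_funM.
Qed.

(** Chernoff's bound: the mass of the ray is at most [expR (p l - l * z)], and the exponent has no
    lower bound when [psi^* z] is infinite. *)
Let mubar_ray z : ~ edom (econjugate psi) z -> mubar `[z, +oo[%classic = 0%E.
Proof.
move=> nXz; apply/eqP; rewrite eq_le measure_ge0 andbT.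
apply/lee_addgt0Pr => e e0; rewrite add0e.
have [l dl le] : exists2 l, edom psi l & - ln e <= l * z - p l.
  apply: contrapT => nl; apply: nXz; rewrite /edom/=.
  apply: (@le_lt_trans _ _ (- ln e)%:E); last exact: ltry.
  apply: ge_ereal_sup => _ [l _ <-].
  have [dl|] := pselect (edom psi l); last first.
    by rewrite /edom/= => /negP; rewrite -leNgt leye_eq => /eqP ->; rewrite leNye.
  rewrite psiE// -EFinB lee_fin leNgt; apply/negP => /ltW H.
  by apply: nl; exists l.
have [l0 _] := dom_le dl.
have cheb : ((expR (l * z))%:E * mubar `[z, +oo[%classic <= (expR (p l))%:E)%E.
  rewrite -mubar_exp// -integral_cst//=.
  apply: (@le_trans _ _ (\int[mubar]_(x in `[z, +oo[) (expR (l * x))%:E)%E).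
    apply: ge0_le_integral => //.
    - exact: measurable_funTS.
    - move=> x; rewrite /= in_itv/= andbT => zx.
      by rewrite lee_fin ler_expR ler_wpM2l.
  exact: ge0_subset_integral.
have mfin : mubar `[z, +oo[%classic \is a fin_num by exact: fin_num_measure.
rewrite -(fineK mfin) -EFinM lee_fin in cheb *.
rewrite -(fineK mfin) lee_fin.
move: cheb; rewrite -ler_pdivlMl ?expR_gt0// -expRN -expRD => /le_trans; apply.
by rewrite -[leRHS]lnK// ler_expR; lra.
Qed.

(* [dom psi^*] is [`]-oo, b]] or [`]-oo, b[]; its complement is a countable union
   of rays avoiding it. *)
Let mubar_X : mubar (~` edom (econjugate psi)) = 0%E.
Proof.
have X0 : edom (econjugate psi) 0 by have := econjugate_dom0 psi_ge0; rewrite inE.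
have nX_gt0 z : ~ edom (econjugate psi) z -> 0 <= z.
  by move=> nXz; rewrite leNgt; apply/negP => z0; apply: nXz; exact: X_le (ltW z0) X0.
have [nX0|nX0] := pselect (~` edom (econjugate psi) !=set0); last first.
  rewrite (_ : ~` _ = set0) ?measure0//.
  by apply: contrapT => /eqP/set0P.
have hi : has_inf (~` edom (econjugate psi)) by split=> //; exists 0 => z /nX_gt0.
pose i := inf (~` edom (econjugate psi)).
have ile z : ~ edom (econjugate psi) z -> i <= z.
  by move=> nXz; apply: ge_inf => //; exact: hi.2.
have [Xi|nXi] := pselect (edom (econjugate psi) i); last first.
  rewrite (_ : ~` _ = `[i, +oo[%classic); first exact: mubar_ray.
  apply/seteqP; split=> z /=; first by move=> /ile; rewrite in_itv/= andbT.
  by rewrite in_itv/= andbT => iz Xz; apply: nXi; exact: X_le iz Xz.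
have neg : mubar.-negligible (\bigcup_n `[i + n.+1%:R^-1, +oo[%classic).
  apply: negligible_bigcup => n; apply/negligibleP; first exact: measurable_itv.
  apply: mubar_ray => Xn; have n0 : 0 < n.+1%:R^-1 :> R by rewrite invr_gt0.
  have [w nXw] := inf_adherent n0 hi; rewrite -/i => win.
  by apply: nXw; exact: X_le (ltW win) Xn.
apply/(negligibleP _ (measurableC measurable_X)); apply: negligibleS neg.
move=> z /= nXz; have iz : i < z.
  by rewrite lt_neqAle ile// andbT; apply/eqP => iz; apply: nXz; rewrite -iz.
have zi0 : 0 < z - i by rewrite subr_gt0.
have /cvgrPdist_lt/(_ _ zi0)[N _ NP] := @cvg_harmonic R.
exists N => //=; rewrite in_itv/= andbT -lerBrDl ltW//.
by have := NP N (leqnn _); rewrite /= sub0r normrN ger0_norm ?invr_ge0.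
Qed.

(** [mubar] is pushed forward by a retraction [r] onto [dom psi^*], which sends the null complement
    to the origin. The sub-psi inequalities hold with equality. *)
Lemma cumulant_measure : exists nu : probability X R,
  [/\ forall B, measurable B -> nu (cv @^-1` B) = mubar B, P nu &
      forall l, edom psi l -> (\int[nu]_x (expR (l * cv x))%:E = (expR (p l))%:E)%E].
Proof.
pose r (x : R) : X := if pselect (edom (econjugate psi) x) is left Xx
  then exist _ x (mem_set Xx) else conj_origin psi_ge0.
have rE x : edom (econjugate psi) x -> cv (r x) = x.
  by move=> Xx; rewrite /r; case: pselect.
have cvr x : cv (r x) = if x \in edom (econjugate psi) then x else 0.
  by rewrite /r; case: pselect => Xx; [rewrite mem_set|rewrite memNset].
have mr : measurable_fun setT r.
  move=> _ A [B mB <-]; rewrite setTI setTI -comp_preimage.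
  have -> : cv \o r = fun x => if x \in edom (econjugate psi) then x else 0.
    by apply/funext => x; exact: cvr.
  have : measurable_fun setT (fun x : R => if x \in edom (econjugate psi) then x else 0).
    rewrite (_ : (fun x => _) = fun x => x * \1_(edom (econjugate psi)) x).
      by apply: measurable_funM => //; exact: measurable_indic.
    apply/funext => x; rewrite indicE; case: (x \in _) => /=; first by rewrite mulr1.
    by rewrite mulr0.
  by move=> /(_ measurableT B mB); rewrite setTI.
have [nu [nuE nuI]] := pushforward_probability mubar mr.
have nuexp l : edom psi l ->
    (\int[nu]_x (expR (l * cv x))%:E = (expR (p l))%:E)%E.
  move=> dl; rewrite nuI; last 2 first.
  - apply/measurable_EFinP; apply: measurableT_comp => //.
    by apply: measurable_funM => //; exact: measurable_conj_val.
  - by move=> x; rewrite lee_fin expR_ge0.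
  rewrite -mubar_exp//; apply: ae_eq_integral => //.
    apply/measurable_EFinP; apply: measurableT_comp => //.
    apply: measurable_funM => //; apply: measurableT_comp => //.
    exact: measurable_conj_val.
  exists (~` edom (econjugate psi)); split=> //; first exact: measurableC.
  by move=> x /= nx Xx; apply: nx => _; rewrite rE.
exists nu; split=> //.
- move=> B mB; rewrite nuE.
  have -> : r @^-1` (cv @^-1` B) =
      (B `&` edom (econjugate psi)) `|` ((~` edom (econjugate psi)) `&` [set x | B 0]).
    apply/seteqP; split => x /=; rewrite cvr.
      by have [Xx|nXx] := pselect (edom (econjugate psi) x);
        [rewrite mem_set// => ?; left|rewrite memNset// => ?; right].
    by move=> [[Bx Xx]|[nXx B0]]; [rewrite mem_set|rewrite memNset].
  have mB0 : measurable [set x : R | B 0].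
    have [B0|B0] := pselect (B 0).
      by rewrite (_ : [set x | _] = setT)//; apply/seteqP; split.
    by rewrite (_ : [set x | _] = set0)//; apply/seteqP; split.
  have null0 : mubar ((~` edom (econjugate psi)) `&` [set x | B 0]) = 0%E.
    apply: (subset_measure0 _ _ _ mubar_X).
    - by apply: measurableI => //; exact: measurableC.
    - exact: measurableC.
    - exact: subIsetl.
  rewrite measureU0//; last 2 first.
  - exact: measurableI.
  - by apply: measurableI => //; exact: measurableC.
  have mBX : measurable (B `&` edom (econjugate psi)) by exact: measurableI.
  rewrite -[in RHS](setIT B) -(setUv (edom (econjugate psi))) setIUr measureU0//.
  - by apply: measurableI => //; exact: measurableC.
  - apply: (subset_measure0 _ _ _ mubar_X).
    + by apply: measurableI => //; exact: measurableC.
    + exact: measurableC.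
    + exact: subIsetr.
- by move=> l dl; rewrite nuexp// psiE.
Qed.

Let integral_exp_evar1 (nu : probability X R) r :
  (forall l, edom psi l -> (\int[nu]_x (expR (l * cv x))%:E = (expR (p l))%:E)%E) ->
  D r -> (\int[nu]_x exp_evar psi lmax r%:E (cv x) = 1)%E.
Proof.
move=> nuexp Dr.
have mE : measurable_fun setT (fun x : X => (expR (r * cv x))%:E).
  apply/measurable_EFinP; apply: measurableT_comp => //.
  by apply: measurable_funM => //; exact: measurable_conj_val.
have E0 (x : X) : setT x -> (0 <= (expR (r * cv x))%:E)%E.
  by rewrite lee_fin expR_ge0.
have k0 : (0 <= (expR (p r))^-1%:E)%E by rewrite lee_fin invr_ge0 expR_ge0.
have -> : (\int[nu]_x exp_evar psi lmax r%:E (cv x) =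
    \int[nu]_x ((expR (p r))^-1%:E * (expR (r * cv x))%:E))%E.
  by apply: eq_integral => x _; rewrite exp_evarE// expRB mulrC EFinM.
rewrite ge0_integralZl//.
rewrite nuexp; last exact: D_dom.
by rewrite -EFinM mulVf// gt_eqF ?expR_gt0.
Qed.

(** A common core for the endpoint cases. [L] is either parameter set, and [kmax] is the factor of
    the endpoint function written as an exponential strictly inside [dom psi^*], with [kmax = 0]
    where it vanishes. A largest point of [dom psi^*], which Laplace transforms do not reach, is
    handled as an atom. *)
Lemma mixture_class_minimal (nu : probability X R) L kmax :
  (forall B, measurable B -> nu (cv @^-1` B) = mubar B) -> P nu ->
  complete_class P (mixture_class psi_ge0 lmax L) ->
  measurable L -> L `<=` closed_params lmax ->
  (forall l, L l -> \int[nu]_x exp_evar psi lmax l (cv x) = 1)%E ->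
  0 <= kmax ->
  (L lmax -> forall x b, edom (econjugate psi) b -> x < b ->
     exp_evar psi lmax lmax x = (kmax * expR (fine lmax * x))%:E) ->
  (forall x, edom (econjugate psi) x ->
     (forall b, edom (econjugate psi) b -> b <= x) ->
     (0 < nu [set z | cv z = x])%E) ->
  (exists x, limit_point (msupport mubar) x /\ (edom (econjugate psi))° x) ->
  minimal_complete_class P (mixture_class psi_ge0 lmax L).
Proof.
move=> nuE Pnu cL mL LL nu1 kmax0 kP atom [x0 [lx0 ix0]].
apply: minimal_complete_classP => // _ _ [pi1 L1 ->] [pi2 L2 ->] [_ le12].
pose H (pi : probability (\bar R) R) x := (\int[pi]_(l in L) exp_evar psi lmax l x)%E.
have intH (pi : probability (\bar R) R) : pi L = 1%E ->
    [/\ measurable_fun setT (fun z : X => H pi (cv z)),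
        forall z : X, (0 <= H pi (cv z))%E &
        (\int[nu]_z H pi (cv z) = 1)%E].
  move=> piL; have [mh h0 ih] := mixture_integral nu mL piL; split=> //.
  rewrite ih (eq_integral (cst 1%E)); last first.
    by move=> l; rewrite inE => Ll; rewrite nu1.
  by rewrite integral_cst// mul1e; exact: piL.
have [mh1 h10 ih1] := intH _ L1; have [mh2 h20 ih2] := intH _ L2.
have null : nu [set z | H pi1 (cv z) <> H pi2 (cv z)] = 0%E.
  apply: le_integral_eq_null => //; first exact: le12.
  - by rewrite ih1 ih2.
  - by rewrite ih1 ltry.
have mneq := measurable_neq_efun mh1 mh2.
suff HE z : H pi1 (cv z) = H pi2 (cv z).
  rewrite /version /qs /negligible_for (_ : [set x | _] = set0).
    by split=> // mu _; exact: measure0.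
  by apply/seteqP; split=> z //= /(_ (HE z)).
have null_sub (B : set R) : measurable B ->
    (forall x, B x -> edom (econjugate psi) x -> H pi1 x <> H pi2 x) ->
    nu (cv @^-1` B) = 0%E.
  move=> mB BH; have mcB : measurable (cv @^-1` B).
    by rewrite -[X in measurable X]setTI; exact: measurable_conj_val.
  apply: (subset_measure0 mcB mneq _ null) => y /= By.
  exact: BH (conj_valP y).
(* Factor and rate of the exponential as functions on the whole extended line; the maximum with 0
   gives [lam] the sign needed for Laplace transforms and is invisible on [L]. *)
pose k l := if (l < lmax)%E then expR (- p (fine l)) else kmax.
pose lam (l : \bar R) := Num.max 0 (fine l).
have mfine : measurable_fun setT (fine : \bar R -> R) by exact: fine_measurable.
have mk : measurable_fun setT k.
  apply: measurable_fun_ifT; [| |exact: measurable_cst].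
    by apply: measurable_fun_lte; [exact: measurable_id|exact: measurable_cst].
  apply: measurableT_comp => //; apply: measurableT_comp => //.
  exact: (measurableT_comp mfine (measurableT_comp measurable_psi mfine)).
have mlam : measurable_fun setT lam.
  by apply: measurable_maxr => //; exact: measurable_cst.
have k0 l : 0 <= k l by rewrite /k; case: ifP => // _; exact: expR_ge0.
have lam0 l : 0 <= lam l by rewrite /lam le_max lexx.
have lapE (pi : probability (\bar R) R) x b : pi L = 1%E ->
    edom (econjugate psi) b -> x < b -> H pi x = laplace k lam pi x.
  move=> piL Xb xb; rewrite /H /laplace.
  rewrite -(@integral_carrier _ _ R pi L)//; last 2 first.
  - apply/measurable_EFinP; apply: measurable_funM => //.
    by apply: measurableT_comp => //; exact: measurable_funM.
  - by move=> l; rewrite lee_fin mulr_ge0// expR_ge0.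
  apply: eq_integral => l; rewrite inE => Ll; have /andP[l0 ll] := LL _ Ll.
  have lamE : lam l = fine l by rewrite /lam; apply/max_idPr; rewrite fine_ge0.
  rewrite lamE /k; case: ifPn => [ll'|nll].
    have lfin : l \is a fin_num by rewrite ge0_fin_numE// (lt_le_trans ll')// leey.
    have Dl : D (fine l) by rewrite /D /right_open_params/= fineK// l0 ll'.
    by rewrite -{1}(fineK lfin) exp_evarE// -expRD addrC.
  have lE : l = lmax by apply/eqP; rewrite eq_le ll leNgt.
  by rewrite lE in Ll *; exact: kP Xb xb.
have Hfin (pi : probability (\bar R) R) x : pi L = 1%E ->
    edom (econjugate psi) x -> (H pi x < +oo)%E.
  move=> piL Xx.
  apply: (@le_lt_trans _ _ (expR (fine (econjugate psi x)))%:E); last exact: ltry.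
  have [u uE] := conj_val_surj Xx.
  rewrite -[leRHS]mule1 -piL -(integral_cst pi mL)//.
  apply: ge0_le_integral => //.
  - by move=> l _; rewrite -uE; exact: exp_evar_ge0.
  - apply: measurable_funTS; rewrite -uE.
    exact: (measurable_fun_pair1 u measurable_exp_evar).
  - by move=> l /LL Ll; exact: exp_evar_le.
have [r r0 rX] : exists2 r, 0 < r & forall y, `|y - x0| < r -> edom (econjugate psi) y.
  move: ix0 => /nbhs_ballP[r /= r0 rX]; exists r => // y yr.
  by apply: rX; rewrite /ball/= distrC.
pose b := x0 + r / 2.
have Xb : edom (econjugate psi) b.
  by apply: rX; rewrite /b addrAC subrr add0r ger0_norm; lra.
have x0b : x0 < b by rewrite /b ltrDl divr_gt0.
have lfin a : edom (econjugate psi) a -> b <= a ->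
  forall (pi : probability (\bar R) R), pi L = 1%E -> forall y, y < a ->
    (laplace k lam pi y < +oo)%E.
  move=> Xc bc pi piL y yc; rewrite -(lapE pi y a piL Xc yc).
  by apply: Hfin => //; exact: X_le (ltW yc) Xc.
have agree e : 0 < e -> exists y,
    [/\ y != x0, `|y - x0| < e & laplace k lam pi1 y = laplace k lam pi2 y].
  (* [y] is within [r / 4] of [x0], and the ball chosen around it within [3 r / 8], so everything
     stays to the left of [b = x0 + r / 2], where both transforms are finite. *)
  move=> e0; pose s := Num.min e (r / 4).
  have s0 : 0 < s by rewrite lt_min e0 divr_gt0.
  have [|y [yx0 sy]] := lx0 (ball x0 s); first exact: nbhsx_ballx.
  rewrite /ball/= distrC lt_min => /andP[ye yr].
  exists y; split=> //; apply: contrapT => nE.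
  have yb1 : y < x0 + r * (3 / 8) by have := ler_norm (y - x0); lra.
  have b1b : x0 + r * (3 / 8) < b by rewrite /b; lra.
  have fin (pi : probability (\bar R) R) : pi L = 1%E ->
      (laplace k lam pi (x0 + r * (3 / 8)) < +oo)%E.
    by move=> piL; exact: lfin Xb (lexx b) pi piL _ b1b.
  have fin_y (pi : probability (\bar R) R) : pi L = 1%E ->
      laplace k lam pi y \is a fin_num.
    move=> piL; rewrite ge0_fin_numE ?laplace_ge0//.
    by apply: lfin Xb (lexx b) pi piL _ _; exact: lt_trans b1b.
  pose F (pi : probability (\bar R) R) w := fine (laplace k lam pi w).
  have dF : 0 < `|F pi1 y - F pi2 y|.
    rewrite normr_gt0 subr_eq0; apply/eqP => FE; apply: nE.
    by rewrite -(fineK (fin_y _ L1)) -(fineK (fin_y _ L2)) -/(F pi1 y) FE.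
  set dl := `|F pi1 y - F pi2 y| in dF.
  (* If the transforms agreed at some [w] this close to [y], their gap [dl] at [y] would be at most
     [dl / 4 + dl / 4]. *)
  have dl4 : 0 < dl / 4 by rewrite divr_gt0.
  have [t1 t10 t1P] := laplace_continuous mk mlam k0 lam0 yb1 (fin _ L1) dl4.
  have [t2 t20 t2P] := laplace_continuous mk mlam k0 lam0 yb1 (fin _ L2) dl4.
  pose t := Num.min (r / 8) (Num.min t1 t2).
  have t0 : 0 < t by rewrite !lt_min t10 t20 divr_gt0.
  (* The ball is charged by [mubar] because [y] is in the support, yet it would lie in the null set
     where the mixtures differ. *)
  have := sy (ball y t) (@ball_open _ _ y t) (ballxx y t0).
  rewrite -nuE; last by apply: open_measurable; exact: ball_open.
  rewrite null_sub ?ltxx//; first by apply: open_measurable; exact: ball_open.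
  move=> w; rewrite /ball/= distrC !lt_min => /and3P[wr wt1 wt2] _.
  have wb : w < b by rewrite /b; have := ler_norm (w - y); have := ler_norm (y - x0); lra.
  rewrite !(lapE _ w b)// => HE.
  have := t1P w wt1; have := t2P w wt2.
  rewrite -/(F pi1 w) -/(F pi2 w) -/(F pi1 y) -/(F pi2 y) {1}/F -HE -/(F pi1 w) => h2 h1.
  have : dl <= `|F pi1 w - F pi2 y| + `|F pi1 w - F pi1 y|.
    rewrite (distrC (F pi1 w) (F pi1 y)) addrC.
    rewrite (_ : dl = `|(F pi1 y - F pi1 w) + (F pi1 w - F pi2 y)|) ?ler_normD//.
    by rewrite addrA subrK.
  lra.
have agree_left a : edom (econjugate psi) a -> b <= a -> forall y, y < a -> H pi1 y = H pi2 y.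
  move=> Xc bc y yc; rewrite !(lapE _ y a)//.
  (* Finiteness of the transforms is known strictly below [a] only, hence an intermediate right
     end. *)
  pose b1 := (Num.max x0 y + a) / 2.
  have x0c : x0 < a by exact: lt_le_trans bc.
  have mc : Num.max x0 y < a by rewrite gt_max x0c yc.
  have xm : x0 <= Num.max x0 y by rewrite le_max lexx.
  have ym : y <= Num.max x0 y by rewrite le_max lexx orbT.
  have b1c : b1 < a by rewrite /b1; lra.
  apply: (@laplace_identity _ _ R k lam mk mlam k0 lam0 pi1 pi2 x0 b1) => //.
  - by rewrite /b1; lra.
  - by apply: lfin Xc bc _ L1 _ b1c.
  - by apply: lfin Xc bc _ L2 _ b1c.
  - by rewrite /b1; lra.
have [[a Xc zc]|nc] := pselect (exists2 a, edom (econjugate psi) a & cv z < a).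
  apply: (agree_left (Num.max b a)); last by rewrite lt_max zc orbT.
    by case: (leP b a).
  by rewrite le_max lexx.
(* Here [cv z] is the largest point of [dom psi^*]; being an atom, it cannot belong to the null set
   of disagreement. *)
apply: contrapT => nz.
have := atom (cv z) (conj_valP z) _; rewrite (_ : [set y | _] = cv @^-1` [set cv z]) //.
rewrite null_sub ?ltxx//; last by move=> x -> _.
by move=> /(_ _)/negP; apply => // a Xc; rewrite leNgt; apply/negP => zc; apply: nc; exists a.
Qed.

(** With bounded parameters [psi^*] is finite everywhere, so a right end of [dom psi^*] forces
    [lmax] to be infinite. *)
Let econj_nonneg_lmax x M : lmax = M%:E -> edom (econjugate psi) x.
Proof.
move=> lE; apply: (@le_lt_trans _ _ (M * `|x|)%:E); last exact: ltry.
apply: ge_ereal_sup => _ [l _ <-].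
have [dl|] := pselect (edom psi l); last first.
  by rewrite /edom/= => /negP; rewrite -leNgt leye_eq => /eqP ->; rewrite leNye.
have [l0] := dom_le dl; rewrite lE lee_fin => lM.
rewrite psiE// -EFinB lee_fin; apply: (@le_trans _ _ (l * `|x|)).
  rewrite lerBlDr; have := p_ge0 l; have : l * x <= l * `|x| by rewrite ler_wpM2l// ler_norm.
  by lra.
by rewrite ler_wpM2r.
Qed.

Lemma mixture_class_closed_minimal b :
  edom (econjugate psi) = [set x | x <= b] ->
  (exists x, limit_point (msupport mubar) x /\ (edom (econjugate psi))° x) ->
  minimal_complete_class P (mixture_class psi_ge0 lmax (closed_params lmax)).
Proof.
move=> XE cluster; have [nu [nuE Pnu nuI]] := cumulant_measure.
have Xb : edom (econjugate psi) b by rewrite XE /=.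
have lE : lmax = +oo%E.
  case E : lmax lmax_gt0 => [M| |]// _.
  have := econj_nonneg_lmax (b + 1) E; rewrite XE/=.
  by rewrite gerDl ler10.
(* All points of [dom psi^*] are at most [b] and the parameters are nonnegative, so the value at [b]
   dominates the whole sequence. *)
have nul : (\int[nu]_x exp_evar psi lmax lmax (cv x) = 1)%E.
  set C := expR (fine (econjugate psi b)).
  have [|||||_ _] := @dominated_convergence _ _ _ nu setT measurableT
    (fun n (x : X) => exp_evar psi lmax (limit_seq n)%:E (cv x))
    (fun x : X => exp_evar psi lmax lmax (cv x)) (cst C%:E).
  - by move=> n; exact: measurable_real_exp.
  - exact: (measurable_fun_pair2 lmax measurable_exp_evar).
  - by apply: aeW => x _; exact: limit_seq_cvg (conj_valP x).
  - by apply: finite_measure_integrable_cst.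
  - apply: aeW => x n _; have Dn := (limit_seqP n).1.
    rewrite gee0_abs ?exp_evar_ge0// exp_evarE// lee_fin ler_expR.
    apply: le_trans (conjugate_bound Xb (D_dom Dn)); rewrite lerD2r.
    apply: ler_wpM2l; first exact: (dom_le (D_dom Dn)).1.
    by have := conj_valP x; rewrite XE.
  - under eq_fun do rewrite (integral_exp_evar1 nuI (limit_seqP _).1).
    by move=> c1; apply/esym; apply: cvg_unique (@cvg_cst _ 1%E _ _ _) c1.
have [mL _] := measurable_params.
apply: (mixture_class_minimal (nu := nu) (kmax := 0)) => //.
- exact: mixture_class_complete.
- move=> l /andP[l0]; rewrite le_eqVlt => /predU1P[->//|ll].
  have lfin : l \is a fin_num by rewrite ge0_fin_numE// (lt_le_trans ll)// leey.
  rewrite -(fineK lfin); apply: integral_exp_evar1 => //.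
  by rewrite /D /right_open_params/= fineK// l0 ll.
- by move=> _ x a Xc xc; rewrite mul0r; exact: exp_evar_infty Xc xc.
move=> x Xx xmax; have xb : x = b.
  by apply/eqP; rewrite eq_le xmax// andbT; move: Xx; rewrite XE.
rewrite xb lt_neqAle measure_ge0 andbT eq_sym; apply/eqP => nu0.
(* The endpoint function vanishes to the left of [b], so its integral 1 has to come from an atom at
   [b]. *)
have : (\int[nu]_x exp_evar psi lmax lmax (cv x) = 0)%E.
  have mb : measurable [set z : X | cv z = b].
    suff : measurable (cv @^-1` [set b]) by [].
    by rewrite -[X in measurable X]setTI; exact: measurable_conj_val.
  have ml : measurable_fun setT (fun z : X => exp_evar psi lmax lmax (cv z)).
    exact: (measurable_fun_pair2 lmax measurable_exp_evar).
  have l0 (z : X) : setT z -> (0 <= exp_evar psi lmax lmax (cv z))%E.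
    by move=> _; exact: exp_evar_ge0.
  rewrite (ge0_negligible_integral mb measurableT ml l0 nu0).
  apply: integral0_eq => z [_ zb]; apply: (exp_evar_infty lE Xb).
  rewrite lt_neqAle; have := conj_valP z; rewrite {1}XE/= => ->.
  by rewrite andbT; apply/eqP.
by rewrite nul => /eqP; rewrite eqe oner_eq0.
Qed.

Lemma mixture_class_open_minimal b : closed_efun psi ->
  edom (econjugate psi) = [set x | (x%:E < b)%E] ->
  (exists x, limit_point (msupport mubar) x /\ (edom (econjugate psi))° x) ->
  (edom psi = EFin @^-1` right_open_params lmax ->
     minimal_complete_class P (mixture_class psi_ge0 lmax (right_open_params lmax))) /\
  (edom psi = EFin @^-1` closed_params lmax -> (lmax < +oo)%E ->
     minimal_complete_class P (mixture_class psi_ge0 lmax (closed_params lmax))).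
Proof.
move=> cpsi XE cluster; have [nu [nuE Pnu nuI]] := cumulant_measure.
have [mL mL0] := measurable_params.
have Xgt x : edom (econjugate psi) x -> exists2 a, edom (econjugate psi) a & x < a.
  rewrite XE/=; case: b XE => [b| |]// XE.
    by rewrite lte_fin => xb; exists ((x + b) / 2); rewrite ?XE/= ?lte_fin; lra.
  by exists (x + 1); rewrite ?XE/= ?ltry ?ltrDl.
have noatom x : edom (econjugate psi) x ->
    (forall a, edom (econjugate psi) a -> a <= x) -> (0 < nu [set z | cv z = x])%E.
  by move=> /Xgt[a Xc xc] /(_ a Xc); rewrite leNgt xc.
have nuD l : right_open_params lmax l ->
    (\int[nu]_x exp_evar psi lmax l (cv x) = 1)%E.
  move=> /andP[l0 ll].
  have lfin : l \is a fin_num by rewrite ge0_fin_numE// (lt_le_trans ll)// leey.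
  rewrite -(fineK lfin); apply: integral_exp_evar1 => //.
  by rewrite /D /right_open_params/= fineK// l0 ll.
have lmaxE : lmax = +oo%E \/ exists M, lmax = M%:E.
  by case: (lmax) lmax_gt0 => [M| |]// _; [right; exists M|left].
split=> [dE|dE loo].
  apply: (mixture_class_minimal (nu := nu) (kmax := 0)) => //.
  - apply: mixture_class_right_open_complete => x Xx.
    have [lE|[M lE]] := lmaxE.
      by have [a Xc xc] := Xgt x Xx; exact: exp_evar_infty Xc xc.
    apply: (exp_evar_closed_zero cpsi lE) => //.
    by rewrite dE /right_open_params/= lE ltxx andbF.
  - by move=> l /andP[l0 ll]; rewrite /closed_params/= l0 ltW.
  - by rewrite /right_open_params/= ltxx andbF.
have [lE|[M lE]] := lmaxE; first by rewrite lE in loo.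
have X0 : edom (econjugate psi) 0 by have := econjugate_dom0 psi_ge0; rewrite inE.
have dM : edom psi M by rewrite dE /closed_params/= -lE lexx ltW.
have [L0 [/andP[L0_ge0 _] L0E L0P]] := exp_evar_limit X0.
(* [p] is at most [p M] below [M]. This gives the endpoint function an integral of at least
   [expR (- p M) * expR (p M) = 1]. *)
have L0M : expR (- p M) <= L0.
  apply/ler_addgt0Pr => e e0; have [l1 Dl1 l1P] := L0P e e0.
  have := l1P l1 Dl1 (lexx _); rewrite mulr0 sub0r.
  have pM : p l1 <= p M.
    have M0 : 0 < M by rewrite -lte_fin -lE.
    have /andP[l10 l1M] := Dl1; rewrite lE lee_fin lte_fin in l10 l1M.
    have t01 : 0 <= l1 / M <= 1.
      by rewrite divr_ge0 ?(ltW M0)//= ler_pdivrMr// mul1r ltW.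
    have d0 : edom psi 0 by rewrite /edom/= psi0 ltry.
    have [_] := dom_convex t01 dM d0.
    rewrite mulr0 addr0 divfK ?gt_eqF// p0 mulr0 addr0 => /le_trans; apply.
    have /andP[_ t1] := t01; have pM0 : 0 <= p M := p_ge0 M; exact: (ler_piMl pM0 t1).
  have : expR (- p M) <= expR (- p l1) by rewrite ler_expR lerN2.
  have := ler_norm (expR (- p l1) - L0); lra.
apply: (mixture_class_minimal (nu := nu) (kmax := L0)) => //.
- exact: mixture_class_complete.
- move=> l /andP[l0]; rewrite le_eqVlt => /predU1P[->|ll]; last first.
    by apply: nuD; rewrite /right_open_params/= l0 ll.
  apply/eqP; rewrite eq_le integral_exp_evar_le1//=; last first.
    by rewrite /closed_params/= lexx ltW.
  under eq_integral => x _ do rewrite (exp_evar_lmax_fin lE (conj_valP x)) L0E/= EFinM.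
  have mE : measurable_fun setT (fun x : X => (expR (M * cv x))%:E).
    apply/measurable_EFinP; apply: measurableT_comp => //.
    by apply: measurable_funM => //; exact: measurable_conj_val.
  have E0 (x : X) : setT x -> (0 <= (expR (M * cv x))%:E)%E.
    by rewrite lee_fin expR_ge0.
  rewrite ge0_integralZl//.
  rewrite nuI// -EFinM lee_fin.
  by rewrite -(expRxMexpNx_1 (p M)) mulrC ler_wpM2r// expR_ge0.
- by move=> _ x a Xc xc; rewrite (exp_evar_lmax_fin lE (X_le (ltW xc) Xc)) L0E lE.
Qed.

End cumulant.

End exponential_evariables.

(** * Group-invariant hypotheses *)

(** [u] may have infinite integral, so the sum is regrouped as the nonnegative functions [u^+] and
    [1 - u^-], the second one integrable. *)
Lemma integral_add1 d (T : measurableType d) (R : realType)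
    (P : probability T R) (u : T -> \bar R) :
  measurable_fun setT u -> (forall x, -1 <= u x)%E ->
  (\int[P]_x (1 + u x) = 1 + \int[P]_x u x)%E.
Proof.
move=> mu u1.
have mp : measurable_fun setT (u^\+)%E by exact: measurable_funepos.
have mn : measurable_fun setT (u^\-)%E by exact: measurable_funeneg.
have n1 x : (u^\- x <= 1)%E.
  by rewrite funenegE ge_max lee01 andbT leeNl.
have i1 : (\int[P]_x cst 1 x = 1)%E.
  exact: integral_probability1.
have In : P.-integrable setT (u^\-)%E.
  apply/integrableP; split=> //.
  under eq_integral do rewrite gee0_abs//.
  apply: (@le_lt_trans _ _ (\int[P]_x cst 1 x)%E); last by rewrite i1 ltry.
  by apply: ge0_le_integral => //; exact: measurable_cst.
pose v x := (1 - u^\- x)%E.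
have -> : (\int[P]_x (1 + u x) = \int[P]_x (u^\+ x + v x))%E.
  by apply: eq_integral => x _; rewrite /v addeCA [in LHS](funeposneg u).
rewrite ge0_integralD//; last 2 first.
- move=> x _; rewrite /v; have := n1 x; have := funeneg_ge0 u x.
  by case: (u^\- x)%E => // r _ r1; rewrite sube_ge0.
- exact: emeasurable_funB.
rewrite {}/v (integralB measurableT (f1 := cst 1%E))//; last first.
  exact: finite_measure_integrable_cst.
rewrite i1 [in RHS]integralE addeCA; congr (_ + _)%E.
Qed.

Section invariant.
Context (R : realType) (G : topologicalGroupType) d (X : measurableType d).
Variables (act : G -> X -> X) (pi : probability (borel_type G) R).
Hypotheses (lact : left_action act) (mact : measurable_action act).
Hypothesis haar : left_haar pi.
Local Open Scope ereal_scope.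

Let mactx x : measurable_fun setT (fun s : borel_type G => act s x).
Proof. exact: (measurable_fun_pair1 x mact). Qed.

Let macts s : measurable_fun setT (act s).
Proof. exact: (measurable_fun_pair2 (s : borel_type G) mact). Qed.

Let orbit_measure x : exists2 mu : probability X R,
  invariant_hypothesis R act mu &
  forall g : X -> \bar R, measurable_fun setT g -> (forall y, 0 <= g y) ->
    \int[mu]_y g y = \int[pi]_s g (act s x).
Proof.
have [mu [muE mug]] := pushforward_probability pi (mactx x).
exists mu => // s A mA; rewrite /pushforward !muE.
have mB : measurable ((fun t : borel_type G => act t x) @^-1` A).
  by rewrite -[X in measurable X]setTI; exact: mactx.
(* The parameters [t] with [act s (act t x)] in [A] form the translate by [s^-1] of those with
   [act t x] in [A]. *)
rewrite -[RHS](haar.1 (s^-1)%g _ mB); congr (pi _).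
apply/seteqP; split => [t /= Ast|_ [t At <-]] /=.
  exists (s * t)%g; last by rewrite mulKg.
  by rewrite /= lact.2.
by rewrite -lact.2 mulVKg.
Qed.

(** By Tonelli the average over the group comes last, and invariance makes the inner integral
    independent of [s]. *)
Let integral_orbit (F : X -> \bar R) (mu : probability X R) :
  measurable_fun setT F -> (forall x, 0 <= F x) ->
  invariant_hypothesis R act mu ->
  \int[mu]_x \int[pi]_s F (act s x) = \int[mu]_x F x.
Proof.
move=> mF F0 Pmu.
rewrite -(fubini_tonelli (m1 := pi) (m2 := mu) (fun p => F (act p.1 p.2)))//.
  have -> : \int[pi]_s \int[mu]_x F (act s x) =
            \int[pi]_s cst (\int[mu]_x F x) s.
    apply: eq_integral => s _ /=.
    have [nu [nuE nug]] := pushforward_probability mu (macts s).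
    rewrite -nug//; apply: eq_measure_integral => A mA _; rewrite -[RHS](Pmu s A mA).
    exact: nuE.
  rewrite integral_cst// -[RHS]mule1; congr (_ * _); exact: probability_setT.
exact: measurableT_comp mact.
Qed.

Lemma invariant_class_minimal :
  minimal_complete_class (invariant_hypothesis R act) (invariant_class act pi).
Proof.
have mcomp (f : X -> \bar R) x : measurable_fun setT f ->
    measurable_fun setT (fun s : borel_type G => f (act s x)).
  by move=> mf; exact: measurableT_comp (mactx x).
have mavg (F : X -> \bar R) : measurable_fun setT F -> (forall x, 0 <= F x) ->
    measurable_fun setT (fun x => \int[pi]_s F (act s x)).
  move=> mF F0.
  apply: (measurable_fun_fubini_tonelli_G (m1 := pi)
    (fun p => F (act p.1 p.2))) => //; exact: measurableT_comp mact.
have integral1 f : measurable_fun setT f -> (forall x, -1 <= f x) ->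
    (forall x, orbit_average act pi f x <= 0) ->
    forall mu, invariant_hypothesis R act mu ->
    \int[mu]_x (1 + f x - orbit_average act pi f x) = 1.
  move=> mf f1 fpi mu Pmu.
  (* [f] need not be known integrable. The average [k] of [F] lies in [0, 1] and has the same
     integral as [F], so that [F] and [1 - k] are nonnegative with integrals adding up to 1. *)
  pose F x := 1 + f x; pose k x := \int[pi]_s F (act s x).
  have mF : measurable_fun setT F by exact: emeasurable_funD.
  have F0 x : 0 <= F x.
    by rewrite /F -(@subee _ 1)// leeD2l.
  have kE x : k x = 1 + orbit_average act pi f x.
    by rewrite /k integral_add1//; exact: mcomp.
  have k0 x : 0 <= k x by apply: integral_ge0 => s _; exact: F0.
  have k1 x : k x <= 1 by rewrite kE -[leRHS]adde0 leeD2l.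
  have mk : measurable_fun setT k by exact: mavg.
  have i1 : \int[mu]_x cst 1 x = 1.
    exact: integral_probability1.
  have ik1 : \int[mu]_x k x <= 1.
    by rewrite -i1; apply: ge0_le_integral => //; exact: measurable_cst.
  have Ik : mu.-integrable setT k.
    apply/integrableP; split=> //.
    under eq_integral do rewrite gee0_abs//.
    by apply: le_lt_trans ik1 _; rewrite ltry.
  pose v x := 1 - k x.
  have -> : \int[mu]_x (1 + f x - orbit_average act pi f x) =
            \int[mu]_x (F x + v x).
    apply: eq_integral => x _; rewrite /F /v; congr (_ + _).
    rewrite kE; move: (k0 x) (k1 x); rewrite kE.
    case: (orbit_average act pi f x) => //= r _ _.
    by rewrite -EFinD; congr EFin; ring.
  rewrite ge0_integralD//; last 2 first.
  - move=> x _; rewrite /v; have := k1 x; have := k0 x.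
    by case: (k x) => // r _ r1; rewrite sube_ge0.
  - exact: emeasurable_funB.
  rewrite {}/v (integralB measurableT (f1 := cst 1))//; last first.
    exact: finite_measure_integrable_cst.
  rewrite i1 integral_orbit// -/k; move: ik1; rewrite integral_orbit//.
  have : 0 <= \int[mu]_x F x by exact: integral_ge0.
  by case: (\int[mu]_x F x) => //= r _ _; rewrite -EFinB -EFinD addrCA subrr addr0.
apply: minimal_complete_classP; last first.
  move=> h h' Eh Eh'; apply: version_of_integral1; first exact: Eh.1.
  - exact: Eh'.1.
  - by move: Eh => [_ [f [mf f1 fpi ->]]]; exact: integral1.
split=> [h []//|h [mh h0 ih]].
pose f x := h x - 1; pose k x := \int[pi]_s h (act s x).
have mf : measurable_fun setT f by exact: emeasurable_funB.
have f1 x : -1 <= f x by rewrite /f -[leLHS]add0e leeD2r.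
have k0 x : 0 <= k x by exact: integral_ge0.
have k1 x : k x <= 1.
  by have [mu Pmu muE] := orbit_measure x; rewrite /k -muE//; exact: ih.
have hE x : h x = 1 + f x by rewrite /f addeCA subee// adde0.
have kE x : k x = 1 + orbit_average act pi f x.
  rewrite -integral_add1//; last exact: mcomp.
  by apply: eq_integral => s _; exact: hE.
have fpi x : orbit_average act pi f x <= 0.
  have := k1 x; rewrite kE; case: (orbit_average _ _ _ _) => //= r.
  by rewrite -EFinD !lee_fin gerDl.
have fpi_ge x : 0 <= - orbit_average act pi f x.
  by rewrite leeNr oppe0.
exists (fun x => 1 + f x - orbit_average act pi f x).
  have mh' : measurable_fun setT (fun x => 1 + f x - orbit_average act pi f x).
    have -> : (fun x => 1 + f x - orbit_average act pi f x) =
        fun x => h x + (1 - k x).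
      apply/funext => x; rewrite -hE kE; congr (_ + _).
      have := k0 x; have := fpi x; rewrite kE.
      case: (orbit_average _ _ _ _) => //= r _ _.
      by rewrite -EFinD; congr EFin; ring.
    by apply: emeasurable_funD => //; apply: emeasurable_funB => //; exact: mavg.
  have cls : exists f0 : X -> \bar R,
      [/\ measurable_fun setT f0, (forall x, -1 <= f0 x),
          (forall x, orbit_average act pi f0 x <= 0) &
          (fun x => 1 + f x - orbit_average act pi f x) =
          fun x => 1 + f0 x - orbit_average act pi f0 x].
    by exists f; split.
  split=> //; split=> // [x|mu Pmu].
    by apply: adde_ge0 => //; rewrite -hE.
  by rewrite integral1.
have hh' x : h x <= 1 + f x - orbit_average act pi f x.
  by rewrite -hE leeDl.
split=> [|mu _].
  by rewrite (_ : [set x | _] = set0)//; apply/seteqP; split => x //=.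
by rewrite (_ : [set x | _] = set0) ?measure0//; apply/seteqP; split => x //=.
Qed.

End invariant.

Theorem theorem6p5 (R : realType) :
  (* (i) *)
  (forall (d : measure_display) (X : measurableType d) (n : nat)
      (g : 'I_n -> X -> R),
    (0 < n)%N -> (forall i, measurable_fun setT (g i)) ->
    let P := generated_hypothesis (range g) in
    complete_class P (affine_class P g) /\
    ((forall f f' : X -> R, cone (range g) f -> cone (range g) f' ->
        qs P (fun x => f x <= f' x) -> qs P (fun x => f x = f' x)) ->
     minimal_complete_class P (affine_class P g))) /\
  (* (ii) *)
  (forall (psi : R -> \bar R) (lmax : \bar R)
      (psi_ge0 : forall l, (0 <= psi l)%E),
    closed_efun psi -> convex_efun psi -> psi 0 = 0%E -> (0 < lmax)%E ->
    (edom psi = EFin @^-1` right_open_params lmax \/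
     (edom psi = EFin @^-1` closed_params lmax /\ (lmax < +oo)%E)) ->
    let P := sub_psi psi_ge0 in
    let E' := mixture_class psi_ge0 lmax (closed_params lmax) in
    let E'0 := mixture_class psi_ge0 lmax (right_open_params lmax) in
    complete_class P E' /\
    (forall mubar : probability R R,
      (forall l, 0 <= l -> psi l = cgf mubar l) -> zero_mean mubar ->
      (exists x, limit_point (msupport mubar) x /\
                 (edom (econjugate psi))° x) ->
      (forall b : R, 0 <= b -> edom (econjugate psi) = [set x | x <= b] ->
         minimal_complete_class P E') /\
      (forall b : \bar R, (0 <= b)%E ->
         edom (econjugate psi) = [set x | (x%:E < b)%E] ->
         (* When lmax is in dom psi, no element of E'0 dominates the e-variable
            h_lmax, and E' is the minimal complete class. *)
         (edom psi = EFin @^-1` right_open_params lmax ->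
            minimal_complete_class P E'0) /\
         (edom psi = EFin @^-1` closed_params lmax -> (lmax < +oo)%E ->
            minimal_complete_class P E')))) /\
  (* (iii) *)
  (forall (G : topologicalGroupType) (d : measure_display)
      (X : measurableType d) (act : G -> X -> X)
      (pi : probability (borel_type G) R),
    compact [set: G] -> left_action act -> measurable_action act ->
    left_haar pi ->
    minimal_complete_class (invariant_hypothesis R act)
      (invariant_class act pi)).
Proof.
split.
  move=> d X n g _ mg P; split; first exact: affine_class_complete.
  by move=> H; exact: affine_class_minimal.
split; last first.
  by move=> G d X act pi _ lact mact haar; exact: invariant_class_minimal.
move=> psi lmax psi_ge0 cpsi convpsi psi0 lmax_gt0 psi_dom P E' E'0; split.
  exact: mixture_class_complete.
move=> mubar psi_cgf _ cluster; split=> b b0 XE.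
  by apply: mixture_class_closed_minimal XE cluster.
by apply: mixture_class_open_minimal XE cluster.
Qed.
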